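(* Let $p>3$ be a prime and let $G_p$ be the finite $p$-group defined below. Let $D_p$ be the number of isomorphism classes of immediate descendants of $G_p$ which have order $p^{10}$ and exponent $p$. Let $V_p$ be the number of pairs $(x,y)\in\mathbb{F}_p^2$ satisfying both $x^4+6x^2-3=0$ and $y^2=x^3-x$. Then: (1) if $p\equiv 5 \pmod{12}$ then $D_p=(p+1)^2/4+3$; (2) if $p\equiv 7 \pmod{12}$ then $D_p=(p+1)^2/2+2$; (3) if $p\equiv 11 \pmod{12}$ then $D_p=(p+1)^2/6+(p+1)/3+2$; (4) if $p\equiv 1 \pmod{12}$ and $V_p=0$ then $D_p=(p+1)^2/4+3$; (5) if $p\equiv 1 \pmod{12}$ and $V_p\neq 0$ then $D_p=(p-1)^2/36+(p-1)/3+4$.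
   Context: For a prime $p$, $G_p$ is the group of exponent $p$ and order $p^9$, nilpotent of class $2$, generated by $x_1,\dots,x_6,y_1,y_2,y_3$ subject to the commutator relations $[x_1,x_4]=y_3$, $[x_1,x_5]=y_1$, $[x_1,x_6]=y_2$, $[x_2,x_4]=y_1$, $[x_2,x_5]=y_3$, $[x_3,x_4]=y_2$, $[x_3,x_6]=y_1$, with all other commutators of pairs of generators equal to $1$ (so $y_1,y_2,y_3$ are central). An immediate descendant of $G_p$ is a finite $p$-group $K$ of nilpotency class exactly $3$ such that $K/\gamma_3(K)\cong G_p$, where $\gamma_3(K)$ is the third term of the lower central series of $K$. *)

(* Defs.v *)
From HB Require Import structures.
From mathcomp Require Import all_boot all_algebra all_fingroup all_solvable.
Set Implicit Arguments.
Unset Strict Implicit.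
Unset Printing Implicit Defensive.
Import GRing.Theory.

Local Open Scope group_scope.

Definition iso_Gp (p : nat) (gT : finGroupType) (Q : {group gT}) : Prop :=
  Q \isog Grp (x1 : x2 : x3 : x4 : x5 : x6 : y1 : y2 : y3 :
    x1 ^+ p, x2 ^+ p, x3 ^+ p, x4 ^+ p, x5 ^+ p, x6 ^+ p,
    y1 ^+ p, y2 ^+ p, y3 ^+ p,
    [~ x1, x4] = y3, [~ x1, x5] = y1, [~ x1, x6] = y2,
    [~ x2, x4] = y1, [~ x2, x5] = y3, [~ x3, x4] = y2, [~ x3, x6] = y1,
    [~ x1, x2], [~ x1, x3], [~ x2, x3], [~ x2, x6], [~ x3, x5],
    [~ x4, x5], [~ x4, x6], [~ x5, x6],
    [~ y1, x1], [~ y1, x2], [~ y1, x3], [~ y1, x4], [~ y1, x5], [~ y1, x6],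
    [~ y2, x1], [~ y2, x2], [~ y2, x3], [~ y2, x4], [~ y2, x5], [~ y2, x6],
    [~ y3, x1], [~ y3, x2], [~ y3, x3], [~ y3, x4], [~ y3, x5], [~ y3, x6],
    [~ y1, y2], [~ y1, y3], [~ y2, y3]).

Definition imm_desc (p : nat) (gT : finGroupType) (K : {group gT}) : Prop :=
  [/\ p.-group K, nilpotent K, nil_class K = 3 & iso_Gp p (K / 'L_3(K))%G].

Definition desc10 (p : nat) (gT : finGroupType) (K : {group gT}) : Prop :=
  [/\ imm_desc p K, #|K| = (p ^ 10)%N & exponent K = p].

Definition num_iso_classes
  (P : forall gT : finGroupType, {group gT} -> Prop) (n : nat) : Prop :=
  exists (T : 'I_n -> finGroupType) (G : forall i, {group T i}),
    [/\ forall i, P _ (G i),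
        forall i j, G i \isog G j -> i = j &
        forall (gT : finGroupType) (H : {group gT}), P gT H ->
          exists i, H \isog G i].

Local Open Scope ring_scope.

Definition Vp (p : nat) : nat :=
  #|[set xy : 'F_p * 'F_p |
      (xy.1 ^+ 4 + 6%:R * xy.1 ^+ 2 - 3%:R == 0) &&
      (xy.2 ^+ 2 == xy.1 ^+ 3 - xy.1)]|.

(* Main.v *)
(** A descendant K of order p^10 carries a canonical subgroup C = C_K(gamma_2),
    and its commutators give a net of quadratic forms on U = K/C (the polars of
    the cubic u2^3 + 3 u1^2 u2 + 3 u1 u3^2) together with an alternating form on
    C/gamma_2, which is identified with U up to a scalar.  An alternating form on
    U is a vector [al], and K is the split extension [mgrp al] of C by an
    elementary abelian group of order p^3.  Two of these groups are isomorphic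
    exactly when a similitude of the cubic maps one vector to the other, so D_p
    is the number of orbits of the group of similitudes on F_p^3.

    The orbits are counted with Burnside's lemma.  The similitudes act
    transitively on the F_p-rational flexes of the cubic; the stabiliser of the
    flex (0 : 0 : 1) is diagonal, cyclic of order 2 or 4 modulo scalars.  A
    similitude fixing no flex has at most 3(p - 1) eigenvectors, and integrality
    of the number of orbits then determines their total number.  The flexes other
    than (0 : 0 : 1) are the solutions of x^4 + 6 x^2 - 3 = 0,
    3 y^2 + x^3 + 3 x = 0, whose number is governed by p mod 12 and V_p. *)

From HB Require Import structures.
Require Import Defs.
From mathcomp Require Import all_boot all_algebra all_fingroup all_solvable.
From mathcomp Require Import finfield.
From mathcomp Require Import ring zify.
Set Implicit Arguments.
Unset Strict Implicit.
Unset Printing Implicit Defensive.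
Import GRing.Theory.
Local Open Scope ring_scope.

(** * The cubic form and the model groups *)

(** [G_p] itself does not separate [x1, x2, x3] from [x4, x5, x6]: its commutator map is a symmetric
    product on [F^3] tensored with the symplectic form of a plane, so [SL_2] acts on the pairs
    [(x_i, x_(3+i))]. Passing to class 3 breaks this symmetry. The Jacobi identity forces
    [[y_k, x_i]] and [[y_k, x_(3+i)]] to be [s] and [t] times the dual pairing, and the nonzero
    vector [(s, t)] is what singles out [C]. The cubic is an elliptic curve with [j = 1728]. With
    the flex [(0 : 0 : 1)] as origin, the flexes are its 3-torsion points and [x^4 + 6 x^2 - 3] is
    its 3-division polynomial. Modulo scalars the similitudes are the maps [P -> eps P + Q], with
    [eps] a fourth root of unity in the field and [Q] a rational flex. Since [1 - eps] is invertible
    on 3-torsion when [eps] is not 1, the maps that fix no flex are the nonzero translations. Their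
    eigenvectors depend on cube roots of unity; bounding the number of eigenvectors and using
    integrality avoids computing them. Hence the orbit number depends only on [p], the number of
    affine flexes and the number of fourth roots of unity. *)

Section Vectors.
Variable F : finFieldType.

Definition vec : Type := (F * F * F)%type.
HB.instance Definition _ := Finite.on vec.
HB.instance Definition _ := GRing.Zmodule.on vec.

Definition mkv (a b c : F) : vec := (a, b, c).
Definition co1 (u : vec) := u.1.1.
Definition co2 (u : vec) := u.1.2.
Definition co3 (u : vec) := u.2.
Definition scl (a : F) (u : vec) : vec := mkv (a * co1 u) (a * co2 u) (a * co3 u).

Definition dot (w u : vec) : F := co1 w * co1 u + co2 w * co2 u + co3 w * co3 u.
(** The commutator table of [G_p]: its entry for [x_i] and [x_(3+j)] is [tau e_i e_j], when
    [e1, e2, e3] stand for [y1, y3, y2]. In this order the table is symmetric, and [tri] is the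
    polar form of a cubic. *)
Definition tau (v u : vec) : vec :=
  mkv (co1 v * co2 u + co2 v * co1 u + co3 v * co3 u)
      (co1 v * co1 u + co2 v * co2 u) (co1 v * co3 u + co3 v * co1 u).
Definition tri (x y z : vec) : F := dot (tau x y) z.
Definition det3 (x y z : vec) : F :=
  co1 x * (co2 y * co3 z - co3 y * co2 z) - co2 x * (co1 y * co3 z - co3 y * co1 z)
  + co3 x * (co1 y * co2 z - co2 y * co1 z).

Lemma co1D u v : co1 (u + v) = co1 u + co1 v. Proof. by []. Qed.
Lemma co2D u v : co2 (u + v) = co2 u + co2 v. Proof. by []. Qed.
Lemma co3D u v : co3 (u + v) = co3 u + co3 v. Proof. by []. Qed.
Lemma co1N u : co1 (- u) = - co1 u. Proof. by []. Qed.
Lemma co2N u : co2 (- u) = - co2 u. Proof. by []. Qed.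
Lemma co3N u : co3 (- u) = - co3 u. Proof. by []. Qed.
Lemma co1_0 : co1 0 = 0. Proof. by []. Qed.
Lemma co2_0 : co2 0 = 0. Proof. by []. Qed.
Lemma co3_0 : co3 0 = 0. Proof. by []. Qed.
Lemma co1k a b c : co1 (mkv a b c) = a. Proof. by []. Qed.
Lemma co2k a b c : co2 (mkv a b c) = b. Proof. by []. Qed.
Lemma co3k a b c : co3 (mkv a b c) = c. Proof. by []. Qed.
Definition coordE := (co1D, co2D, co3D, co1N, co2N, co3N,
  co1_0, co2_0, co3_0, co1k, co2k, co3k).

Lemma vecP (u v : vec) : co1 u = co1 v -> co2 u = co2 v -> co3 u = co3 v -> u = v.
Proof.
by case: u => [[? ?] ?]; case: v => [[? ?] ?]; rewrite /co1 /co2 /co3 /= => -> -> ->.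
Qed.
End Vectors.
Arguments mkv {F}.

(** The coordinates of the variables are generalised, so that [ring] sees them as atoms. *)
Ltac vecring :=
  rewrite /tri /det3 /dot /tau /scl ?coordE;
  repeat match goal with
  | |- context [co1 ?u] => generalize (co1 u); intro
  | |- context [co2 ?u] => generalize (co2 u); intro
  | |- context [co3 ?u] => generalize (co3 u); intro
  end; ring.

Section Model.
Variables (F : finFieldType) (al : vec F).

(* [al] does not occur in the type: it only selects the group law. *)
Definition mgrp of vec F : Type := (vec F * vec F * vec F * F)%type.
HB.instance Definition _ := Finite.on (mgrp al).

Definition mg (u v w : vec F) (z : F) : mgrp al := (u, v, w, z).
Definition pu (g : mgrp al) : vec F := g.1.1.1.
Definition pv (g : mgrp al) : vec F := g.1.1.2.
Definition pw (g : mgrp al) : vec F := g.1.2.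
Definition pz (g : mgrp al) : F := g.2.

Lemma mgE g : g = mg (pu g) (pv g) (pw g) (pz g).
Proof. by case: g => [[[? ?] ?] ?]. Qed.

(** The element [(u, v, w, z)] stands for the word [X_u V_v W_w Z_z]. A vector [u] acts on the
    normal subgroup of the [(0, v, w, z)] as the exponential of [v -> 2 tau v u], [w -> dot w u];
    the factor 2 cancels the denominator of its quadratic term [tri v u u]. The cocycle [det3 al]
    makes the commutator of [v] and [v'] equal to [2 det3 al v v']. *)
Definition mmul (g h : mgrp al) : mgrp al :=
  mg (pu g + pu h) (pv g + pv h)
     (pw g + pw h + (tau (pv g) (pu h) + tau (pv g) (pu h)))
     (pz g + pz h + dot (pw g) (pu h) + tri (pv g) (pu h) (pu h)
      + det3 al (pv g) (pv h)).
Definition mone : mgrp al := mg 0 0 0 0.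
Definition minv (g : mgrp al) : mgrp al :=
  mg (- pu g) (- pv g) (- pw g + (tau (pv g) (pu g) + tau (pv g) (pu g)))
     (- pz g + dot (pw g) (pu g) - tri (pv g) (pu g) (pu g)).

Lemma mg_congr u v w z u' v' w' z' :
  u = u' -> v = v' -> w = w' -> z = z' -> mg u v w z = mg u' v' w' z'.
Proof. by move=> -> -> -> ->. Qed.

Lemma mmulA : associative mmul.
Proof.
move=> [[[u v] w] z] [[[u' v'] w'] z'] [[[u2 v2] w2] z2].
apply: mg_congr; rewrite /= ?addrA //.
  by apply: vecP; vecring.
by vecring.
Qed.

Lemma mmul1 : left_id mone mmul.
Proof.
move=> a; rewrite [RHS]mgE; apply: mg_congr; rewrite /= ?add0r //.
  by apply: vecP; vecring.
by vecring.
Qed.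

Lemma mmulV : left_inverse mone minv mmul.
Proof.
move=> a; apply: mg_congr; rewrite /= ?addNr //.
  by apply: vecP; vecring.
by vecring.
Qed.
HB.instance Definition _ := Finite_isGroup.Build (mgrp al) mmulA mmul1 mmulV.
End Model.

(** * Commutators, lower central series and powers in the model groups *)

Section ModelTheory.
Variables (F : finFieldType) (al : vec F).
Hypothesis F2 : (2%:R : F) != 0.
Implicit Types (g h : mgrp al) (u v w : vec F).

Definition dbl u := u + u.

Lemma puM g h : pu (g * h)%g = pu g + pu h. Proof. by []. Qed.
Lemma pvM g h : pv (g * h)%g = pv g + pv h. Proof. by []. Qed.
Lemma pwM g h : pw (g * h)%g = pw g + pw h + dbl (tau (pv g) (pu h)).
Proof. by []. Qed.
Lemma pzM g h : pz (g * h)%g = pz g + pz h + dot (pw g) (pu h)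
  + tri (pv g) (pu h) (pu h) + det3 al (pv g) (pv h).
Proof. by []. Qed.
Lemma puV g : pu g^-1%g = - pu g. Proof. by []. Qed.
Lemma pvV g : pv g^-1%g = - pv g. Proof. by []. Qed.

Lemma mgrpP g h :
  pu g = pu h -> pv g = pv h -> pw g = pw h -> pz g = pz h -> g = h.
Proof. by rewrite {5}(mgE g) {5}(mgE h) => -> -> -> ->. Qed.

Lemma puR g h : pu [~ g, h]%g = 0.
Proof. by rewrite /commg /conjg !(puM, puV) (addrC (pu g)) addKr addNr. Qed.

Lemma pvR g h : pv [~ g, h]%g = 0.
Proof. by rewrite /commg /conjg !(pvM, pvV) (addrC (pv g)) addKr addNr. Qed.

(** Read off from [g h = h g [g, h]], which avoids computing with inverses; the next two lemmas are
    obtained in the same way. *)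
Lemma pwR g h :
  pw [~ g, h]%g = dbl (tau (pv g) (pu h)) - dbl (tau (pv h) (pu g)).
Proof.
move: (commgC g h) (puR g h) (pvR g h); move: [~ g, h]%g => c /(congr1 (@pw _ _)).
rewrite !(pwM, puM, pvM) => e cu cv.
transitivity ((pw g + pw h + dbl (tau (pv g) (pu h)))
   - (pw g + pw h) - dbl (tau (pv h) (pu g))).
  by rewrite e cu; apply: vecP; rewrite /dbl; vecring.
by apply: vecP; rewrite /dbl; vecring.
Qed.

Lemma pzR2 g h : pu g = 0 -> pv g = 0 -> pz [~ g, h]%g = dot (pw g) (pu h).
Proof.
move=> gu gv; move: (commgC g h) (puR g h) (pvR g h).
move: [~ g, h]%g => c /(congr1 (@pz _ _)).
rewrite !(pzM, pwM, puM, pvM) gu gv => e cu cv.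
transitivity (pz g + pz h + dot (pw g) (pu h) + tri 0 (pu h) (pu h) +
      det3 al 0 (pv h) - pz g - pz h); last by vecring.
by rewrite e cu cv; vecring.
Qed.

Lemma pzR1 g h : pu g = 0 -> pu h = 0 ->
  pz [~ g, h]%g = det3 al (pv g) (pv h) + det3 al (pv g) (pv h).
Proof.
move=> gu hu; move: (commgC g h) (puR g h) (pvR g h).
move: [~ g, h]%g => c /(congr1 (@pz _ _)).
rewrite !(pzM, pwM, puM, pvM) gu hu => e cu cv.
transitivity (pz g + pz h + dot (pw g) 0 + tri (pv g) 0 0 +
    det3 al (pv g) (pv h) - pz g - pz h - det3 al (pv h) (pv g)).
  by rewrite e cu cv; vecring.
by vecring.
Qed.

Definition Xm u : mgrp al := mg al u 0 0 0.
Definition Vm v : mgrp al := mg al 0 v 0 0.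
Definition Wm w : mgrp al := mg al 0 0 w 0.
Definition Zm z : mgrp al := mg al 0 0 0 z.

Lemma pu_X u : pu (Xm u) = u. Proof. by []. Qed.
Lemma pv_X u : pv (Xm u) = 0. Proof. by []. Qed.
Lemma pw_X u : pw (Xm u) = 0. Proof. by []. Qed.
Lemma pz_X u : pz (Xm u) = 0. Proof. by []. Qed.
Lemma pu_V v : pu (Vm v) = 0. Proof. by []. Qed.
Lemma pv_V v : pv (Vm v) = v. Proof. by []. Qed.
Lemma pw_V v : pw (Vm v) = 0. Proof. by []. Qed.
Lemma pz_V v : pz (Vm v) = 0. Proof. by []. Qed.
Lemma pu_W w : pu (Wm w) = 0. Proof. by []. Qed.
Lemma pv_W w : pv (Wm w) = 0. Proof. by []. Qed.
Lemma pw_W w : pw (Wm w) = w. Proof. by []. Qed.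
Lemma pz_W w : pz (Wm w) = 0. Proof. by []. Qed.
Lemma pu_Z z : pu (Zm z) = 0. Proof. by []. Qed.
Lemma pv_Z z : pv (Zm z) = 0. Proof. by []. Qed.
Lemma pw_Z z : pw (Zm z) = 0. Proof. by []. Qed.
Lemma pz_Z z : pz (Zm z) = z. Proof. by []. Qed.
Definition genE := (pu_X, pv_X, pw_X, pz_X, pu_V, pv_V, pw_V, pz_V, pu_W, pv_W, pw_W, pz_W, pu_Z, pv_Z, pw_Z, pz_Z).

Definition N2 := [set g : mgrp al | (pu g == 0) && (pv g == 0)].
Definition N3 := [set g : mgrp al | [&& pu g == 0, pv g == 0 & pw g == 0]].

Lemma N2_group_set : group_set N2.
Proof.
apply/group_setP; split=> [|g h]; first by rewrite inE !eqxx.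
rewrite !inE => /andP[/eqP gu /eqP gv] /andP[/eqP hu /eqP hv].
by rewrite puM pvM gu gv hu hv addr0 !eqxx.
Qed.
Canonical N2_group := Group N2_group_set.

Lemma N3_group_set : group_set N3.
Proof.
apply/group_setP; split=> [|g h]; first by rewrite inE !eqxx.
rewrite !inE => /and3P[/eqP gu /eqP gv /eqP gw] /and3P[/eqP hu /eqP hv /eqP hw].
rewrite puM pvM pwM gu gv gw hu hv hw !addr0 !eqxx /= /dbl add0r.
by apply/eqP/vecP; vecring.
Qed.
Canonical N3_group := Group N3_group_set.

Lemma N3_comm g h : g \in N3 -> commute g h.
Proof.
rewrite inE => /and3P[/eqP gu /eqP gv /eqP gw]; apply/commgP/eqP.
have cw : pw [~ g, h]%g = 0 by rewrite pwR gu gv; apply: vecP; rewrite /dbl; vecring.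
apply: mgrpP; rewrite ?puR ?pvR ?cw //.
by rewrite pzR2 // gw [RHS](_ : _ = 0) //; vecring.
Qed.

Lemma lcn2_sub : 'L_2([set: mgrp al])%g \subset N2.
Proof.
rewrite lcnSn lcn1 gen_subG; apply/subsetP => _ /imset2P[g h _ _ ->].
by rewrite inE puR pvR !eqxx.
Qed.

Lemma lcn3_sub : 'L_3([set: mgrp al])%g \subset N3.
Proof.
rewrite lcnSn; apply: (subset_trans (commSg _ lcn2_sub)).
rewrite gen_subG; apply/subsetP => _ /imset2P[g h + _ ->].
rewrite !inE puR pvR !eqxx pwR => /andP[/eqP-> /eqP->] /=.
by apply/eqP/vecP; rewrite /dbl; vecring.
Qed.

Lemma lcn4 : 'L_4([set: mgrp al])%g = 1%g.
Proof.
rewrite lcnSn; apply/commG1P; apply: subset_trans lcn3_sub _.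
by apply/centsP => g gN h _; apply: N3_comm.
Qed.

Lemma mem_lcn2 g h : [~ g, h]%g \in 'L_2([set: mgrp al])%g.
Proof. by rewrite lcnSn lcn1 mem_commg ?inE. Qed.

Lemma mem_lcn3 g h k : [~ g, h, k]%g \in 'L_3([set: mgrp al])%g.
Proof. by rewrite lcnSn mem_commg ?mem_lcn2 ?inE. Qed.

Lemma lcn3E : 'L_3([set: mgrp al])%g = N3.
Proof.
apply/eqP; rewrite eqEsubset lcn3_sub; apply/subsetP => g.
rewrite inE => /and3P[/eqP gu /eqP gv /eqP gw].
(* With [a = pz g], [2 tau (0, a/2, 0) e1 = (a, 0, 0)], whose pairing with [e1] is [a]. *)
have -> : g = [~ Vm (mkv 0 (pz g / 2%:R) 0)%R, Xm (mkv 1 0 0)%R, Xm (mkv 1 0 0)%R]%g.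
  have e0 u : tau 0 u = 0 by apply: vecP; vecring.
  apply: mgrpP; rewrite ?puR ?pvR ?gu ?gv ?gw //.
    by rewrite pwR pvR puR !e0 subrr.
  rewrite pzR2 ?puR ?pvR // pwR !genE /dbl /tau /dot ?coordE; field.
  exact: F2.
exact: mem_lcn3.
Qed.

Lemma lcn2E : 'L_2([set: mgrp al])%g = N2.
Proof.
apply/eqP; rewrite eqEsubset lcn2_sub; apply/subsetP => g.
rewrite inE => /andP[/eqP gu /eqP gv].
(* The map [tau _ e1] swaps the first two coordinates, so half of the swapped [pw g] is a preimage
   of [pw g] under [2 tau _ e1]. *)
set c := [~ Vm (scl 2%:R^-1 (mkv (co2 (pw g)) (co1 (pw g)) (co3 (pw g))))%R,
  Xm (mkv 1 0 0)%R]%g.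
have cw : pw c = pw g.
  rewrite pwR !genE; apply: vecP; rewrite /dbl /tau /scl ?coordE; field; exact: F2.
rewrite -(mulKVg c g) groupM ?mem_lcn2 //.
apply: (subsetP (lcn_subS 2 _)); rewrite lcn3E.
have e : (g = c * (c^-1 * g))%g by rewrite mulKVg.
have uu : pu (c^-1 * g)%g = 0 by rewrite puM puV puR gu oppr0 addr0.
have vv : pv (c^-1 * g)%g = 0 by rewrite pvM pvV pvR gv oppr0 addr0.
rewrite inE uu vv !eqxx /=; move/(congr1 (@pw _ _)): e.
rewrite pwM uu pvR cw => e; apply/eqP.
transitivity (pw g - pw g); last by rewrite subrr.
by rewrite {1}e; apply: vecP; rewrite /dbl; vecring.
Qed.

Lemma nil_class_model : nilpotent [set: mgrp al] /\ nil_class [set: mgrp al] = 3.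
Proof.
have n : nilpotent [set: mgrp al] by apply/lcnP; exists 3; exact: lcn4.
split=> //; apply/eqP; rewrite eqn_leq; apply/andP; split.
  by apply/(lcn_nil_classP _ n); rewrite lcn4.
rewrite ltnNge; apply/negP => /(lcn_nil_classP _ n); rewrite lcn3E => e.
have : Zm 1 \in N3 by rewrite inE !eqxx.
by rewrite e => /set1P /(congr1 (@pz _ _)) /= /eqP; rewrite oner_eq0.
Qed.

(** Multiplying [g ^+ n] by [g] adds [n + 2 'C(n, 2) = n^2] to the coefficient of [tri], so this
    coefficient is the sum of the squares below [n]. At [n = p > 3] all the binomials are divisible
    by [p]. *)
Lemma expg_model g n :
  [/\ pu (g ^+ n)%g = pu g *+ n, pv (g ^+ n)%g = pv g *+ n,
      pw (g ^+ n)%g = pw g *+ n + dbl (tau (pv g) (pu g)) *+ 'C(n, 2) &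
      pz (g ^+ n)%g = pz g *+ n + dot (pw g) (pu g) *+ 'C(n, 2)
        + tri (pv g) (pu g) (pu g) *+ ('C(n, 2) + 'C(n, 3) + 'C(n, 3))].
Proof.
elim: n => [|n [IHu IHv IHw IHz]].
  by rewrite expg0 !bin0n !mulr0n !addr0.
rewrite expgSr puM pvM pwM pzM IHu IHv IHw IHz !binS bin1.
have dotD x y u : dot (x + y) u = dot x u + dot y u by vecring.
have dotN x u k : dot (x *+ k) u = dot x u *+ k.
  elim: k => [|k IH]; first by rewrite !mulr0n; vecring.
  by rewrite mulrSr dotD IH -mulrSr.
have tauD x y u : tau (x + y) u = tau x u + tau y u by apply: vecP; vecring.
have tauN x u k : tau (x *+ k) u = tau x u *+ k.
  elim: k => [|k IH]; first by rewrite !mulr0n; apply: vecP; vecring.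
  by rewrite mulrSr tauD IH -mulrSr.
have detD x y : det3 al (y + x) x = det3 al y x by vecring.
have detN x k : det3 al (x *+ k) x = 0.
  elim: k => [|k IH]; first by rewrite mulr0n; vecring.
  by rewrite mulrSr detD.
split; rewrite ?(mulrSr _ n) //.
  rewrite tauN /dbl !mulrnDr !mulrnDl -!addrA; congr (_ + _).
  by rewrite 2![_ + (pw g + _)]addrCA.
rewrite detN addr0 /tri tauN !dotD !dotN /dbl dotD.
by rewrite !mulrnDr; ring.
Qed.
End ModelTheory.

(** * Morphisms out of the model groups *)

Inductive ix := I1 | I2 | I3.

Definition eb (F : finFieldType) (i : ix) : vec F :=
  match i with I1 => mkv 1 0 0 | I2 => mkv 0 1 0 | I3 => mkv 0 0 1 end.
Arguments eb {F}.

Section PrimeField.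
Variables (p : nat) (F : finFieldType) (nv : F -> nat).
Hypothesis hp : prime p.
Hypothesis pF : p \in [pchar F].
Hypothesis nvK : forall a, (nv a)%:R = a.
Local Notation "x ^^ a" := (x ^+ nv a)%g (at level 29, left associativity).

(** When [x ^+ p = 1] only the class of the exponent modulo [p] matters. Elements of [F] can thus
    serve as exponents through their representatives [nv]. *)
Lemma expg_natr_eq (gT : finGroupType) (x : gT) m n :
  (x ^+ p = 1)%g -> m%:R = n%:R :> F -> (x ^+ m = x ^+ n)%g.
Proof.
move=> xp; wlog le : m n / (m <= n)%N => [IH e|e].
  by case/orP: (leq_total m n) => l; [apply: IH | apply/esym/IH].
have /eqP : (n - m)%:R = 0 :> F by rewrite natrB // e subrr.
rewrite -(dvdn_pcharf pF) => /dvdnP[k ek].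
by rewrite -(subnKC le) expgD ek mulnC expgM xp expg1n mulg1.
Qed.

Lemma expg_natr (gT : finGroupType) (x : gT) n :
  (x ^+ p = 1)%g -> x ^^ n%:R = (x ^+ n)%g.
Proof. by move=> xp; apply: expg_natr_eq; rewrite ?nvK. Qed.

Lemma expg_addF (gT : finGroupType) (x : gT) (a b : F) :
  (x ^+ p = 1 -> x ^^ (a + b)%R = x ^^ a * x ^^ b)%g.
Proof. by move=> xp; rewrite -expgD; apply: expg_natr_eq; rewrite // natrD !nvK. Qed.

Lemma expg_mulF (gT : finGroupType) (x : gT) (a b : F) :
  (x ^+ p = 1 -> x ^^ (a * b)%R = (x ^^ a) ^^ b)%g.
Proof. by move=> xp; rewrite -expgM; apply: expg_natr_eq; rewrite // natrM !nvK. Qed.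

Lemma expg_0F (gT : finGroupType) (x : gT) : (x ^+ p = 1)%g -> x ^^ 0 = 1%g.
Proof. by move=> xp; rewrite -[RHS](expg0 x); apply: expg_natr_eq; rewrite ?nvK. Qed.

Lemma expg_1F (gT : finGroupType) (x : gT) : (x ^+ p = 1)%g -> x ^^ 1%R = x.
Proof. by move=> xp; rewrite -[RHS](expg1 x); apply: expg_natr_eq; rewrite ?nvK. Qed.

Lemma expg_oppF (gT : finGroupType) (x : gT) (a : F) :
  (x ^+ p = 1 -> x ^^ (- a)%R = (x ^^ a)^-1)%g.
Proof.
move=> xp; apply/eqP; rewrite eq_sym eq_invg_mul -expg_addF //.
by rewrite subrr expg_0F.
Qed.

(** Scalars are natural numbers, so every vector is a sum of basis vectors; an additive statement
    need only be checked on the basis. *)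
Lemma vec_ind (P : vec F -> Prop) :
  (forall u v, P u -> P v -> P (u + v)) -> (forall i, P (eb i)) ->
  forall u, P u.
Proof.
move=> PD Pe u.
have Pn v n : P v -> P (v *+ n.+1).
  by move=> Pv; elim: n => [//|n IH]; rewrite mulrSr; apply: (PD).
have co_n (v : vec F) n : [/\ co1 (v *+ n) = co1 v *+ n, co2 (v *+ n) = co2 v *+ n &
    co3 (v *+ n) = co3 v *+ n].
  elim: n => [//|n [e1 e2 e3]]; by rewrite !mulrSr -e1 -e2 -e3 !coordE.
have Ps i (a : F) : P (scl a (eb i)).
  (* Adding [p] keeps the number of summands positive, since [P 0] is not among the assumptions. *)
  have -> : scl a (eb i) = eb i *+ (nv a + p)%N.
    have e (b : F) : b *+ (nv a + p)%N = a * b.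
      by rewrite mulrnDr -[b *+ p]mulr_natr (pcharf0 pF) mulr0 addr0 -mulr_natr nvK mulrC.
    have [h1 h2 h3] := co_n (eb i) (nv a + p)%N.
    by apply: vecP; rewrite ?h1 ?h2 ?h3 e.
  have e : (nv a + p = (nv a + p).-1.+1)%N by rewrite prednK // addn_gt0 (prime_gt0 hp) orbT.
  by rewrite e; apply: (Pn (eb i)); apply: Pe.
have -> : u = scl (co1 u) (eb I1) + scl (co2 u) (eb I2) + scl (co3 u) (eb I3).
  by apply: vecP; rewrite /eb; vecring.
by apply: (PD); [apply: (PD)|]; apply: (Ps).
Qed.

Section Universal.
Variables (al : vec F) (gT : finGroupType).
Variables (X V W : vec F -> gT) (Z : F -> gT).
Local Open Scope group_scope.
Hypothesis ZD : forall a b, Z (a + b)%R = Z a * Z b.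
Hypothesis XD : forall a b, X (a + b)%R = X a * X b.
Hypothesis WD : forall a b, W (a + b)%R = W a * W b.
Hypothesis VD : forall a b, V a * V b = V (a + b)%R * Z (det3 al a b).
Hypothesis ZX : forall z u, Z z * X u = X u * Z z.
Hypothesis ZV : forall z u, Z z * V u = V u * Z z.
Hypothesis ZW : forall z u, Z z * W u = W u * Z z.
Hypothesis WV : forall w v, W w * V v = V v * W w.
Hypothesis WX : forall w u, W w * X u = X u * W w * Z (dot w u).
Hypothesis VX : forall v u,
  V v * X u = X u * V v * W (dbl (tau v u)) * Z (tri v u u).

Definition umor (g : mgrp al) := X (pu g) * V (pv g) * W (pw g) * Z (pz g).

(** The relations are exactly those used to collect the product of two normal forms into one. *)
Lemma umorM : {morph umor : g h / g * h}.
Proof.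
(* The trailing 1 provides the remainder [r] in the rules below, which then apply anywhere in a
   right-associated word. *)
move=> g h; rewrite -[LHS]mulg1 -[RHS]mulg1 /umor -!mulgA.
have ZXr z u r : Z z * (X u * r) = X u * (Z z * r) by rewrite mulgA ZX -mulgA.
have ZVr z u r : Z z * (V u * r) = V u * (Z z * r) by rewrite mulgA ZV -mulgA.
have ZWr z u r : Z z * (W u * r) = W u * (Z z * r) by rewrite mulgA ZW -mulgA.
have WVr z u r : W z * (V u * r) = V u * (W z * r) by rewrite mulgA WV -mulgA.
have WXr w u r : W w * (X u * r) = X u * (W w * (Z (dot w u) * r)).
  by rewrite mulgA WX -!mulgA.
have VXr v u r : V v * (X u * r) =
    X u * (V v * (W (dbl (tau v u)) * (Z (tri v u u) * r))).
  by rewrite mulgA VX -!mulgA.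
have Vr a b r : V a * (V b * r) = V (a + b)%R * (Z (det3 al a b) * r).
  by rewrite mulgA VD -mulgA.
have Xr a b r : X a * (X b * r) = X (a + b)%R * r by rewrite XD mulgA.
have Wr a b r : W a * (W b * r) = W (a + b)%R * r by rewrite WD mulgA.
have Zr a b r : Z a * (Z b * r) = Z (a + b)%R * r by rewrite ZD mulgA.
rewrite !(ZXr, ZVr, ZWr, WVr, WXr, VXr, Vr, Xr, Wr, Zr).
rewrite puM pvM pwM pzM; congr (_ * (_ * (W _ * (Z _ * _)))).
  by apply: vecP; rewrite /dbl; vecring.
by rewrite /dbl; vecring.
Qed.
End Universal.

Section Basis.
Variables (al : vec F) (gT : finGroupType).
Variables (x v w : ix -> gT) (Z : F -> gT).
Local Open Scope group_scope.
Definition pw3 (y : ix -> gT) (u : vec F) : gT :=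
  locked (y I1 ^^ co1 u * y I2 ^^ co2 u * y I3 ^^ co3 u).
Let W := pw3 w.
(** The ordered products of powers of the [v i] multiply with a triangular cocycle. It differs from
    the alternating cocycle [det3 al] by the coboundary of this quadratic form. *)
Definition corrZ (u : vec F) : F := (- (co1 u * co2 u * det3 al (eb I1) (eb I2)
   + co1 u * co3 u * det3 al (eb I1) (eb I3)
   + co2 u * co3 u * det3 al (eb I2) (eb I3)))%R.

Hypothesis xp : forall i, x i ^+ p = 1.
Hypothesis vp : forall i, v i ^+ p = 1.
Hypothesis wp : forall i, w i ^+ p = 1.
Hypothesis ZD : forall a b, Z (a + b)%R = Z a * Z b.
Hypothesis xx : forall i j, commute (x i) (x j).
Hypothesis ww : forall i j, commute (w i) (w j).
Hypothesis wv : forall i j, commute (w i) (v j).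
Hypothesis Zx : forall z i, commute (Z z) (x i).
Hypothesis Zv : forall z i, commute (Z z) (v i).
Hypothesis Zw : forall z i, commute (Z z) (w i).
Hypothesis vv : forall i j, [~ v i, v j] = Z (det3 al (eb i) (eb j) *+ 2)%R.
Hypothesis wx : forall i j, w i * x j = x j * w i * Z (dot (eb i) (eb j)).
Hypothesis vx : forall i j, v i * x j =
  x j * v i * W (dbl (tau (eb i) (eb j))) * Z (tri (eb i) (eb j) (eb j)).

Lemma pw3_commute (y : ix -> gT) g u :
  (forall i, commute g (y i)) -> commute g (pw3 y u).
Proof. by move=> c; rewrite /pw3 -lock; do !apply: commuteM; apply: commuteX. Qed.

Lemma pw3D (y : ix -> gT) : (forall i, y i ^+ p = 1) ->
  (forall i j, commute (y i) (y j)) -> forall a b, pw3 y (a + b)%R = pw3 y a * pw3 y b.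
Proof.
move=> yp yy a b; rewrite /pw3 -!lock !coordE !expg_addF // -!mulgA; congr (_ * _).
have c i j (m n : nat) r : y i ^+ m * (y j ^+ n * r) = y j ^+ n * (y i ^+ m * r).
  by rewrite !mulgA; congr (_ * _); apply: commuteX2.
by rewrite (c I3 I1) (c I2 I1) (c I3 I2).
Qed.

Lemma pw3_eb (y : ix -> gT) i : (forall i, y i ^+ p = 1) -> pw3 y (eb i) = y i.
Proof.
by move=> yp; case: i; rewrite /pw3 -lock !coordE !expg_0F ?expg_1F ?mulg1 ?mul1g.
Qed.

Definition pwV (u : vec F) : gT := locked (pw3 v u * Z (corrZ u)).
Let V := pwV.

Lemma pw3V a b : V a * V b = V (a + b)%R * Z (det3 al a b).
Proof.
have ZX (z : F) n : Z z ^+ n = Z (z *+ n)%R.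
  elim: n => [|n IH]; last by rewrite expgSr IH mulrSr ZD.
  by rewrite expg0 mulr0n; apply: (mulgI (Z 0%R)); rewrite mulg1 -ZD addr0.
have sw i j (m n : F) r : v i ^^ m * (v j ^^ n * r) =
    v j ^^ n * (v i ^^ m * (Z (det3 al (eb i) (eb j) *+ 2 * m * n)%R * r)).
  rewrite mulgA (commgC (v i ^^ m)) commXXg.
  - rewrite vv ZX -!mulgA; congr (_ * (_ * (Z _ * r))).
    by rewrite -[LHS]mulr_natr natrM !nvK mulrA.
  - by rewrite vv; apply: commute_sym; apply: Zv.
  - by rewrite vv; apply: commute_sym; apply: Zv.
have Zvr z i (m : F) r : Z z * (v i ^^ m * r) = v i ^^ m * (Z z * r).
  by rewrite !mulgA; congr (_ * _); apply: commuteX; apply: Zv.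
have Zr c d r : Z c * (Z d * r) = Z (c + d)%R * r by rewrite ZD mulgA.
have vr i (c d : F) r : v i ^^ c * (v i ^^ d * r) = v i ^^ (c + d)%R * r.
  by rewrite expg_addF // mulgA.
rewrite -[LHS]mulg1 -[RHS]mulg1 /V /pwV /pw3 -!lock -!mulgA.
rewrite !(Zvr, Zr).
rewrite (sw I3 I1) (sw I2 I1) !(Zvr, Zr) vr (sw I3 I2) !(Zvr, Zr) vr vr.
rewrite !coordE; congr (_ * (_ * (_ * (Z _ * _)))).
by rewrite /corrZ /eb /det3 ?coordE; ring.
Qed.

(** A von Dyck principle for the model: relations between the basis images suffice, because both
    sides of [WX] and [VX] are compatible with addition in each argument and [vec_ind] applies
    twice. *)
Lemma basis_mor : exists f : mgrp al -> gT, [/\ {morph f : g h / g * h},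
  (forall g, f g = pw3 x (pu g) * V (pv g) * W (pw g) * Z (pz g)),
  (forall i, [/\ f (Xm al (eb i)) = x i, f (Vm al (eb i)) = v i &
     f (Wm al (eb i)) = w i]) & (forall a, f (Zm al a) = Z a)].
Proof.
have Z0 : Z 0%R = 1 by apply: (mulgI (Z 0%R)); rewrite mulg1 -ZD addr0.
have XD := pw3D xp xx; have WD : forall a b, W (a + b)%R = W a * W b := pw3D wp ww.
have ZX z u : Z z * pw3 x u = pw3 x u * Z z by apply: pw3_commute.
have ZW z u : Z z * W u = W u * Z z by apply: pw3_commute.
have ZZ a b : Z a * Z b = Z b * Z a by rewrite -!ZD addrC.
have ZV z u : Z z * V u = V u * Z z.
  by rewrite /V /pwV -lock mulgA (pw3_commute u (Zv z)) -!mulgA ZZ.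
have WV a b : W a * V b = V b * W a.
  rewrite /V /pwV -lock mulgA -[pw3 v b * _ * _]mulgA ZW mulgA; congr (_ * _).
  suff : commute (W a) (pw3 v b) by [].
  apply: pw3_commute => j; apply: commute_sym; apply: pw3_commute => i.
  by apply: commute_sym.
have X0 (y : ix -> gT) : (forall i, y i ^+ p = 1) -> pw3 y 0%R = 1.
  by move=> yp; rewrite /pw3 -lock !coordE !expg_0F // !mulg1.
have V0 : V 0%R = 1.
  by rewrite /V /pwV -lock X0 // mul1g -[RHS]Z0; congr Z; rewrite /corrZ ?coordE; ring.
have Ve i : V (eb i) = v i.
  rewrite /V /pwV -lock pw3_eb // (_ : corrZ _ = 0%R) ?Z0 ?mulg1 //.
  by case: i; rewrite /corrZ ?coordE; ring.
have ZXr z u r : Z z * (pw3 x u * r) = pw3 x u * (Z z * r) by rewrite mulgA ZX -mulgA.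
have ZVr z u r : Z z * (V u * r) = V u * (Z z * r) by rewrite mulgA ZV -mulgA.
have ZWr z u r : Z z * (W u * r) = W u * (Z z * r) by rewrite mulgA ZW -mulgA.
have WVr z u r : W z * (V u * r) = V u * (W z * r) by rewrite mulgA WV -mulgA.
have Vr a b r : V a * (V b * r) = V (a + b)%R * (Z (det3 al a b) * r).
  by rewrite mulgA pw3V -mulgA.
have Xr a b r : pw3 x a * (pw3 x b * r) = pw3 x (a + b)%R * r by rewrite XD mulgA.
have Wr a b r : W a * (W b * r) = W (a + b)%R * r by rewrite WD mulgA.
have Zr a b r : Z a * (Z b * r) = Z (a + b)%R * r by rewrite ZD mulgA.
have WX a b : W a * pw3 x b = pw3 x b * W a * Z (dot a b).
  move: a b; apply: vec_ind => [a a' IHa IHa' b|i].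
    rewrite WD -mulgA IHa' mulgA (mulgA (W a)) IHa -[LHS]mulg1 -[RHS]mulg1.
    rewrite -!mulgA !(ZXr, ZWr, ZVr, Zr, Wr) WD -?mulgA; congr (_ * (_ * (_ * (Z _ * _)))).
    by vecring.
  apply: vec_ind => [b b' IHb IHb'|j].
    rewrite XD mulgA IHb -mulgA ZX mulgA -(mulgA (pw3 x b)) IHb'.
    rewrite -[LHS]mulg1 -[RHS]mulg1 -!mulgA !(ZXr, ZWr, ZVr, Zr, Wr).
    congr (_ * (_ * (_ * (Z _ * _)))).
    by vecring.
  by rewrite [W _]pw3_eb // pw3_eb //; exact: wx.
have WXr a b r : W a * (pw3 x b * r) = pw3 x b * (W a * (Z (dot a b) * r)).
  by rewrite mulgA WX -!mulgA.
have VX a b : V a * pw3 x b =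
    pw3 x b * V a * W (dbl (tau a b)) * Z (tri a b b).
  move: a b; apply: vec_ind => [a a' IHa IHa' b|i].
    (* [V] is additive only up to the cocycle, whose inverse has to be carried along. *)
    have -> : V (a + a')%R = V a * V a' * Z (- det3 al a a')%R.
      by rewrite pw3V -mulgA -ZD subrr Z0 mulg1.
    have IHr r : V a * (pw3 x b * r) =
      pw3 x b * (V a * (W (dbl (tau a b)) * (Z (tri a b b) * r))).
      by rewrite mulgA IHa -!mulgA.
    have IHr' r : V a' * (pw3 x b * r) =
      pw3 x b * (V a' * (W (dbl (tau a' b)) * (Z (tri a' b b) * r))).
      by rewrite mulgA IHa' -!mulgA.
    rewrite -[LHS]mulg1 -[RHS]mulg1 -!mulgA.
    rewrite !(ZXr, IHr, IHr', ZWr, ZVr, WVr, Zr, Wr) !(Vr, ZWr, Zr).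
    congr (_ * (_ * (W _ * (Z _ * _)))); last by vecring.
    by apply: vecP; rewrite /dbl; vecring.
  apply: vec_ind => [b b' IHb IHb'|j]; last by rewrite Ve !pw3_eb //; apply: vx.
  have IHr r : V (eb i) * (pw3 x b * r) =
      pw3 x b * (V (eb i) * (W (dbl (tau (eb i) b)) * (Z (tri (eb i) b b) * r))).
    by rewrite mulgA IHb -!mulgA.
  have IHr' r : V (eb i) * (pw3 x b' * r) =
      pw3 x b' * (V (eb i) * (W (dbl (tau (eb i) b')) * (Z (tri (eb i) b' b') * r))).
    by rewrite mulgA IHb' -!mulgA.
  rewrite XD -[LHS]mulg1 -[RHS]mulg1 -!mulgA.
  rewrite !(IHr, IHr', ZXr, ZWr, ZVr, WVr, WXr, Vr, Zr, Wr).
  congr (_ * (_ * (_ * (W _ * (Z _ * _))))); last by rewrite /dbl; vecring.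
  by apply: vecP; rewrite /dbl; vecring.
exists (umor (al := al) (pw3 x) V W Z); split=> //.
- by apply: umorM => //; apply: pw3V.
- move=> i; rewrite /umor !genE V0 !X0 // Z0 [W 0%R]X0 // !mulg1 !mul1g.
  by rewrite Ve [W _]pw3_eb // pw3_eb.
- by move=> a; rewrite /umor !genE X0 // V0 [W 0%R]X0 // !mul1g.
Qed.
End Basis.
End PrimeField.

(** * The model groups are immediate descendants *)

Local Close Scope ring_scope.
Local Open Scope group_scope.

Definition tabA (gT : finGroupType) (y : ix -> gT) (i j : ix) : gT :=
  match i, j with
  | I1, I1 | I2, I2 => y I2
  | I1, I2 | I2, I1 | I3, I3 => y I1
  | I1, I3 | I3, I1 => y I3
  | I2, I3 | I3, I2 => 1
  end.

(** The presentation in families: [x] for [x1, x2, x3], [v] for [x4, x5, x6], and [y] for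
    [y1, y3, y2] in this order. *)
Definition Gp_rel p (gT : finGroupType) (x v y : ix -> gT) :=
  [/\ forall i, [/\ x i ^+ p = 1, v i ^+ p = 1 & y i ^+ p = 1],
      forall i j, [/\ commute (x i) (x j), commute (v i) (v j) &
                      commute (y i) (y j)],
      forall i j, commute (y i) (x j) /\ commute (y i) (v j) &
      forall i j, [~ x i, v j] = tabA y i j].

Definition tri_gen (gT : finGroupType) (x v y : ix -> gT) (H : {group gT}) :=
  (forall i, [/\ x i \in H, v i \in H & y i \in H]) /\
  (forall L : {group gT},
     (forall i, [/\ x i \in L, v i \in L & y i \in L]) -> H \subset L).

Definition fam (T : Type) (a b c : T) (i : ix) : T :=
  match i with I1 => a | I2 => b | I3 => c end.

(** Peels off one relation of a presentation. With the two [simpl never] flags it keeps the 45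
    relations of [G_p] from being unfolded at once. *)
Lemma and_relE (xT : finType) (x1 x2 : xT) (r : Presentation.rel_type) :
  Presentation.bool_of_rel (Presentation.and_rel x1 x2 r) =
  (x1 == x2) && Presentation.bool_of_rel r.
Proof. by case: r => //=; rewrite andbT. Qed.

Local Arguments Presentation.and_rel : simpl never.
Local Arguments Presentation.bool_of_rel : simpl never.

Lemma Gp_hom_rel p (gT : finGroupType) (H : {group gT}) :
  (H \homg Grp (x1 : x2 : x3 : x4 : x5 : x6 : y1 : y2 : y3 :
    x1 ^+ p, x2 ^+ p, x3 ^+ p, x4 ^+ p, x5 ^+ p, x6 ^+ p,
    y1 ^+ p, y2 ^+ p, y3 ^+ p,
    [~ x1, x4] = y3, [~ x1, x5] = y1, [~ x1, x6] = y2,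
    [~ x2, x4] = y1, [~ x2, x5] = y3, [~ x3, x4] = y2, [~ x3, x6] = y1,
    [~ x1, x2], [~ x1, x3], [~ x2, x3], [~ x2, x6], [~ x3, x5],
    [~ x4, x5], [~ x4, x6], [~ x5, x6],
    [~ y1, x1], [~ y1, x2], [~ y1, x3], [~ y1, x4], [~ y1, x5], [~ y1, x6],
    [~ y2, x1], [~ y2, x2], [~ y2, x3], [~ y2, x4], [~ y2, x5], [~ y2, x6],
    [~ y3, x1], [~ y3, x2], [~ y3, x3], [~ y3, x4], [~ y3, x5], [~ y3, x6],
    [~ y1, y2], [~ y1, y3], [~ y2, y3])) ->
  exists x v y : ix -> gT, Gp_rel p x v y /\ tri_gen x v y H.
Proof.
have cP (a b : gT) : [~ a, b] = 1 -> commute a b by move=> e; apply/commgP/eqP.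
have cP' (a b : gT) : commute a b -> [~ a, b] = 1 by move=> e; apply/eqP/commgP.
  case/existsP=> -[[[[[[[[x1 x2] x3] x4] x5] x6] y1] y2] y3] /=.
  rewrite !and_relE => /andP[/eqP defH].
  do 45![move=> /andP[/eqP ? ]]; move=> _.
  exists (fam x1 x2 x3), (fam x4 x5 x6), (fam y1 y3 y2); split; last first.
    split=> [[]|L LP] /=; rewrite -?defH.
    - by split; rewrite -cycle_subG; do ?[exact: joing_subr |
        apply: subset_trans (joing_subl _ _)].
    - by split; rewrite -cycle_subG; do ?[exact: joing_subr |
        apply: subset_trans (joing_subl _ _)].
    - by split; rewrite -cycle_subG; do ?[exact: joing_subr |
        apply: subset_trans (joing_subl _ _)].
    by case: (LP I1) (LP I2) (LP I3) => [? ? ?] [? ? ?] [? ? ?];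
       rewrite !join_subG !cycle_subG; do !(apply/andP; split).
  split=> [[]|[] []|[] []|[] []] //=; split=> //;
    by [apply: cP | apply: commute_sym; apply: cP].
Qed.

Lemma Gp_rel_hom p (gT : finGroupType) (H : {group gT}) :
  (exists x v y : ix -> gT, Gp_rel p x v y /\ tri_gen x v y H) ->
  (H \homg Grp (x1 : x2 : x3 : x4 : x5 : x6 : y1 : y2 : y3 :
    x1 ^+ p, x2 ^+ p, x3 ^+ p, x4 ^+ p, x5 ^+ p, x6 ^+ p,
    y1 ^+ p, y2 ^+ p, y3 ^+ p,
    [~ x1, x4] = y3, [~ x1, x5] = y1, [~ x1, x6] = y2,
    [~ x2, x4] = y1, [~ x2, x5] = y3, [~ x3, x4] = y2, [~ x3, x6] = y1,
    [~ x1, x2], [~ x1, x3], [~ x2, x3], [~ x2, x6], [~ x3, x5],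
    [~ x4, x5], [~ x4, x6], [~ x5, x6],
    [~ y1, x1], [~ y1, x2], [~ y1, x3], [~ y1, x4], [~ y1, x5], [~ y1, x6],
    [~ y2, x1], [~ y2, x2], [~ y2, x3], [~ y2, x4], [~ y2, x5], [~ y2, x6],
    [~ y3, x1], [~ y3, x2], [~ y3, x3], [~ y3, x4], [~ y3, x5], [~ y3, x6],
    [~ y1, y2], [~ y1, y3], [~ y2, y3])).
Proof.
have cP (a b : gT) : [~ a, b] = 1 -> commute a b by move=> e; apply/commgP/eqP.
have cP' (a b : gT) : commute a b -> [~ a, b] = 1 by move=> e; apply/eqP/commgP.
case=> x [v [y [[hX hC hY hA] [mem gen]]]].
apply/existsP; exists (x I1, x I2, x I3, v I1, v I2, v I3, y I1, y I3, y I2) => /=.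
have xp i : x i ^+ p = 1 by case: (hX i).
have vp i : v i ^+ p = 1 by case: (hX i).
have yp i : y i ^+ p = 1 by case: (hX i).
have xx i j : [~ x i, x j] = 1 by apply: cP'; case: (hC i j).
have vv i j : [~ v i, v j] = 1 by apply: cP'; case: (hC i j).
have yy i j : [~ y i, y j] = 1 by apply: cP'; case: (hC i j).
have yx i j : [~ y i, x j] = 1 by apply: cP'; case: (hY i j).
have yv i j : [~ y i, v j] = 1 by apply: cP'; case: (hY i j).
rewrite !and_relE !xp !vp !yp !hA !xx !vv !yy !yx !yv /= !eqxx /= andbT.
rewrite eqEsubset; apply/andP; split.
  by case: (mem I1) (mem I2) (mem I3) => [? ? ?] [? ? ?] [? ? ?];
    rewrite !join_subG !cycle_subG; do !(apply/andP; split).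
apply: gen => -[]; split; rewrite -cycle_subG; do ?[exact: joing_subr |
   apply: subset_trans (joing_subl _ _)]; exact: subxx.
Qed.

Section ModelDesc.
Variables (p : nat) (F : finFieldType) (nv : F -> nat).
Hypothesis hp : prime p.
Hypothesis hp3 : 3 < p.
Hypothesis pF : p \in [pchar F]%R.
Hypothesis cF : #|F| = p.
Hypothesis nvK : forall a, (nv a)%:R%R = a.

Lemma nz2F : (2%:R : F)%R != 0%R.
Proof. by rewrite -(dvdn_pcharf pF) gtnNdvd // (leq_trans _ hp3). Qed.

Lemma expg_model_p (al : vec F) (g : mgrp al) : g ^+ p = 1.
Proof.
have [eu ev eigs_diag ez] := expg_model g p.
have p2 : p %| 'C(p, 2) by rewrite prime_dvd_bin // (leq_trans _ hp3).
have p3 : p %| 'C(p, 3) by rewrite prime_dvd_bin.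
have Fn (a : F) n : p %| n -> (a *+ n = 0)%R.
  by rewrite (dvdn_pcharf pF) => /eqP e; rewrite -mulr_natr e mulr0.
have vn (a : vec F) n : p %| n -> (a *+ n = 0)%R.
  move=> pn; have co_n : [/\ co1 (a *+ n) = co1 a *+ n, co2 (a *+ n) = co2 a *+ n &
      co3 (a *+ n) = co3 a *+ n]%R.
    elim: (n) => [//|m [e1 e2 e3]]; by rewrite !mulrSr -e1 -e2 -e3 !coordE.
  by case: co_n => e1 e2 e3; apply: vecP; rewrite ?e1 ?e2 ?e3 Fn.
apply: mgrpP; rewrite ?eu ?ev ?eigs_diag ?ez ?vn ?Fn ?addr0 //.
by rewrite !dvdn_addr.
Qed.

Lemma card_model (al : vec F) : #|[set: mgrp al]| = (p ^ 10)%N.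
Proof. by rewrite cardsT !card_prod cF !expnS; ring. Qed.

Lemma exponent_model (al : vec F) : exponent [set: mgrp al] = p.
Proof.
have : exponent [set: mgrp al] %| p.
  by apply/exponentP => g _; apply: expg_model_p.
case/primeP: hp => _ pr /pr /orP[]/eqP // e1.
have : #|[set: mgrp al]| = 1%N.
  by apply/eqP; rewrite -trivg_card1 trivg_exponent e1.
by rewrite card_model => /eqP; rewrite -(exp1n 10) eqn_exp2r // => /eqP e; move: (hp3); rewrite e.
Qed.

(** In the model [[v, x]] is [W] of [2 tau], up to [Z], whereas the table gives [[x, v]], the
    inverse. This is why [w] is [y] to the power [-1/2]. *)
Lemma dbl_half_eb (gT : finGroupType) (y : ix -> gT) k :
  (forall i, y i ^+ p = 1) -> (forall i j, commute (y i) (y j)) ->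
  pw3 nv (fun i => y i ^+ nv (- 2%:R^-1)%R) (dbl (eb k)) = (y k)^-1.
Proof.
move=> yp yy; set w := (fun i => _).
have wp i : w i ^+ p = 1 by rewrite /w -expgM mulnC expgM yp expg1n.
rewrite /dbl (pw3D pF nvK) //; last by move=> i j; apply: commuteX2.
rewrite (pw3_eb pF nvK) // /w -(expg_addF pF nvK) //.
rewrite (_ : (_ + _)%R = - 1%R)%R; last by field; apply: nz2F.
by rewrite (expg_oppF pF nvK) // (expg_1F pF nvK).
Qed.

Definition tau_ix (i j : ix) : option ix :=
  match i, j with
  | I1, I1 | I2, I2 => Some I2
  | I1, I2 | I2, I1 | I3, I3 => Some I1
  | I1, I3 | I3, I1 => Some I3
  | I2, I3 | I3, I2 => None
  end.

Lemma tau_ebE i j : tau (eb i) (eb j) = oapp (@eb F) 0%R (tau_ix i j).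
Proof. by case: i; case: j; apply: vecP; rewrite /=; vecring. Qed.

Lemma tabAE (gT : finGroupType) (y : ix -> gT) i j :
  tabA y i j = oapp y 1 (tau_ix i j).
Proof. by case: i; case: j. Qed.

Lemma tau_ixC i j : tau_ix i j = tau_ix j i.
Proof. by case: i; case: j. Qed.

(** Collapsing [Z] to 1 turns the relations of the model into those of [G_p], so every group that
    satisfies the latter is an image of the model. *)
Lemma Gp_rel_mor (al : vec F) (rT : finGroupType) (x v y : ix -> rT) (H : {group rT}) :
  Gp_rel p x v y -> tri_gen x v y H ->
  exists f : {morphism [set: mgrp al] >-> rT},
    f @* [set: mgrp al] = H /\ forall a, f (Zm al a) = 1.
Proof.
case=> hX hC hY hA [mem gen].
pose w i := y i ^+ nv (- 2%:R^-1)%R.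
have yp i : y i ^+ p = 1 by case: (hX i).
have wp i : w i ^+ p = 1 by rewrite /w -expgM mulnC expgM yp expg1n.
have yy i j : commute (y i) (y j) by case: (hC i j).
have [|||||||||||||f [fM fF fE fZ]] :=
   @basis_mor p F nv hp pF nvK al rT x v w (fun _ => 1).
- by move=> i; case: (hX i).
- by move=> i; case: (hX i).
- exact: wp.
- by rewrite mulg1.
- by move=> i j; case: (hC i j).
- by move=> i j; apply: commuteX2.
- by move=> i j; apply: commute_sym; apply: commuteX; apply: commute_sym; case: (hY i j).
- by move=> *; apply: commute_sym; apply: commute1.
- by move=> *; apply: commute_sym; apply: commute1.
- by move=> *; apply: commute_sym; apply: commute1.
- by move=> i j; apply/eqP/commgP; case: (hC i j).
- move=> i j; rewrite mulg1; apply: commute_sym; apply: commuteX.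
  by apply: commute_sym; case: (hY i j).
- move=> i j; rewrite mulg1 (commgC (x j)) hA tabAE tau_ebE.
  rewrite -[LHS]mulg1 -(mulgA (v i * x j)) tau_ixC; congr (_ * _).
  case: (tau_ix _ _) => [k|] /=; first by rewrite [pw3 _ _ _](dbl_half_eb k yp yy) mulgV.
  rewrite mul1g /dbl addr0 /pw3 -lock !coordE !(expg_0F pF nvK) ?mulg1 //.
pose f' := @Morphism _ _ [set: mgrp al] f (in2W fM).
exists f'; split=> //; apply/eqP; rewrite eqEsubset; apply/andP; split.
  rewrite morphimEdom; apply/subsetP => _ /imsetP[g _ ->].
  rewrite /= fF /pwV /pw3 -!lock; case: (mem I1) (mem I2) (mem I3) => [? ? ?] [? ? ?] [? ? ?].
  by do !(apply: groupM || apply: groupX).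
have fim g : f g \in f' @* [set: mgrp al] by rewrite (mem_morphim f') ?inE.
have xL i : x i \in f' @* [set: mgrp al] by case: (fE i) => <-.
have vL i : v i \in f' @* [set: mgrp al] by case: (fE i) => _ <-.
apply: (gen) => -[]; split=> //.
- by rewrite -[y I1](hA I1 I2) groupR.
- by rewrite -[y I2](hA I1 I1) groupR.
- by rewrite -[y I3](hA I1 I3) groupR.
Qed.

Local Notation Q al := ([set: mgrp al] / 'L_3([set: mgrp al]))%g.

Lemma coset_model (al : vec F) (g h : mgrp al) :
  pu g = pu h -> pv g = pv h -> pw g = pw h ->
  coset 'L_3([set: mgrp al]) g = coset 'L_3([set: mgrp al]) h.
Proof.
move=> eu ev eigs_diag; have nL k : k \in 'N('L_3([set: mgrp al])).
  by rewrite (subsetP (lcn_norm 3 _)) ?inE.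
apply/eqP; rewrite -(mulKVg g h); move: (mulKVg g h); move: (g^-1 * h) => k e.
have ku : pu k = 0%R by apply: (addrI (pu g)); rewrite addr0 -puM e.
have kv : pv k = 0%R by apply: (addrI (pv g)); rewrite addr0 -pvM e.
suff kL : k \in 'L_3([set: mgrp al]) by rewrite morphM //= (coset_id kL) mulg1.
rewrite (lcn3E al nz2F) inE ku kv !eqxx /=.
move: eigs_diag; rewrite -e pwM ku => eigs_diag; apply/eqP.
transitivity (pw g - pw g)%R; last by rewrite subrr.
by rewrite {1}eigs_diag; apply: vecP; rewrite /dbl; vecring.
Qed.

Lemma model_iso_Gp (al : vec F) : iso_Gp p (Q al)%G.
Proof.
set L := 'L_3([set: mgrp al]).
have nL k : k \in 'N(L) by rewrite (subsetP (lcn_norm 3 _)) ?inE.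
have cQ k : coset L k \in Q al by rewrite mem_quotient ?inE.
apply: intro_isoGrp; last first.
  move=> rT H /Gp_hom_rel[x [v [y [rel gen]]]].
  have [f [fH fZ]] := Gp_rel_mor al rel gen.
  have nrm : L <| [set: mgrp al] by apply: lcn_normal.
  have fL : f @* L = 1.
    apply/trivgP/subsetP => _ /morphimP[g _ gL ->]; rewrite inE.
    have : g \in N3 al by rewrite -(lcn3E al nz2F).
    rewrite inE => /and3P[/eqP gu /eqP gv /eqP gw].
    by rewrite (_ : g = Zm al (pz g)) ?fZ //; apply: mgrpP.
  have : f @* [set: mgrp al] / f @* L \homg Q al.
    by apply/homgP; exists (quotm_morphism f nrm); rewrite morphim_quotm.
  rewrite fH fL; apply: homg_trans; apply: isog_hom; rewrite isog_sym.
  by rewrite isog_sym quotient1_isog.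
apply: Gp_rel_hom.
(* The commutator of [Xm e_i] and [Vm e_j] has [w]-coordinate [- 2 tau e_i e_j], whence the factor
   -2 in the images of the [y]. *)
exists (fun i => coset L (Xm al (eb i))), (fun i => coset L (Vm al (eb i))),
  (fun i => coset L (Wm al (scl (- 2%:R)%R (eb i)))); split.
  have cp k : coset L k ^+ p = 1 by rewrite -morphX // expg_model_p morph1.
  have cc k l : pw (k * l) = pw (l * k) -> commute (coset L k) (coset L l).
    move=> e; rewrite /commute -!morphM //; apply: coset_model => //.
    - by rewrite !puM addrC.
    - by rewrite !pvM addrC.
  split=> [i|i j|i j|i j]; first by split; apply: cp.
  - split; apply: cc; rewrite !pwM !genE; apply: vecP; rewrite /dbl; vecring.
  - split; apply: cc; rewrite !pwM !genE; apply: vecP; rewrite /dbl; vecring.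
  rewrite -morphR // tabAE.
  have -> : oapp (fun i0 => coset L (Wm al (scl (- 2%:R)%R (eb i0)))) 1 (tau_ix i j)
     = coset L (Wm al (scl (- 2%:R)%R (tau (eb i) (eb j)))).
    rewrite tau_ebE; case: (tau_ix _ _) => [k|] //=; rewrite -(morph1 (coset_morphism L)).
    by apply: coset_model => //=; apply: vecP; vecring.
  apply: coset_model; rewrite ?puR ?pvR ?genE // pwR !genE.
  by apply: vecP; rewrite /dbl; vecring.
split=> [i|M gens]; first by rewrite !cQ.
have Xin u : coset L (Xm al u) \in M.
  move: u; apply: (vec_ind hp pF nvK) => [u u' h h'|i]; last by case: (gens i).
  rewrite (_ : coset L _ = coset L (Xm al u) * coset L (Xm al u')) ?groupM //.
  by rewrite -morphM //; apply: coset_model; rewrite ?puM ?pvM ?pwM !genE ?addr0 //;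
    apply: vecP; rewrite /dbl; vecring.
have Vin u : coset L (Vm al u) \in M.
  move: u; apply: (vec_ind hp pF nvK) => [u u' h h'|i]; last by case: (gens i).
  rewrite (_ : coset L _ = coset L (Vm al u) * coset L (Vm al u')) ?groupM //.
  by rewrite -morphM //; apply: coset_model; rewrite ?puM ?pvM ?pwM !genE ?addr0 //;
    apply: vecP; rewrite /dbl; vecring.
have Win2 u : coset L (Wm al (scl (- 2%:R)%R u)) \in M.
  move: u; apply: (vec_ind hp pF nvK) => [u u' h h'|i]; last by case: (gens i).
  rewrite (_ : coset L _ = coset L (Wm al (scl (- 2%:R)%R u)) *
     coset L (Wm al (scl (- 2%:R)%R u'))) ?groupM //.
  by rewrite -morphM //; apply: coset_model; rewrite ?puM ?pvM ?pwM !genE ?addr0 //;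
    apply: vecP; rewrite /dbl; vecring.
have Win u : coset L (Wm al u) \in M.
  rewrite (_ : u = scl (- 2%:R)%R (scl (- 2%:R^-1)%R u)) //.
  by apply: vecP; rewrite /scl ?coordE; field; apply: nz2F.
apply/subsetP => _ /morphimP[g _ _ ->] /=.
rewrite (_ : coset L g = coset L (Xm al (pu g)) * coset L (Vm al (pv g)) *
   coset L (Wm al (pw g))) ?groupM //.
rewrite -!morphM //; apply: coset_model; rewrite ?puM ?pvM ?pwM !genE ?addr0 ?add0r //.
by apply: vecP; rewrite /dbl; vecring.
Qed.

Lemma model_desc10 (al : vec F) : desc10 p [set: mgrp al]%G.
Proof.
have [nl nc] := nil_class_model al nz2F.
split; [split=> // | exact: card_model | exact: exponent_model].
  by rewrite /pgroup card_model pnatX pnat_id.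
exact: model_iso_Gp.
Qed.

End ModelDesc.

(** * Every immediate descendant is a model group *)

Section ClassThree.
Variables (gT : finGroupType) (K : {group gT}).
Hypothesis L4 : 'L_4(K) = 1.

Lemma L3_comm g h : g \in 'L_3(K) -> h \in K -> commute g h.
Proof.
move=> gL hK; apply/commgP/eqP/set1P.
by rewrite -[[set _]]L4 lcnSn mem_commg.
Qed.

(** Elements central modulo [L_3]. Since [L_3] is central, taking commutators of such elements with
    elements of [K] is multiplicative in both arguments. *)
Definition inD c := c \in K /\ forall k, k \in K -> [~ c, k] \in 'L_3(K).

Lemma inDR g h : g \in K -> h \in K -> inD [~ g, h].
Proof.
move=> gK hK; split; first exact: groupR.
by move=> k kK; rewrite lcnSn mem_commg // lcnSn lcn1 mem_commg.
Qed.

Lemma inD_L3 c : c \in 'L_3(K) -> inD c.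
Proof.
move=> cL; split; first exact: (subsetP (lcn_sub 3 K)).
by move=> k kK; rewrite (eqP (introT commgP (L3_comm cL kK))).
Qed.

Lemma inD_conj c k h : inD c -> k \in K -> h \in K -> [~ c, k] ^ h = [~ c, k].
Proof.
by case=> _ cD kK hK; rewrite conjgE (L3_comm (cD _ kK) hK) mulKg.
Qed.

Lemma inDM c d : inD c -> inD d -> inD (c * d).
Proof.
move=> cD dD; case: (cD) (dD) => cK c3 [dK d3]; split; first exact: groupM.
by move=> k kK; rewrite commMgJ inD_conj // groupM ?c3 ?d3.
Qed.

Lemma commDMr c k l : inD c -> k \in K -> l \in K ->
  [~ c, k * l] = [~ c, k] * [~ c, l].
Proof.
move=> cD kK lK; rewrite commgMJ inD_conj //; apply: L3_comm; first by apply: cD.2.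
by apply: groupR => //; apply: cD.1.
Qed.

Lemma commDMl c d k : inD c -> inD d -> k \in K ->
  [~ c * d, k] = [~ c, k] * [~ d, k].
Proof. by move=> cD dD kK; rewrite commMgJ inD_conj //; apply: dD.1. Qed.

Lemma commDX c k n : inD c -> k \in K -> [~ c, k ^+ n] = [~ c, k] ^+ n.
Proof.
move=> cD kK; rewrite commgX //; apply/commute_sym/L3_comm => //; exact: cD.2.
Qed.

Lemma commXD c k n : inD c -> k \in K -> [~ c ^+ n, k] = [~ c, k] ^+ n.
Proof.
move=> cD kK; rewrite commXg //; apply/commute_sym/L3_comm; first exact: cD.2.
exact: cD.1.
Qed.

Lemma inDX c n : inD c -> inD (c ^+ n).
Proof.
move=> cD; split; first by apply: groupX; apply: cD.1.
by move=> k kK; rewrite commXD // groupX // cD.2.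
Qed.

Lemma commDV c k : inD c -> k \in K -> [~ c^-1, k] = [~ c, k]^-1.
Proof.
move=> cD kK; rewrite commVg //; apply/commute_sym/L3_comm; first exact: cD.2.
exact: cD.1.
Qed.

(** [[c, _]] is a homomorphism from [K] to an abelian group, so it kills commutators. *)
Lemma commDr1 c g h : inD c -> g \in K -> h \in K -> commute c [~ g, h].
Proof.
move=> cD gK hK; apply/commgP/eqP.
rewrite (_ : [~ g, h] = g^-1 * (h^-1 * (g * h))) //.
rewrite !commDMr ?groupM ?groupV //.
have cV k : k \in K -> [~ c, k^-1] = [~ c, k]^-1.
  move=> kK; apply/eqP; rewrite eq_sym eq_invg_mul -commDMr ?groupV //.
  by rewrite mulgV commg1.
have cAB : commute [~ c, g] [~ c, h].
  by apply: L3_comm; [apply: cD.2 | apply: groupR => //; apply: cD.1].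
rewrite !cV //; move: cAB; move: [~ c, g] [~ c, h] => A B ->.
by rewrite mulKg mulVg.
Qed.

(** The double commutators are central in class 3, so the conjugations in the Hall-Witt identity
    disappear and the Jacobi identity is left. *)
Lemma HallWitt3 a b c : a \in K -> b \in K -> c \in K ->
  [~ a, b, c] * [~ b, c, a] * [~ c, a, b] = 1.
Proof.
move=> aK bK cK.
have inv x y z : x \in K -> y \in K -> z \in K ->
    [~ x, y^-1, z] ^ y = [~ x, y, z]^-1.
  move=> xK yK zK; have D1 := inDR xK yK; have D2 := inDR xK (groupVr yK).
  rewrite inD_conj //.
  have e : [~ x, y^-1] ^ y = [~ x, y]^-1.
    apply/eqP; rewrite eq_sym eq_invg_mul -commgMJ mulVg.
    by rewrite commg1.
  have : [~ [~ x, y^-1] ^ y, z] = [~ x, y^-1, z].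
    rewrite conjg_mulR commDMl //; last by apply: inD_L3; apply: D2.2.
    by rewrite (eqP (introT commgP (L3_comm (D2.2 _ yK) zK))) mulg1.
  by rewrite e commDV.
have := Hall_Witt_identity a b c; rewrite !inv // => e.
have c3 x y z : x \in K -> y \in K -> z \in K -> [~ x, y, z] \in 'L_3(K).
  by move=> *; rewrite lcnSn mem_commg // lcnSn lcn1 mem_commg.
have m3 x y z : x \in K -> y \in K -> z \in K -> [~ x, y, z] \in K.
  by move=> *; rewrite !groupR.
have cc x y z x' y' z' : x \in K -> y \in K -> z \in K ->
    x' \in K -> y' \in K -> z' \in K -> commute [~ x, y, z] [~ x', y', z'].
  by move=> *; apply: L3_comm; [apply: c3 | apply: m3].
have c1 := cc _ _ _ _ _ _ aK bK cK bK cK aK.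
have c2 := cc _ _ _ _ _ _ cK aK bK bK cK aK.
have c4 := cc _ _ _ _ _ _ cK aK bK aK bK cK.
move: e c1 c2 c4; move: [~ a, b, c] [~ b, c, a] [~ c, a, b] => A B C.
move=> /(congr1 (@invg _)); rewrite !invMg !invgK invg1 => e cAB cCB cCA.
by rewrite cAB -(commuteM cCB cCA).
Qed.
End ClassThree.

Lemma tabAC (gT : finGroupType) (y : ix -> gT) i j : tabA y i j = tabA y j i.
Proof. by case: i; case: j. Qed.

(** The rigidity of the cubic: a pairing that makes the composite with [tau] symmetric is a multiple
    of the dual pairing, with [o] in the role of zero. The type is arbitrary because the lemma
    serves both for commutators in [K] and for bilinear forms over [F]. *)
Lemma tau_ix_symm_solve (T : Type) (o : T) (B : ix -> ix -> T) :
  (forall i i' j, oapp (B^~ i) o (tau_ix i' j) = oapp (B^~ i') o (tau_ix i j)) ->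
  forall k i, B k i = (match k, i with
    | I1, I1 | I2, I2 | I3, I3 => B I1 I1 | _, _ => o end).
Proof.
move=> H.
have e := (H I1 I2 I1, H I1 I2 I2, H I1 I2 I3, H I1 I3 I1, H I1 I3 I2, H I1 I3 I3,
           H I2 I3 I1, H I2 I3 I2, H I2 I3 I3).
move: e => /= [[[[[[[[e1 e2] e3] e4] e5] e6] e7] e8] e9].
by case; case=> //; congruence.
Qed.

(** The exponent is the determinant [ad - bc]: this is the [SL_2] symmetry between the [x_i] and the
    [v_i] in [G_p]. *)
Lemma commg_basis_change (gT : finGroupType) (x1 v1 x2 v2 A : gT) a b c d :
  commute x1 x2 -> commute v1 v2 -> [~ x1, v2] = A -> [~ x2, v1] = A ->
  commute A x1 -> commute A v1 -> commute A x2 -> commute A v2 ->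
  [~ x1 ^+ a * v1 ^+ b, x2 ^+ c * v2 ^+ d] = A ^+ (a * d) * (A ^+ (b * c))^-1.
Proof.
move=> xx vv e1 e2 Ax1 Av1 Ax2 Av2.
have cj (g h : gT) : commute g h -> g ^ h = g.
  by move=> gh; rewrite conjgE gh mulKg.
have q1 : [~ x1 ^+ a, x2 ^+ c * v2 ^+ d] = A ^+ (a * d).
  rewrite commgMJ (eqP (introT commgP (commuteX2 a c xx))) conj1g mulg1.
  by rewrite commXXg e1 //; apply: commute_sym.
have q2 : [~ v1 ^+ b, x2 ^+ c * v2 ^+ d] = (A ^+ (b * c))^-1.
  rewrite commgMJ (eqP (introT commgP (commuteX2 b d vv))) mul1g.
  rewrite -invg_comm commXXg e2; try exact: commute_sym.
  rewrite mulnC cj //; apply/commute_sym/commuteV/commute_sym.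
  by apply: commuteX2.
by rewrite commMgJ q1 q2 cj //; apply: commuteX2.
Qed.

(** * Generators of a descendant adapted to a model group *)

Section Classify.
Variables (p : nat) (F : finFieldType) (nv : F -> nat).
Hypothesis hp : prime p.
Hypothesis hp3 : 3 < p.
Hypothesis pF : p \in [pchar F]%R.
Hypothesis cF : #|F| = p.
Hypothesis nvK : forall a, (nv a)%:R%R = a.
Variables (gT : finGroupType) (K : {group gT}).
Hypothesis hK : desc10 p K.

Local Notation L3 := 'L_3(K).
Local Notation "x ^^ a" := (x ^+ nv a) (at level 29, left associativity).

Lemma K_L4 : 'L_4(K) = 1.
Proof. by case: hK => -[_ nl nc _] _ _; apply/(lcn_nil_classP 3 nl); rewrite nc. Qed.
Let L4 := K_L4.

Lemma K_exp g : g \in K -> g ^+ p = 1.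
Proof. by case: hK => _ _ <-; apply: expg_exponent. Qed.

Lemma card_N3 (al : vec F) : #|N3 al| = p.
Proof.
rewrite -cF -(card_imset _ (_ : injective (Zm al))).
  apply: eq_card => g; rewrite inE; apply/and3P/imsetP => [[/eqP gu /eqP gv /eqP gw]|].
    by exists (pz g) => //; apply: mgrpP.
  by case=> a _ ->; rewrite !genE !eqxx.
by move=> a b /(congr1 (@pz _ _)).
Qed.

(** [K / L_3] and the corresponding quotient of a model satisfy the same presentation, hence have
    the same order. As [K] and the model both have order [p^10], their third terms do too. *)
Lemma card_L3 : #|L3| = p.
Proof.
have [[_ _ _ isoQ] oK _] := hK.
pose al : vec F := 0%R.
have isoM := model_iso_Gp hp hp3 pF nvK al.
have e : (K / L3) \isog ([set: mgrp al] / 'L_3([set: mgrp al])).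
  rewrite isogEhom; apply/andP; split.
    by have := homg_refl (K / L3); rewrite (isoQ _ (K / L3)%G) -(isoM _ (K / L3)%G).
  have := homg_refl ([set: mgrp al] / 'L_3([set: mgrp al])).
  rewrite (isoM _ ([set: mgrp al] / 'L_3([set: mgrp al]))%G).
  by rewrite -(isoQ _ ([set: mgrp al] / 'L_3([set: mgrp al]))%G).
have := card_isog e; rewrite !card_quotient ?lcn_norm // => e2.
have lag (gT' : finGroupType) (G : {group gT'}) :
    (#|'L_3(G)| * #|G : 'L_3(G)| = #|G|)%N by apply: Lagrange; apply: lcn_sub.
have c3 : #|'L_3([set: mgrp al])| = p by rewrite (lcn3E al (nz2F hp3 pF)) card_N3.
have := lag _ K; rewrite e2 oK; have := lag _ [set: mgrp al]%G.
rewrite (card_model cF al) c3; move=> e3 /eqP; rewrite -{1}e3 eqn_pmul2r => [/eqP //|].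
by rewrite indexg_gt0.
Qed.

Lemma L3_gen : exists2 z, L3 = <[z]> & [/\ z \in L3, #[z] = p & z \in K].
Proof.
have /cyclicP[z zE] : cyclic L3 by apply: prime_cyclic; rewrite card_L3.
have zL : z \in L3 by rewrite zE cycle_id.
exists z => //; split=> //; first by rewrite orderE -zE card_L3.
exact: (subsetP (lcn_sub 3 K)).
Qed.

Lemma K_gen (x v y : ix -> gT) (xb vb yb : ix -> coset_of L3) :
  tri_gen xb vb yb (K / L3)%G ->
  (forall i, [/\ x i \in K, v i \in K & y i \in K]) ->
  (forall i, [/\ coset L3 (x i) = xb i, coset L3 (v i) = vb i &
     coset L3 (y i) = yb i]) ->
  forall M : {group gT}, L3 \subset M ->
  (forall i, [/\ x i \in M, v i \in M & y i \in M]) -> K \subset M.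
Proof.
move=> [_ gen] mK cE M LM xM.
have nK := subsetP (lcn_norm 3 K).
have nL g : g \in K -> g \in 'N(L3) by apply: nK.
rewrite -(quotientSGK (lcn_norm 3 K) LM).
apply: (gen (M / L3)%G) => i; have [xK vK yK] := mK i; have [<- <- <-] := cE i.
by case: (xM i) => *; split; apply: mem_quotient.
Qed.

Lemma coset_L3P z g h : L3 = <[z]> -> #[z] = p -> g \in K -> h \in K ->
  coset L3 g = coset L3 h -> exists a : F, g = h * z ^^ a.
Proof.
move=> zE oz gK hK' e; have nK := subsetP (lcn_norm 3 K).
have : h^-1 * g \in L3.
  apply: coset_idr; first by rewrite nK // groupM ?groupV.
  by rewrite morphM ?morphV ?nK ?groupV //= e mulVg.
rewrite zE => /cycleP[n e2]; exists (n%:R)%R.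
rewrite (expg_natr pF nvK) -?e2 ?mulKVg //.
by rewrite -oz expg_order.
Qed.

Lemma lift_fam (b : ix -> coset_of L3) : (forall i, b i \in K / L3) ->
  exists x : ix -> gT, forall i, x i \in K /\ coset L3 (x i) = b i.
Proof.
move=> bQ.
have lift c : c \in K / L3 -> exists g, g \in K /\ coset L3 g = c.
  by case/morphimP => g _ gK ->; exists g.
have [x1 h1] := lift _ (bQ I1); have [x2 h2] := lift _ (bQ I2).
by have [x3 h3] := lift _ (bQ I3); exists (fam x1 x2 x3); case.
Qed.

Lemma zeta_inj (z : gT) (a b : F) : #[z] = p -> z ^^ a = z ^^ b -> a = b.
Proof.
move=> oz /eqP; rewrite eq_expg_mod_order oz => e.
rewrite -(nvK a) -(nvK b).
wlog le : a b e / nv a <= nv b.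
  move=> IH; case/orP: (leq_total (nv a) (nv b)) => l; first exact: IH.
  by apply/esym/IH => //; rewrite eq_sym.
move: e; rewrite eq_sym eqn_mod_dvd // (dvdn_pcharf pF) natrB // subr_eq0.
by move/eqP.
Qed.


(** For arbitrary lifts, the Jacobi identity and [tau_ix_symm_solve] give [[y_k, x_i] = z^s] and
    [[y_k, v_i] = z^t] for [k = i], and 1 otherwise. If [s = t = 0], the [y_k] are central and [K]
    has class at most 2. Otherwise a change of basis of determinant 1 moves [(s, t)] to [(1, 0)]. *)
Lemma good_gens : exists (z : gT) (x v y : ix -> gT),
  [/\ L3 = <[z]> /\ #[z] = p,
      (forall i, [/\ x i \in K, v i \in K & inD K (y i)]),
      (forall i j, commute (y i) (y j)),
      (forall i j, [/\ exists a : F, [~ x i, x j] = z ^^ a,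
        exists a : F, [~ v i, v j] = z ^^ a &
        exists a : F, [~ x i, v j] = tabA y i j * z ^^ a]) &
      forall i j, [~ y i, x j] = z ^^ (dot (eb i) (eb j)) /\ [~ y i, v j] = 1].
Proof.
have [z zE [zL oz zK]] := L3_gen.
have [[_ nl nc isoQ] _ _] := hK.
have nK := subsetP (lcn_norm 3 K).
have nL g : g \in K -> g \in 'N(L3) by apply: nK.
have /Gp_hom_rel[xb [vb [yb [[hX hC hY hA] gen]]]] := isoGrp_hom isoQ.
have memQ i : [/\ xb i \in K / L3, vb i \in K / L3 & yb i \in K / L3] by apply: gen.1.
have [|x xP] := @lift_fam xb; first by move=> i; case: (memQ i).
have [|v vP] := @lift_fam vb; first by move=> i; case: (memQ i).
have [|y yP] := @lift_fam yb; first by move=> i; case: (memQ i).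
have xK i : x i \in K by case: (xP i).
have vK i : v i \in K by case: (vP i).
have yK i : y i \in K by case: (yP i).
have zp : z ^+ p = 1 by rewrite -oz expg_order.
have zLa (a : F) : z ^^ a \in L3 by apply: groupX.
have tabK i j : tabA y i j \in K by rewrite tabAE; case: (tau_ix i j) => /=.
have ctab i j : coset L3 (tabA y i j) = tabA yb i j.
  rewrite !tabAE; case: (tau_ix i j) => [k|] /=; first by case: (yP k).
  exact: (morph1 (coset_morphism L3)).
have xvE i j : exists a : F, [~ x i, v j] = tabA y i j * z ^^ a.
  apply: coset_L3P => //; first exact: groupR.
  by rewrite morphR ?nL //= ctab -hA; case: (xP i) => _ ->; case: (vP j) => _ ->.
have tabD i j : inD K (tabA y i j).
  have [a e] := xvE i j; rewrite (_ : tabA y i j = [~ x i, v j] * z ^^ (- a)%R).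
    by apply: (inDM L4); [apply: inDR | apply: (inD_L3 L4)].
  by rewrite e -mulgA -(expg_addF pF nvK) // subrr (expg_0F pF nvK) // mulg1.
have yD k : inD K (y k) by case: k; [exact: (tabD I1 I2)|exact: (tabD I1 I1)|exact: (tabD I1 I3)].
have L3_1 g k : g \in L3 -> k \in K -> [~ g, k] = 1.
  by move=> gL kK; apply/eqP/commgP; apply: (L3_comm L4).
have xvD i j k : k \in K -> [~ [~ x i, v j], k] = [~ tabA y i j, k].
  move=> kK; have [a ->] := xvE i j.
  by rewrite (commDMl L4) // ?(L3_1 (z ^^ a)) ?mulg1 //; apply: (inD_L3 L4).
(* Modulo [L_3] each [y j] is a commutator, and commutators commute with elements central modulo
   [L_3]. *)
have yy i j : commute (y i) (y j).
  have [i' [j' ej]] : exists i' j', y j = tabA y i' j'.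
    by case: j; [exists I1, I2|exists I1, I1|exists I1, I3].
  have [a e] := xvE i' j'.
  have -> : y j = [~ x i', v j'] * z ^^ (- a)%R.
    rewrite e ej -mulgA -(expg_addF pF nvK) // subrr (expg_0F pF nvK) // mulg1.
    by [].
  apply: commuteM; first exact: (commDr1 L4).
  by apply/commute_sym/(L3_comm L4).
have cosL g : g \in K -> coset L3 g = 1 -> g \in L3.
  by move=> gK e; apply: coset_idr => //; apply: nL.
have xxL i j : [~ x i, x j] \in L3.
  apply: cosL; first exact: groupR.
  rewrite morphR ?nL //=; case: (xP i) (xP j) => _ -> [_ ->].
  by apply/eqP/commgP; case: (hC i j).
have vvL i j : [~ v i, v j] \in L3.
  apply: cosL; first exact: groupR.
  rewrite morphR ?nL //=; case: (vP i) (vP j) => _ -> [_ ->].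
  by apply/eqP/commgP; case: (hC i j).
(* In the Jacobi identity for [x i], [x i'], [v j] the commutator [[x i, x i']] lies in [L_3] and
   drops out. *)
have eqX i i' j : [~ tabA y i' j, x i] = [~ tabA y i j, x i'].
  have := HallWitt3 L4 (xK i) (xK i') (vK j).
  rewrite (L3_1 _ _ (xxL i i') (vK j)) mul1g xvD // -[[~ v j, x i]]invg_comm (commDV L4) ?xvD //.
    by move=> /eqP; rewrite -eq_mulgV1 => /eqP.
  exact: inDR.
have eqV i i' j : [~ tabA y i' j, v i] = [~ tabA y i j, v i'].
  have := HallWitt3 L4 (vK i) (vK i') (xK j).
  rewrite (L3_1 _ _ (vvL i i') (xK j)) mul1g xvD // -[[~ v i', x j]]invg_comm (commDV L4) ?xvD //.
    by move=> /eqP; rewrite -eq_invg_mul invgK => /eqP; rewrite ![tabA y j _]tabAC.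
  exact: inDR.
have solve (t : ix -> gT) : (forall i i' j, [~ tabA y i' j, t i] = [~ tabA y i j, t i']) ->
    forall k i, [~ y k, t i] = (match k, i with
    | I1, I1 | I2, I2 | I3, I3 => [~ y I1, t I1] | _, _ => 1 end).
  move=> e; apply: (tau_ix_symm_solve (B := fun k i => [~ y k, t i])) => i i' j.
  have := e i i' j; rewrite !tabAE.
  by case: (tau_ix i' j) (tau_ix i j) => [k|] [l|] /=; rewrite ?comm1g.
have zdot (c : gT) (a : F) k i : c = z ^^ a ->
   (match k, i with I1, I1 | I2, I2 | I3, I3 => c | _, _ => 1 end)
     = z ^^ (a * dot (eb k) (eb i))%R.
  move=> ->; have e1 : dot (eb k) (eb i) =
      (match k, i with I1, I1 | I2, I2 | I3, I3 => 1 | _, _ => 0 end)%R :> F.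
    by case: k; case: i; rewrite /=; vecring.
  by rewrite e1; case: k {e1}; case: i => /=; rewrite ?mulr1 ?mulr0 ?(expg_0F pF nvK).
have toz g : g \in L3 -> exists a : F, g = z ^^ a.
  rewrite zE => /cycleP[n ->]; exists (n%:R)%R.
  by rewrite (expg_natr pF nvK).
have [s sE] : exists s : F, [~ y I1, x I1] = z ^^ s by apply: toz; apply: (yD I1).2.
have [t tE] : exists t : F, [~ y I1, v I1] = z ^^ t by apply: toz; apply: (yD I1).2.
have yx k i : [~ y k, x i] = z ^^ (s * dot (eb k) (eb i))%R.
  by rewrite solve //; apply: zdot.
have yv k i : [~ y k, v i] = z ^^ (t * dot (eb k) (eb i))%R.
  by rewrite solve //; apply: zdot.
have genK := K_gen gen (fun i => And3 (xK i) (vK i) (yK i))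
  (fun i => And3 (xP i).2 (vP i).2 (yP i).2).
have st : (s != 0%R) || (t != 0%R).
  apply: contraT; rewrite negb_or !negbK => /andP[/eqP s0 /eqP t0].
  have comy k g : g \in K -> commute (y k) g.
    have sub : K \subset 'C[y k].
      apply: genK => [|i]; first by apply/subsetP => l lL; apply/cent1P/(L3_comm L4).
      split; apply/cent1P; apply/commute_sym => //; apply/commgP.
      - by rewrite yx s0 mul0r (expg_0F pF nvK).
      - by rewrite yv t0 mul0r (expg_0F pF nvK).
    by move/(subsetP sub)/cent1P/commute_sym.
  have yZ k : y k \in 'Z(K).
    by apply/centerP; split=> // g /(comy k).
  have LZ : L3 \subset 'Z(K).
    apply/subsetP => l lL; apply/centerP; split; first exact: (subsetP (lcn_sub 3 K)).
    by move=> g; apply: (L3_comm L4).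
  have nZ g : g \in K -> g \in 'N('Z(K)) by apply: (subsetP (normal_norm (center_normal K))).
  have xvZ i j : [~ x i, v j] \in 'Z(K).
    have [a ->] := xvE i j; apply: groupM; last exact: (subsetP LZ).
    rewrite tabAE; by case: (tau_ix i j) => [k|] /=; [exact: yZ | exact: group1].
  have comZ g h : g \in K -> h \in K -> [~ g, h] \in 'Z(K) ->
      commute (coset 'Z(K) g) (coset 'Z(K) h).
    by move=> gK hK' ghZ; apply/commgP; rewrite -morphR ?nZ //= coset_id.
  have yZh k h : h \in K -> [~ y k, h] \in 'Z(K).
    by move=> hK'; rewrite (eqP (introT commgP (comy k h hK'))).
  have Zc g h : [~ g, h] \in 'Z(K) -> [~ h, g] \in 'Z(K).
    by move=> ?; rewrite -invg_comm groupV.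
  have genA g : g \in K ->
     (forall i, [/\ [~ g, x i] \in 'Z(K), [~ g, v i] \in 'Z(K) & [~ g, y i] \in 'Z(K)]) ->
     forall h, h \in K -> commute (coset 'Z(K) g) (coset 'Z(K) h).
    move=> gK gP.
    have sub : K \subset coset 'Z(K) @*^-1 'C[coset 'Z(K) g].
      apply: genK => [|i].
        apply/subsetP => l lL; rewrite mem_morphpre ?nZ ?(subsetP (lcn_sub 3 K)) //.
        by rewrite /= coset_id ?(subsetP LZ) ?group1.
      by case: (gP i) => *; split; rewrite mem_morphpre ?nZ //; apply/cent1P/commute_sym/comZ.
    by move=> h /(subsetP sub) /morphpreP[_ /cent1P /commute_sym].
  have xc i h : h \in K -> commute (coset 'Z(K) (x i)) (coset 'Z(K) h).
    apply: genA => // j; split; [|exact: xvZ|by apply: Zc; apply: yZh].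
    exact: (subsetP LZ).
  have vc i h : h \in K -> commute (coset 'Z(K) (v i)) (coset 'Z(K) h).
    apply: genA => // j; split; [by apply: Zc; apply: xvZ| |by apply: Zc; apply: yZh].
    exact: (subsetP LZ).
  have ab : abelian (K / 'Z(K)).
    rewrite /abelian sub_quotient_pre ?(normal_norm (center_normal K)) //.
    have sub : K \subset coset 'Z(K) @*^-1 'C(K / 'Z(K)).
      apply: genK => [|i].
        apply/subsetP => l lL; rewrite mem_morphpre ?nZ ?(subsetP (lcn_sub 3 K)) //.
        by rewrite /= coset_id ?(subsetP LZ) ?group1.
      split; rewrite mem_morphpre ?nZ //; apply/centP => _ /morphimP[h _ hK' ->].
      - exact: xc.
      - exact: vc.
      - by apply: comZ => //; apply: yZh.
    exact: sub.
  have L31 : L3 = 1.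
    rewrite lcnSn lcn2; apply/commG1P; apply: (subset_trans (der1_min _ ab)).
      exact: (normal_norm (center_normal K)).
    exact: subsetIr.
  by have := card_L3; rewrite L31 cards1 => e; move: (hp3); rewrite -e.
have [a [b ab]] : exists a b : F, (a * s + b * t = 1)%R.
  case/orP: st => n0; first by exists (s^-1)%R, 0%R; rewrite mulVf // mul0r addr0.
  by exists 0%R, (t^-1)%R; rewrite mulVf // mul0r add0r.
(* The change of basis has determinant [a s + b t = 1], and the exponents [(-t, s)] of [V] pair to
   zero with [(s, t)]. *)
pose X i := x i ^^ a * v i ^^ b; pose V i := x i ^^ (- t)%R * v i ^^ s.
have mK i c d : x i ^^ c * v i ^^ d \in K by rewrite groupM ?groupX.
have bc i j c d c' d' :
   coset L3 [~ x i ^^ c * v i ^^ d, x j ^^ c' * v j ^^ d'] =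
   tabA yb i j ^^ (c * d' - d * c')%R.
  have tp : tabA yb i j ^+ p = 1.
    by rewrite tabAE; case: (tau_ix i j) => [k|]; rewrite ?expg1n //=; case: (hX k).
  have tc k : commute (tabA yb i j) (xb k) /\ commute (tabA yb i j) (vb k).
    rewrite tabAE; case: (tau_ix i j) => [l|] /=; first exact: hY.
    by split; apply/commute_sym/commute1.
  rewrite morphR ?nL //= !morphM ?morphX ?nL ?groupX //=.
  case: (xP i) (xP j) (vP i) (vP j) => _ -> [_ ->] [_ ->] [_ ->].
  rewrite (@commg_basis_change _ _ _ _ _ (tabA yb i j)); last first.
  - by case: (tc j).
  - by case: (tc j).
  - by case: (tc i).
  - by case: (tc i).
  - by rewrite hA tabAC.
  - exact: hA.
  - by case: (hC i j).
  - by case: (hC i j).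
  rewrite !expgM -!(expg_mulF pF nvK) // (expg_addF pF nvK) // (expg_oppF pF nvK) //.
have yg i j c d : [~ y i, x j ^^ c * v j ^^ d] =
    z ^^ ((s * c + t * d) * dot (eb i) (eb j))%R.
  rewrite (commDMr L4) ?groupX // !(commDX L4) // yx yv -!(expg_mulF pF nvK) //.
  by rewrite -(expg_addF pF nvK) //; congr (z ^^ _); ring.
have one (g : coset_of L3) : g ^+ p = 1 -> g ^^ 0%R = 1 by apply: (expg_0F pF nvK).
have tp i j : tabA yb i j ^+ p = 1.
  by rewrite tabAE; case: (tau_ix i j) => [k|]; rewrite ?expg1n //=; case: (hX k).
have toz1 g : g \in K -> coset L3 g = 1 -> exists a : F, g = z ^^ a.
  by move=> gK e; apply: toz; apply: cosL.
exists z, X, V, y; split=> //.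
- by move=> i; split; [apply: mK | apply: mK | apply: yD].
- move=> i j; split.
  - apply: toz1; first by rewrite groupR ?mK.
    by rewrite bc (_ : (_ - _)%R = 0%R) ?one //; ring.
  - apply: toz1; first by rewrite groupR ?mK.
    by rewrite bc (_ : (_ - _)%R = 0%R) ?one //; ring.
  - apply: coset_L3P => //; first by rewrite groupR ?mK.
    rewrite bc ctab (_ : (_ - _)%R = 1%R) ?(expg_1F pF nvK) //.
    by rewrite -ab; ring.
move=> i j; rewrite /X /V !yg; split.
  by congr (z ^^ _); rewrite -[RHS]mul1r -ab; ring.
by rewrite (_ : (_ * _)%R = 0%R) ?(expg_0F pF nvK) //; ring.
Qed.


(** Multiplying [x i] and [v j] by elements of the image of [W] shifts commutators by elements of
    [L_3]. This makes the [x i] commute and gives [[v i, x j]] its model value. The [[v i, v j]] are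
    not changed by it: they form the alternating form recorded by [al]. *)
Lemma classify : exists al : vec F, K \isog [set: mgrp al].
Proof.
have [z [x [v [y [[zE oz] mK yy cc yc]]]]] := good_gens.
have xK i : x i \in K by case: (mK i).
have vK i : v i \in K by case: (mK i).
have yD i : inD K (y i) by case: (mK i).
have yK i : y i \in K by case: (yD i).
have zp : z ^+ p = 1 by rewrite -oz expg_order.
have zLa (a : F) : z ^^ a \in L3 by rewrite zE groupX ?cycle_id.
have n2 := nz2F hp3 pF.
pose h : F := (- 2%:R^-1)%R.
have hh : ((-2%:R) * h = 1 :> F)%R by rewrite /h; field; exact: n2.
pose Z (a : F) := z ^^ (h * a)%R.
have ZD a b : Z (a + b)%R = Z a * Z b by rewrite /Z mulrDr (expg_addF pF nvK).
have Z0 : Z 0%R = 1 by rewrite /Z mulr0 (expg_0F pF nvK).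
have ZL a : Z a \in L3 by apply: zLa.
have Zinj a b : Z a = Z b -> a = b.
  move/(zeta_inj oz)/(congr1 (fun c => (-2%:R) * c)%R); by rewrite !mulrA hh !mul1r.
have toZ (a : F) : z ^^ a = Z (-2%:R * a)%R.
  by rewrite /Z mulrA (mulrC h) hh mul1r.
have ZV a : Z (- a)%R = (Z a)^-1.
  by apply/eqP; rewrite eq_sym eq_invg_mul -ZD subrr Z0.
have Zc a g : g \in K -> commute (Z a) g by move=> gK; apply: (L3_comm L4).
pose w i := y i ^^ h.
have wD i : inD K (w i) by apply: (inDX L4).
have wK i : w i \in K by apply: groupX.
have wp i : w i ^+ p = 1 by apply: K_exp.
have ww i j : commute (w i) (w j) by apply: commuteX2.
have wx i j : [~ w i, x j] = Z (dot (eb i) (eb j)).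
  rewrite (commXD L4) //; case: (yc i j) => -> _.
  by rewrite -(expg_mulF pF nvK) // mulrC.
have wv i j : [~ w i, v j] = 1.
  by rewrite (commXD L4) //; case: (yc i j) => _ ->; rewrite expg1n.
pose W u := pw3 nv w u.
have WD : forall a b, W (a + b)%R = W a * W b by apply: (pw3D pF nvK).
have We i : W (eb i) = w i by apply: (pw3_eb pF nvK).
have WinD u : inD K (W u).
  by rewrite /W /pw3 -lock; do !apply: (inDM L4); apply: (inDX L4).
have WK u : W u \in K by case: (WinD u).
have Wx u j : [~ W u, x j] = Z (dot u (eb j)).
  move: u; apply: (vec_ind hp pF nvK) => [a b IHa IHb|i]; last by rewrite We.
  by rewrite WD (commDMl L4) // IHa IHb -ZD; congr Z; vecring.
have Wv u j : [~ W u, v j] = 1.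
  move: u; apply: (vec_ind hp pF nvK) => [a b IHa IHb|i]; last by rewrite We.
  by rewrite WD (commDMl L4) // IHa IHb mulg1.
have WW a b : commute (W a) (W b).
  by rewrite /commute -!WD addrC.
have choose3 (P : ix -> F -> Prop) : (forall i, exists a, P i a) ->
    exists f : ix -> F, forall i, P i (f i).
  move=> H; have [a1 h1] := H I1; have [a2 h2] := H I2; have [a3 h3] := H I3.
  by exists (fam a1 a2 a3); case.
have choose9 (P : ix -> ix -> F -> Prop) : (forall i j, exists a, P i j a) ->
    exists f : ix -> ix -> F, forall i j, P i j (f i j).
  move=> H; have H' i : exists f : ix -> F, forall j, P i j (f j) by apply: choose3.
  have [f1 h1] := H' I1; have [f2 h2] := H' I2; have [f3 h3] := H' I3.
  by exists (fam f1 f2 f3); case.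
have [c cE] : exists c : ix -> ix -> F, forall i j, [~ x i, x j] = Z (c i j).
  by apply: (choose9 (fun i j a => [~ x i, x j] = Z a)) => i j; case: (cc i j) => -[a ->] _ _; rewrite toZ; eexists.
have [e eE] : exists e : ix -> ix -> F, forall i j, [~ v i, v j] = Z (e i j).
  by apply: (choose9 (fun i j a => [~ v i, v j] = Z a)) => i j; case: (cc i j) => _ [a ->] _; rewrite toZ; eexists.
have [d dE] : exists d : ix -> ix -> F, forall i j, [~ x i, v j] = tabA y i j * Z (d i j).
  by apply: (choose9 (fun i j a => [~ x i, v j] = tabA y i j * Z a)) => i j; case: (cc i j) => _ _ [a ->]; rewrite toZ; eexists.
have anti (t : ix -> gT) (q : ix -> ix -> F) :
    (forall i j, [~ t i, t j] = Z (q i j)) -> forall i j, q j i = (- q i j)%R.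
  by move=> tq i j; apply: Zinj; rewrite ZV -!tq invg_comm.
have cA := anti _ _ cE; have eA := anti _ _ eE.
have e0 i : e i i = 0%R by apply: Zinj; rewrite -eE commgg Z0.
(* The corrections of [X i] and [X j] contribute equally to [[X i, X j]], so each cancels half of
   [c i j], whence [h = -1/2]. *)
pose hx i : vec F := scl h (mkv (c i I1) (c i I2) (c i I3)).
pose hv j : vec F := mkv (d I1 j + tri (eb j) (eb I1) (eb I1))%R
  (d I2 j + tri (eb j) (eb I2) (eb I2))%R (d I3 j + tri (eb j) (eb I3) (eb I3))%R.
pose X i := x i * W (hx i); pose V i := v i * W (hv i).
have XK i : X i \in K by apply: groupM.
have VK i : V i \in K by apply: groupM.
have commM4 a b c' d' : a \in K -> c' \in K -> inD K b -> inD K d' -> commute b d' ->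
    [~ a * b, c' * d'] = [~ d', a]^-1 * [~ a, c'] * [~ b, c'].
  move=> aK cK bD dD bd; have [[bK _] [dK _]] := (bD, dD).
  have cj (g h' : gT) : commute g h' -> g ^ h' = g.
    by move=> gh; rewrite conjgE gh mulKg.
  rewrite commMgJ (commDMr L4 bD cK dK) (eqP (introT commgP bd)) mulg1.
  rewrite [[~ a, c' * d']]commgMJ (cj [~ a, c'] d'); last first.
    exact/commute_sym/(commDr1 L4).
  rewrite -[[~ a, d']]invg_comm cj //; apply/commute_sym/commuteM.
    by apply/commuteV/commute_sym/(L3_comm L4) => //; apply: dD.2.
  exact: (commDr1 L4).
have XX i j : [~ X i, X j] = 1.
  rewrite commM4 // !Wx cE -ZV -!ZD -[RHS]Z0; congr Z.
  have hE a b : dot (hx a) (eb b) = (h * c a b)%R by case: b; rewrite /hx; vecring.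
  rewrite !hE (cA i j) /h; field; exact: n2.
have VV i j : [~ V i, V j] = Z (e i j).
  by rewrite commM4 // !Wv eE invg1 mul1g mulg1.
have W0 : W 0%R = 1.
  by apply: (mulgI (W 0%R)); rewrite mulg1 -WD addr0.
have VX i j : [~ V i, X j] =
    W (dbl (tau (eb i) (eb j))) * Z (tri (eb i) (eb j) (eb j)).
  rewrite commM4 // Wv invg1 mul1g Wx -[[~ v i, x j]]invg_comm dE invMg -ZV.
  have -> : (tabA y j i)^-1 = W (dbl (tau (eb i) (eb j))).
    rewrite tabAC tabAE tau_ebE; case: (tau_ix i j) => [k|] /=.
      by rewrite [RHS](dbl_half_eb hp3 pF nvK) // => l; apply: K_exp.
    by rewrite invg1 /dbl addr0 W0.
  rewrite (Zc _ _ (WK _)) -mulgA -ZD; congr (_ * Z _).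
  have -> : dot (hv i) (eb j) = (d j i + tri (eb i) (eb j) (eb j))%R.
    by case: j; rewrite /hv /=; rewrite /dot !coordE; ring.
  by rewrite addKr.
(* The coordinates of half the alternating form [e], since commutators double the cocycle [det3 al];
   here [-h = 1/2]. *)
pose al : vec F := scl (- h)%R (mkv (e I2 I3) (- e I1 I3)%R (e I1 I2)).
have alE i j : (det3 al (eb i) (eb j) *+ 2 = e i j)%R.
  have eA' := (eA I1 I2, eA I1 I3, eA I2 I3).
  by case: i; case: j; rewrite ?e0 ?eA' /al /h /scl /det3 /eb !coordE; field; exact: n2.
exists al.
have [|||||||||||||f [fM fF fE fZ]] := @basis_mor p F nv hp pF nvK al gT X V w Z => //.
- by move=> i; apply: K_exp.
- by move=> i; apply: K_exp.
- by move=> i j; apply/commgP; rewrite XX.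
- move=> i j; apply: commuteM; first by apply/commgP; rewrite wv.
  by rewrite -(We i).
- by move=> a i; apply: Zc.
- by move=> a i; apply: Zc.
- by move=> a i; apply: Zc.
- by move=> i j; rewrite VV alE.
- move=> i j; rewrite commgC; congr (_ * _); rewrite (commDMr L4) // wx.
  by rewrite -(We i) (eqP (introT commgP (WW _ _))) mulg1.
- by move=> i j; rewrite commgC VX mulgA.
pose f' := @Morphism _ _ [set: mgrp al] f (in2W fM).
have injf : 'injm f'.
  apply: contraT => nt.
  (* A nontrivial kernel would meet the centre. Commuting with all [Wm], [Vm] and [Xm] leaves only
     elements [Zm a], on which the map is injective. *)
  have nil : nilpotent [set: mgrp al] by case: (nil_class_model al n2).
  have : 'ker f' :&: 'Z([set: mgrp al]) != 1.
    apply: (meet_center_nil nil); first exact: ker_normal.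
    by apply: contra nt => /eqP ->.
  case/trivgPn => g /setIP[gk /centerP[_ gc]] g1; case/negP: g1; apply/eqP.
  have gC k : [~ g, k] = 1 by apply/eqP/commgP; apply: gc; rewrite inE.
  have gu : pu g = 0%R.
    have q u : dot u (pu g) = 0%R.
      rewrite -[u in dot u _](pw_W al u) -pzR2 ?genE // -invg_comm gC invg1 //.
    apply: vecP; [rewrite -[RHS](q (eb I1))|rewrite -[RHS](q (eb I2))|
      rewrite -[RHS](q (eb I3))]; by vecring.
  have gv : pv g = 0%R.
    have : pw [~ g, Xm al (eb I1)] = 0%R by rewrite gC.
    rewrite pwR !genE gu => q.
    have n2' (a : F) : (a + a = 0 -> a = 0)%R.
      by rewrite -mulr2n -mulr_natr => /eqP; rewrite mulf_eq0 (negPf n2) orbF => /eqP.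
    have [[q1 q2] q3] := (congr1 (@co1 _) q, congr1 (@co2 _) q, congr1 (@co3 _) q).
    apply: vecP; apply: (n2').
    - by rewrite -[RHS]q2 /dbl; vecring.
    - by rewrite -[RHS]q1 /dbl; vecring.
    - by rewrite -[RHS]q3 /dbl; vecring.
  have gw : pw g = 0%R.
    have q u : dot (pw g) u = 0%R.
      by rewrite -[u in dot _ u](pu_X al u) -pzR2 // gC.
    apply: vecP; [rewrite -[RHS](q (eb I1))|rewrite -[RHS](q (eb I2))|
      rewrite -[RHS](q (eb I3))]; by vecring.
  have gE : g = Zm al (pz g) by apply: mgrpP.
  have : Z (pz g) = Z 0%R by rewrite -fZ -gE Z0; apply: (mker gk).
  by move/Zinj => e1; rewrite gE e1.
have imK : f' @* [set: mgrp al] = K.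
  apply/eqP; rewrite eqEcard; apply/andP; split.
    rewrite morphimEdom; apply/subsetP => _ /imsetP[g _ ->].
    have m3 (t : ix -> gT) u : (forall i, t i \in K) -> pw3 nv t u \in K.
      by move=> tK; rewrite /pw3 -lock !groupM ?groupX.
    have ZK a : Z a \in K by apply: (subsetP (lcn_sub 3 K)).
    by rewrite /= fF /pwV -lock; do !apply: groupM => //; apply: m3.
  by rewrite card_injm // (card_model cF); case: hK => _ ->.
rewrite isog_sym; apply/isogP; exists f' => //.
Qed.
End Classify.

(** * Isomorphisms between model groups *)

Local Close Scope group_scope.
Local Open Scope ring_scope.

Section Linear.
Variables (p : nat) (F : finFieldType) (nv : F -> nat).
Hypothesis hp : prime p.
Hypothesis hp3 : (3 < p)%N.
Hypothesis pF : p \in [pchar F].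
Hypothesis cF : #|F| = p.
Hypothesis nvK : forall a, (nv a)%:R = a.
Implicit Types (u v w : vec F) (s : vec F -> vec F).

Definition cub u : F := tri u u u.

Lemma nz6F : (6%:R : F) != 0.
Proof.
rewrite -(dvdn_pcharf pF) (Euclid_dvdM 2 3 hp) !gtnNdvd //.
by rewrite (leq_trans _ hp3).
Qed.

Lemma scl_nat n u : scl n%:R u = u *+ n.
Proof.
elim: n => [|n IH]; first by rewrite mulr0n; apply: vecP; vecring.
by rewrite (mulrSr u) -IH -natr1; apply: vecP; rewrite /scl !coordE mulrDl mul1r.
Qed.

Lemma scl1 u : scl 1 u = u. Proof. by apply: vecP; vecring. Qed.
Lemma scl0 a : scl a 0 = 0 :> vec F. Proof. by apply: vecP; vecring. Qed.
Lemma sclA a b u : scl a (scl b u) = scl (a * b) u. Proof. by apply: vecP; vecring. Qed.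
Lemma sclDr a u v : scl a (u + v) = scl a u + scl a v. Proof. by apply: vecP; vecring. Qed.

Lemma scl_eq0 a u : a != 0 -> scl a u = 0 -> u = 0.
Proof. by move=> a0 e; rewrite -(scl1 u) -(mulVf a0) -sclA e scl0. Qed.

Lemma add_scl s : {morph s : u v / u + v} -> forall a u, s (scl a u) = scl a (s u).
Proof.
move=> sD a u; rewrite -(nvK a) !scl_nat.
have s0 : s 0 = 0 by apply: (addrI (s 0)); rewrite -sD !addr0.
by elim: (nv a) => [|n IH]; rewrite ?mulr0n // !mulrSr sD IH.
Qed.

Lemma vec_decomp u :
  u = scl (co1 u) (eb I1) + scl (co2 u) (eb I2) + scl (co3 u) (eb I3).
Proof. by apply: vecP; rewrite /eb; vecring. Qed.

Lemma add_decomp s u : {morph s : u v / u + v} ->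
  s u = scl (co1 u) (s (eb I1)) + scl (co2 u) (s (eb I2)) + scl (co3 u) (s (eb I3)).
Proof. by move=> sD; rewrite {1}(vec_decomp u) !sD !(add_scl sD). Qed.

Lemma dot_inj u v : (forall x, dot u x = dot v x) -> u = v.
Proof.
move=> e; apply: vecP.
- by have := e (eb I1); rewrite /dot !coordE !mulr0 !addr0 !mulr1.
- by have := e (eb I2); rewrite /dot !coordE !mulr0 !addr0 !add0r !mulr1.
- by have := e (eb I3); rewrite /dot !coordE !mulr0 !add0r !mulr1.
Qed.

Lemma polarize s m : {morph s : u v / u + v} ->
  (forall u, cub (s u) = m * cub u) ->
  forall u v w, tri (s u) (s v) (s w) = m * tri u v w.
Proof.
move=> sD sc u v w; apply: (mulfI nz6F).
have pol x y z : 6%:R * tri x y z = cub (x + y + z) - cub (x + y) - cub (x + z)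
   - cub (y + z) + cub x + cub y + cub z :> F by rewrite /cub; vecring.
by rewrite pol -!sD !sc mulrCA pol; ring.
Qed.

Lemma det3_mor s : {morph s : u v / u + v} -> forall u v w,
  det3 (s u) (s v) (s w) = det3 (s (eb I1)) (s (eb I2)) (s (eb I3)) * det3 u v w.
Proof.
move=> sD u v w; rewrite (add_decomp u sD) (add_decomp v sD) (add_decomp w sD).
by vecring.
Qed.

Lemma det3_collinear (a b : vec F) : a != 0 -> (forall y, det3 b a y = 0) -> exists t, b = scl t a.
Proof.
move=> a0 H.
have e1 : co2 b * co3 a = co3 b * co2 a.
  by apply/eqP; rewrite -subr_eq0 -(H (eb I1)); apply/eqP; vecring.
have e2 : co1 b * co3 a = co3 b * co1 a.
  apply/eqP; rewrite -subr_eq0 -oppr_eq0 -(H (eb I2)); apply/eqP; vecring.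
have e3 : co1 b * co2 a = co2 b * co1 a.
  by apply/eqP; rewrite -subr_eq0 -(H (eb I3)); apply/eqP; vecring.
have [z1|n1] := eqVneq (co1 a) 0; last first.
  exists (co1 b / co1 a); apply: vecP; rewrite /scl !coordE.
  - by field.
  - by rewrite mulrAC e3; field.
  - by rewrite mulrAC e2; field.
have [z2|n2] := eqVneq (co2 a) 0; last first.
  exists (co2 b / co2 a); apply: vecP; rewrite /scl !coordE.
  - by rewrite mulrAC -e3; field.
  - by field.
  - by rewrite mulrAC e1; field.
have n3 : co3 a != 0.
  by apply: contra a0 => /eqP z3; apply/eqP/vecP; rewrite ?z1 ?z2 ?z3.
exists (co3 b / co3 a); apply: vecP; rewrite /scl !coordE.
- by rewrite mulrAC -e2; field.
- by rewrite mulrAC -e1; field.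
- by field.
Qed.

(** Permutations, so that the similitudes form a finite group with an action on vectors. Additive
    maps are linear because the field is prime. *)
Definition simil : {set {perm vec F}} :=
  [set s : {perm vec F} | [forall u, forall v, s (u + v) == s u + s v] &&
    [exists m : F, (m != 0) && [forall u, cub (s u) == m * cub u]]].

Lemma similP (s : {perm vec F}) : reflect ({morph s : u v / u + v} /\
   exists2 m, m != 0 & forall u v w, tri (s u) (s v) (s w) = m * tri u v w)
  (s \in simil).
Proof.
rewrite inE; apply: (iffP andP) => [[/forallP h1 /existsP[m /andP[m0 /forallP h2]]]|].
  have sD : {morph s : u v / u + v} by move=> u v; apply/eqP; apply: (forallP (h1 u)).
  by split=> //; exists m => //; apply: polarize => // u; apply/eqP.
case=> sD [m m0 h]; split; first by apply/forallP => u; apply/forallP => v; rewrite sD.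
by apply/existsP; exists m; rewrite m0; apply/forallP => u; apply/eqP/h.
Qed.

Lemma simil_group_set : group_set simil.
Proof.
apply/group_setP; split.
  apply/similP; split=> [u v|]; first by rewrite !perm1.
  by exists 1; rewrite ?oner_eq0 // => u v w; rewrite !perm1 mul1r.
move=> s t /similP[sD [m m0 hs]] /similP[tD [n n0 ht]]; apply/similP; split.
  by move=> u v; rewrite !permM sD tD.
by exists (n * m); rewrite ?mulf_neq0 // => u v w; rewrite !permM ht hs mulrA.
Qed.

(** The centroid of the cubic consists of scalars: this is [tau_ix_symm_solve] for the matrix of
    [m]. *)
Lemma tri_sym_scalar (m : vec F -> vec F) : {morph m : u v / u + v} ->
  (forall x u y, tri (m x) u y = tri (m u) x y) -> exists k, forall x, m x = scl k x.
Proof.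
move=> mD H; pose B k i := dot (eb k) (m (eb i)).
have BE : forall k i, B k i = (match k, i with
    | I1, I1 | I2, I2 | I3, I3 => B I1 I1 | _, _ => 0 end).
  apply: tau_ix_symm_solve => i i' j.
  have q a b c : oapp (B^~ a) 0 (tau_ix b c) = tri (m (eb a)) (eb b) (eb c).
    rewrite (_ : tri _ _ _ = dot (tau (eb b) (eb c)) (m (eb a))); last by vecring.
    rewrite tau_ebE; case: (tau_ix b c) => [k|] //=; by vecring.
  by rewrite !q H.
have me i : m (eb i) = scl (B I1 I1) (eb i).
  have co (a : vec F) : [/\ co1 a = dot (eb I1) a, co2 a = dot (eb I2) a & co3 a = dot (eb I3) a].
    by split; vecring.
  have [q1 q2 q3] := co (m (eb i)).
  by apply: vecP; rewrite ?q1 ?q2 ?q3 -/(B _ _) BE; case: i {q1 q2 q3} => /=;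
     rewrite /scl ?coordE /= ?mulr1 ?mulr0.
exists (B I1 I1) => x; rewrite (add_decomp x mD) !me.
by apply: vecP; rewrite /eb; vecring.
Qed.

Lemma isog_of_simil (s : {perm vec F}) al :
  s \in simil -> [set: mgrp al] \isog [set: mgrp (s al)].
Proof.
case/similP=> sD [m m0 hs].
set d := det3 (s (eb I1)) (s (eb I2)) (s (eb I3)).
have hd := det3_mor sD; rewrite -/d in hd.
have sK u : s ((s^-1)%g u) = u by rewrite permKV.
have d0 : d != 0.
  apply/eqP => d0; have := hd ((s^-1)%g (eb I1)) ((s^-1)%g (eb I2)) ((s^-1)%g (eb I3)).
  rewrite !sK d0 mul0r => /eqP; rewrite (_ : det3 _ _ _ = 1) ?oner_eq0 //.
  by vecring.
(* If [v] is scaled by [c] and [z] by [l], then [tri] requires [l = c m] and [det3] requires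
   [l = c^2 d]; so [c = m / d]. *)
pose c := m / d; pose l := c * m.
have c0 : c != 0 by rewrite mulf_neq0 ?invr_eq0.
have l0 : l != 0 by rewrite mulf_neq0.
(* The vectors [w] live in the dual space, so they are moved by the inverse transpose of [s]. *)
pose T w := mkv (dot w ((s^-1)%g (eb I1))) (dot w ((s^-1)%g (eb I2)))
   (dot w ((s^-1)%g (eb I3))).
have tD : {morph (s^-1)%g : u v / u + v}.
  by move=> u v; apply: (@perm_inj _ s); rewrite sD !sK.
have TE w x : dot (T w) x = dot w ((s^-1)%g x).
  by rewrite (add_decomp x tD) /T; vecring.
have TD w w' : T (w + w') = T w + T w' by apply: vecP; rewrite /T; vecring.
pose f (g : mgrp al) : mgrp (s al) :=
  mg (s al) (s (pu g)) (scl c (s (pv g))) (scl l (T (pw g))) (l * pz g).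
have fM : {morph f : g h / (g * h)%g}.
  move=> g h.
  have fu k : pu (f k) = s (pu k) by [].
  have fv k : pv (f k) = scl c (s (pv k)) by [].
  have fw k : pw (f k) = scl l (T (pw k)) by [].
  have fz k : pz (f k) = l * pz k by [].
  apply: mgrpP; rewrite !(puM, pvM, pwM, pzM, fu, fv, fw, fz).
  - by rewrite -sD.
  - by rewrite -sclDr -sD.
  - have tauE v u : scl l (T (tau v u)) = tau (scl c (s v)) (s u).
      apply: dot_inj => x.
      rewrite (_ : dot (scl l (T (tau v u))) x = l * dot (T (tau v u)) x); last by vecring.
      rewrite TE (_ : dot (tau (scl c (s v)) (s u)) x = c * tri (s v) (s u) x).
        by rewrite -{2}(sK x) hs mulrA.
      by vecring.
    by rewrite /dbl -!tauE !TD !sclDr.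
  rewrite (_ : dot (scl l _) _ = l * dot (T (pw g)) (s (pu h))); last by vecring.
  rewrite TE permK.
  rewrite (_ : tri (scl c _) _ _ = c * tri (s (pv g)) (s (pu h)) (s (pu h))); last by vecring.
  rewrite hs.
  rewrite (_ : det3 _ (scl c _) (scl c _) = c * (c * det3 (s al) (s (pv g)) (s (pv h))));
    last by vecring.
  rewrite hd (_ : c * (c * (d * _)) = l * det3 al (pv g) (pv h)); last first.
    by rewrite /l /c; field.
  by rewrite /l; ring.
pose f' := @Morphism _ _ [set: mgrp al] f (in2W fM).
have injf : ('injm f')%g.
  apply/injmP => g h _ _ /= e.
  have sclI a (u v : vec F) : a != 0 -> scl a u = scl a v -> u = v.
    by move=> a0 /(congr1 (scl a^-1)); rewrite !sclA mulVf // !scl1.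
  apply: mgrpP.
  - by apply: (@perm_inj _ s); have := congr1 (@pu _ _) e.
  - apply: (@perm_inj _ s); apply: (sclI c) => //; by have := congr1 (@pv _ _) e.
  - have /(sclI l _ _ l0) eT := congr1 (@pw _ _) e.
    apply: dot_inj => x; rewrite -(permK s x) -!TE.
    by rewrite (eT : T (pw g) = T (pw h)).
  - by apply: (mulfI l0); have := congr1 (@pz _ _) e.
apply/isogP; exists f' => //; apply/eqP; rewrite eqEcard subsetT card_injm //.
by rewrite !(card_model cF) leqnn.
Qed.

(** An isomorphism induces linear maps [g1] on the [u]-part, [g2] on the [v]-part and a scalar [lam]
    on [L_3]. Rigidity makes [g1] a multiple of [g2], so [g1] is a similitude. Comparing the
    alternating forms shows that [g1 al] and [be] are proportional, and scalars are similitudes. *)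
Lemma simil_of_isog al be : [set: mgrp al] \isog [set: mgrp be] ->
  exists2 s : {perm vec F}, s \in simil & s al = be.
Proof.
case/isogP=> f injf imf.
have n2 := nz2F hp3 pF.
have fM g h : f (g * h)%g = (f g * f h)%g by rewrite morphM ?inE.
have fR g h : f [~ g, h]%g = [~ f g, f h]%g by rewrite morphR ?inE.
have fI g h : f g = f h -> g = h by move/injmP: injf => ii /ii -> //; rewrite inE.
have fN2 g : g \in N2 al -> f g \in N2 be.
  rewrite -(lcn2E al n2) -(lcn2E be n2) => gL.
  have : f g \in (f @* 'L_2([set: mgrp al]))%g by rewrite mem_morphim ?inE.
  by rewrite morphim_lcn ?subxx // imf.
have fN2s h : h \in N2 be -> exists2 g, g \in N2 al & f g = h.
  rewrite -(lcn2E al n2) -(lcn2E be n2) => hL.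
  have : h \in (f @* 'L_2([set: mgrp al]))%g by rewrite morphim_lcn ?subxx // imf.
  by case/morphimP => g _ gL ->; exists g.
have fN3 g : g \in N3 al -> f g \in N3 be.
  rewrite -(lcn3E al n2) -(lcn3E be n2) => gL.
  have : f g \in (f @* 'L_3([set: mgrp al]))%g by rewrite mem_morphim ?inE.
  by rewrite morphim_lcn ?subxx // imf.
have Zin a : Zm al a \in N3 al by rewrite inE !genE !eqxx.
pose g1 u := pu (f (Xm al u)); pose g2 v := pv (f (Vm al v)).
have g1D : {morph g1 : u v / u + v}.
  move=> u v; rewrite /g1 -puM -fM; congr (pu (f _)).
  by apply: mgrpP; rewrite ?puM ?pvM ?pwM ?pzM !genE ?addr0 //;
    [apply: vecP; rewrite /dbl; vecring | vecring].
have g2D : {morph g2 : u v / u + v}.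
  move=> u v; rewrite /g2 -pvM -fM.
  have -> : (Vm al u * Vm al v = Vm al (u + v) * Zm al (det3 al u v))%g.
    by apply: mgrpP; rewrite ?puM ?pvM ?pwM ?pzM !genE ?addr0 //;
      [apply: vecP; rewrite /dbl; vecring | vecring].
  rewrite fM pvM; have := fN3 _ (Zin (det3 al u v)).
  by rewrite inE => /and3P[_ /eqP-> _]; rewrite addr0.
(* [Vm al v] centralises [N2], which is carried onto [N2 be]; an element of [mgrp be] that
   centralises [N2 be] has zero [u]-part. *)
have fV v : pu (f (Vm al v)) = 0.
  apply: dot_inj => w; rewrite (_ : dot 0 w = 0); last by vecring.
  rewrite (_ : dot _ w = dot (pw (Wm be w)) (pu (f (Vm al v)))); last first.
    by rewrite genE; vecring.
  have Wn : Wm be w \in N2 be by rewrite inE !genE !eqxx.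
  have [g gN gE] := fN2s _ Wn.
  rewrite -pzR2 ?genE // -gE -fR (_ : [~ g, Vm al v]%g = 1%g) ?morph1 //.
  move: gN; rewrite inE => /andP[/eqP gu /eqP gv].
  apply: mgrpP; rewrite ?puR ?pvR //.
    rewrite pwR !genE gu gv.
    by apply: vecP; rewrite /dbl; vecring.
  by rewrite pzR2 // genE [RHS](_ : _ = 0) //; vecring.
pose l a := pz (f (Zm al a)).
have lE a : f (Zm al a) = Zm be (l a).
  have := fN3 _ (Zin a); rewrite inE => /and3P[/eqP e1 /eqP e2 /eqP e3].
  exact: mgrpP.
have lD a b : l (a + b) = l a + l b.
  rewrite /l (_ : Zm al (a + b) = (Zm al a * Zm al b)%g); last first.
    by apply: mgrpP; rewrite ?puM ?pvM ?pwM ?pzM !genE ?addr0 //;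
      [apply: vecP; rewrite /dbl; vecring | vecring].
  rewrite fM !lE pzM !genE; by vecring.
have ll a : l a = l 1 * a.
  have l00 : l 0 = 0 by apply: (addrI (l 0)); rewrite -lD !addr0.
  rewrite -(nvK a); elim: (nv a) => [|n IH]; first by rewrite mulr0.
  by rewrite -natr1 lD IH mulrDr mulr1.
set lam := l 1 in ll.
have lam0 : lam != 0.
  apply/eqP => e; have : f (Zm al 1) = f (Zm al 0) by rewrite !lE !ll e !mul0r.
  by move/fI/(congr1 (@pz _ _)); rewrite !genE => /eqP; rewrite oner_eq0.
have H v u u' : tri (g2 v) (g1 u) (g1 u') = lam * tri v u u'.
  have : f [~ Vm al v, Xm al u, Xm al u']%g = Zm be (lam * (tri v u u' + tri v u u')).
    rewrite -ll -lE; congr (f _); apply: mgrpP; rewrite ?puR ?pvR //.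
      by rewrite pwR puR pvR !genE; apply: vecP; rewrite /dbl; vecring.
    by rewrite pzR2 ?puR ?pvR // pwR !genE /dbl; vecring.
  rewrite !fR => /(congr1 (@pz _ _)); rewrite pzR2 ?puR ?pvR // pwR fV !genE => e.
  apply: (mulfI n2); transitivity (lam * (tri v u u' + tri v u u')); last by ring.
  by rewrite -e /g1 /g2 /dbl; vecring.
have Hd v v' : det3 be (g2 v) (g2 v') = lam * det3 al v v'.
  have : f [~ Vm al v, Vm al v']%g = Zm be (lam * (det3 al v v' + det3 al v v')).
    rewrite -ll -lE; congr (f _); apply: mgrpP; rewrite ?puR ?pvR //.
      by rewrite pwR !genE; apply: vecP; rewrite /dbl; vecring.
    by rewrite pzR1 ?genE.
  rewrite fR => /(congr1 (@pz _ _)); rewrite pzR1 ?fV // !genE => e.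
  apply: (mulfI n2); transitivity (lam * (det3 al v v' + det3 al v v')); last by ring.
  by rewrite -e /g2; ring.
have add_inj s : {morph s : u v / u + v} -> (forall u, s u = 0 -> u = 0) -> injective s.
  move=> sD s0 u v e; apply/eqP; rewrite -subr_eq0; apply/eqP/s0.
  have sN x : s (- x) = - s x.
    have z0 : s 0 = 0 by apply: (addrI (s 0)); rewrite -sD !addr0.
    by apply/eqP; rewrite -addr_eq0 -sD addNr z0.
  by rewrite sD sN e subrr.
have g1i : injective g1.
  apply: add_inj => // u e; have q v u' : tri v u u' = 0.
    apply: (mulfI lam0); rewrite -H e mulr0.
    by vecring.
  apply: vecP; [rewrite -[RHS](q (eb I2) (eb I1))|rewrite -[RHS](q (eb I1) (eb I1))|
    rewrite -[RHS](q (eb I3) (eb I1))]; by vecring.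
have g2i : injective g2.
  apply: add_inj => // u e; have q v u' : tri u v u' = 0.
    apply: (mulfI lam0); rewrite -H e mulr0.
    by vecring.
  apply: vecP; [rewrite -[RHS](q (eb I2) (eb I1))|rewrite -[RHS](q (eb I1) (eb I1))|
    rewrite -[RHS](q (eb I3) (eb I1))]; by vecring.
pose s1 := perm g1i; pose s2 := perm g2i.
(* [lam * tri (m x) u y = tri (g1 x) (g1 u) (g1 y)] is symmetric in [x] and [u], so [m] is a
   scalar. *)
pose m x := (s2^-1)%g (g1 x).
have mE x : g2 (m x) = g1 x by rewrite -(permE g2i) permKV.
have mD : {morph m : u v / u + v} by move=> u v; apply: (g2i); rewrite g2D !mE g1D.
have [|k kE] := tri_sym_scalar mD.
  move=> x u y; apply: (mulfI lam0); rewrite -!H !mE; by vecring.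
have g1E x : g1 x = scl k (g2 x) by rewrite -mE kE (add_scl g2D).
have k0 : k != 0.
  apply/eqP => k0; have : g1 (eb I1) = g1 0.
    by rewrite !g1E k0; apply: vecP; vecring.
  by move/g1i/(congr1 (@co1 _))/eqP; rewrite !coordE oner_eq0.
have tg1 u v w : tri (g1 u) (g1 v) (g1 w) = k * lam * tri u v w.
  by rewrite {1}g1E -mulrA -H; vecring.
have dg1 v v' : det3 be (g1 v) (g1 v') = k * k * lam * det3 al v v'.
  by rewrite !g1E -mulrA -Hd; vecring.
have g1s y : exists x, y = g1 x.
  by exists ((s1^-1)%g y); rewrite -(permE g1i) permKV.
have fromt t : t != 0 -> exists2 s : {perm vec F}, s \in simil & forall u, s u = scl t (g1 u).
  move=> t0; have ti : injective (fun u => scl t (g1 u)).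
    move=> u v /(congr1 (scl t^-1)); rewrite !sclA mulVf // !scl1; exact: g1i.
  exists (perm ti) => [|u]; last by rewrite permE.
  apply/similP; split=> [u v|]; first by rewrite !permE g1D sclDr.
  exists (t * t * t * (k * lam)); first by rewrite !mulf_neq0.
  by move=> u v w; rewrite !permE -mulrA -tg1; vecring.
have det0 (a : vec F) : (forall x y, det3 a x y = 0) -> a = 0.
  move=> q; apply: vecP; [rewrite -[RHS](q (eb I2) (eb I3))|rewrite -[RHS](q (eb I3) (eb I1))|
    rewrite -[RHS](q (eb I1) (eb I2))]; by vecring.
have [al0|aln] := eqVneq al 0.
  have [s sG sE] := fromt 1 (oner_neq0 F); exists s => //.
  rewrite sE scl1 [RHS]det0; last first.
    by move=> x y; have [x' ->] := g1s x; have [y' ->] := g1s y; rewrite dg1 al0; vecring.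
  by apply: (addrI (g1 0)); rewrite al0 -g1D !addr0.
have g1n : g1 al != 0.
  apply: contra aln => /eqP e; apply/eqP/g1i; rewrite e.
  by apply: (addrI (g1 0)); rewrite -g1D !addr0.
(* [g1 al] spans the radical of the form [det3 be], because [al] is in the radical of [det3 al]. *)
have [|t tE] := det3_collinear (b := be) g1n.
  by move=> y; have [y' ->] := g1s y; rewrite dg1; vecring.
have t0 : t != 0.
  apply: contra aln => /eqP t0; apply/eqP/det0 => x y.
  have kk : k * k * lam != 0 by rewrite !mulf_neq0.
  by apply: (mulfI kk); rewrite -dg1 tE t0; vecring.
have [s sG sE] := fromt t t0; exists s => //.
by rewrite sE tE.
Qed.
End Linear.

(** * Flexes of the cubic *)

Section Flex.
Variables (p : nat) (F : finFieldType) (nv : F -> nat).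
Hypothesis hp : prime p.
Hypothesis hp3 : (3 < p)%N.
Hypothesis pF : p \in [pchar F].
Hypothesis cF : #|F| = p.
Hypothesis nvK : forall a, (nv a)%:R = a.
Implicit Types (u v w : vec F).

Local Notation e1 := (@eb F I1).
Local Notation e2 := (@eb F I2).
Local Notation e3 := (@eb F I3).

Lemma nz3F : (3 : F) != 0.
Proof. by rewrite -(dvdn_pcharf pF) gtnNdvd. Qed.

(** The flexes [(1 : x : y)]. The second equation is the cubic; the Hessian reads [x y^2 = x^2 - 1],
    and eliminating [y] from the two gives the quartic. *)
Definition affine_flex (x y : F) := (x ^+ 4 + 6 * x ^+ 2 - 3 == 0) && (3 * y ^+ 2 + x ^+ 3 + 3 * x == 0).

Lemma affine_flex_neq0 x y : affine_flex x y -> (x != 0) /\ (y != 0).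
Proof.
case/andP=> /eqP h1 /eqP h2.
have x0 : x != 0.
  by apply: contra_eq_neq h1 => ->; rewrite !expr0n /= mulr0 !add0r oppr_eq0 nz3F.
split=> //; apply: contra_eq_neq h2 => ->.
rewrite expr0n /= mulr0 add0r (_ : _ + _ = x * (x ^+ 2 + 3)); last by ring.
rewrite mulf_neq0 //; apply/eqP => e.
have : (12 : F) = 0.
  rewrite -[LHS]opprK -[RHS]oppr0; congr (- _).
  transitivity (x ^+ 4 + 6 * x ^+ 2 - 3 - (x ^+ 2 + 3) * (x ^+ 2 + 3)); first by ring.
  by rewrite h1 e; ring.
by move/eqP; rewrite (_ : 12 = 2 * 6) ?mulf_eq0 ?(negPf (nz2F hp3 pF)) ?(negPf (nz6F hp hp3 pF)) //; ring.
Qed.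

(** In the group law with origin [e3], this matrix induces [P -> Q - P] for the flex
    [Q = (1 : x : y)]: it exchanges [e3] and [Q] up to scalars. *)
Definition transl (x y : F) (u : vec F) : vec F :=
  mkv (- (1 + x ^+ 2) * y * co1 u - (5 * x + x ^+ 3) * y * co2 u + 4 * co3 u)
      (- (9 * x + x ^+ 3) * y * co1 u + (5 + x ^+ 2) * y * co2 u + 4 * x * co3 u)
      (- (10 * x + 2 * x ^+ 3) * co1 u - (2 + 2 * x ^+ 2) * co2 u + 4 * y * co3 u).

Lemma cub_transl x y u : affine_flex x y -> cub (transl x y u) = 512 * y ^+ 3 * cub u.
Proof.
case/andP=> /eqP h1 /eqP h2; apply/eqP; rewrite -subr_eq0.
suff : 3 * (cub (transl x y u) - 512 * y ^+ 3 * cub u) == 0.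
  by rewrite mulf_eq0 (negPf nz3F).
have [a ea] : exists a, a = co1 u by exists (co1 u).
have [b eb'] : exists b, b = co2 u by exists (co2 u).
have [c ec] : exists c, c = co3 u by exists (co3 u).
(* An explicit membership in the ideal of the two equations of a flex; the cofactors result from
   polynomial division, and the factor 3 clears the denominators. *)
have -> : 3 * (cub (transl x y u) - 512 * y ^+ 3 * cub u) =
  (a ^+ 3 * (273 * x ^+ 2 * y + 171 * x ^+ 4 * y + 27 * x ^+ 6 * y + 1 * x ^+ 8 * y)
   + 3 * a ^+ 2 * b * (- 467 * x * y - 189 * x ^+ 3 * y - 9 * x ^+ 5 * y + 1 * x ^+ 7 * y)
   + 3 * a ^+ 2 * c * (- 244 * x ^+ 2 - 88 * x ^+ 4 - 4 * x ^+ 6)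
   + 3 * a * b ^+ 2 * (4 * y + 45 * x ^+ 2 * y + 55 * x ^+ 4 * y + 15 * x ^+ 6 * y + 1 * x ^+ 8 * y)
   + 6 * a * b * c * (- 92 * x - 72 * x ^+ 3 - 12 * x ^+ 5)
   + 3 * a * c ^+ 2 * (- 32 * x * y)
   + b ^+ 3 * (- 327 * x * y - 201 * x ^+ 3 * y - 37 * x ^+ 5 * y - 3 * x ^+ 7 * y)
   + 3 * b ^+ 2 * c * (- 16 - 84 * x ^+ 2 - 40 * x ^+ 4 - 4 * x ^+ 6)
   + 3 * b * c ^+ 2 * (- 16 * y + 16 * x ^+ 2 * y)) * (x ^+ 4 + 6 * x ^+ 2 - 3) +
  (a ^+ 3 * (- 27 * x * y - 786 * x ^+ 3 * y - 276 * x ^+ 5 * y - 30 * x ^+ 7 * y - 1 * x ^+ 9 * y)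
   + 3 * a ^+ 2 * b * (- 507 * y + 326 * x ^+ 2 * y + 60 * x ^+ 4 * y - 6 * x ^+ 6 * y - 1 * x ^+ 8 * y)
   + 3 * a ^+ 2 * c * (156 * x + 508 * x ^+ 3 + 100 * x ^+ 5 + 4 * x ^+ 7)
   + 3 * a * b ^+ 2 * (- 175 * x * y - 270 * x ^+ 3 * y - 112 * x ^+ 5 * y - 18 * x ^+ 7 * y - 1 * x ^+ 9 * y)
   + 6 * a * b * c * (- 12 + 212 * x ^+ 2 + 108 * x ^+ 4 + 12 * x ^+ 6)
   + 3 * a * c ^+ 2 * (- 528 * y - 16 * x ^+ 2 * y)
   + b ^+ 3 * (- 387 * y + 450 * x ^+ 2 * y + 240 * x ^+ 4 * y + 46 * x ^+ 6 * y + 3 * x ^+ 8 * y)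
   + 3 * b ^+ 2 * c * (- 20 * x + 156 * x ^+ 3 + 52 * x ^+ 5 + 4 * x ^+ 7)
   + 3 * b * c ^+ 2 * (- 80 * x * y - 16 * x ^+ 3 * y)
   + c ^+ 3 * (192)) * (3 * y ^+ 2 + x ^+ 3 + 3 * x).
  by rewrite /cub /tri /dot /tau /transl !coordE -ea -eb' -ec; ring.
by rewrite h1 h2 !mulr0 addr0.
Qed.

Lemma simil_inj (s : vec F -> vec F) m : {morph s : u v / u + v} -> m != 0 ->
  (forall u v w, tri (s u) (s v) (s w) = m * tri u v w) -> injective s.
Proof.
move=> sD m0 h u v e; apply/eqP; rewrite -subr_eq0; apply/eqP.
have s0 : s 0 = 0 by apply: (addrI (s 0)); rewrite -sD !addr0.
have sN x : s (- x) = - s x by apply/eqP; rewrite -addr_eq0 -sD addNr s0.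
have q x y : tri (u - v) x y = 0.
  apply: (mulfI m0); rewrite -h sD sN e subrr mulr0; by vecring.
apply: vecP; [rewrite -[RHS](q e2 e1)|rewrite -[RHS](q e1 e1)|rewrite -[RHS](q e3 e1)];
  by vecring.
Qed.

Lemma simil_perm (s : vec F -> vec F) m : {morph s : u v / u + v} -> m != 0 ->
  (forall u v w, tri (s u) (s v) (s w) = m * tri u v w) ->
  exists2 t : {perm vec F}, t \in simil F & forall u, t u = s u.
Proof.
move=> sD m0 h; have si := simil_inj sD m0 h.
exists (perm si) => [|u]; last by rewrite permE.
apply/(similP hp hp3 pF); split=> [u v|]; first by rewrite !permE.
by exists m => // u v w; rewrite !permE.
Qed.

Lemma scl_simil t : t != 0 -> exists2 s : {perm vec F}, s \in simil F & forall u, s u = scl t u.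
Proof.
move=> t0; apply: (@simil_perm _ (t * t * t)).
- by move=> u v; apply: sclDr.
- by rewrite !mulf_neq0.
- by move=> u v w; vecring.
Qed.

(** The last condition is the vanishing of the Hessian determinant at [u], expressed by a kernel
    vector. Flexes are counted as nonzero vectors, not as projective points. *)
Definition flex u := [&& u != 0, cub u == 0 &
  [exists n, (n != 0) && [forall x, tri u n x == 0]]].

Lemma flexP u : reflect [/\ u != 0, cub u = 0 &
  exists2 n, n != 0 & forall x, tri u n x = 0] (flex u).
Proof.
apply: (iffP and3P) => [[u0 /eqP c0 /existsP[n /andP[n0 /forallP h]]]|[u0 c0 [n n0 h]]].
  by split=> //; exists n => // x; apply/eqP.
by split=> //; [rewrite c0 | apply/existsP; exists n; rewrite n0; apply/forallP => x; rewrite h].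
Qed.

Lemma flex_e3 : flex e3.
Proof.
apply/flexP; split.
- by apply/eqP => /(congr1 (@co3 _)) /eqP; rewrite !coordE oner_eq0.
- by rewrite /cub; vecring.
exists e2; first by apply/eqP => /(congr1 (@co2 _)) /eqP; rewrite !coordE oner_eq0.
by move=> x; vecring.
Qed.

Lemma simil_add (s : {perm vec F}) : s \in simil F -> {morph s : u v / u + v}.
Proof. by case/(similP hp hp3 pF). Qed.

Lemma simil0 (s : {perm vec F}) : s \in simil F -> s 0 = 0.
Proof. by move/simil_add => sD; apply: (addrI (s 0)); rewrite -sD !addr0. Qed.

Lemma simil_eq0 (s : {perm vec F}) u : s \in simil F -> (s u == 0) = (u == 0).
Proof. by move=> sG; rewrite -{1}(simil0 sG) (inj_eq (@perm_inj _ s)). Qed.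

Lemma flex_simil (s : {perm vec F}) u : s \in simil F -> flex u -> flex (s u).
Proof.
move=> sG /flexP[u0 c0 [n n0 h]]; have /(similP hp hp3 pF)[sD [m m0 hm]] := sG.
apply/flexP; split; first by rewrite simil_eq0.
  by rewrite /cub hm -/(cub u) c0 mulr0.
exists (s n); first by rewrite simil_eq0.
by move=> x; rewrite -(permKV s x) hm h mulr0.
Qed.

Lemma flex_cases u : flex u -> (exists2 t, t != 0 & u = scl t e3) \/
  (exists t x y, [/\ t != 0, affine_flex x y & u = scl t (mkv 1 x y)]).
Proof.
case/flexP=> u0 c0 [n n0 h].
have cE : cub u = co2 u ^+ 3 + 3 * co1 u ^+ 2 * co2 u + 3 * co1 u * co3 u ^+ 2.
  by rewrite /cub; vecring.
have [z1|nz1] := eqVneq (co1 u) 0.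
  left; have z2 : co2 u = 0.
    apply/eqP; have := c0; rewrite cE z1 !expr0n /= !(mulr0, mul0r) !addr0 => /eqP.
    by rewrite expf_eq0.
  exists (co3 u).
    by apply: contra u0 => /eqP z3; apply/eqP/vecP; rewrite ?z1 ?z2 ?z3.
  by apply: vecP; rewrite ?z1 ?z2; vecring.
right; exists (co1 u), (co2 u / co1 u), (co3 u / co1 u); split=> //; last first.
  by apply: vecP; rewrite /scl !coordE; field.
have q1 : co2 u * co1 n + co1 u * co2 n + co3 u * co3 n = 0 by rewrite -(h e1); vecring.
have q2 : co1 u * co1 n + co2 u * co2 n = 0 by rewrite -(h e2); vecring.
have q3 : co3 u * co1 n + co1 u * co3 n = 0 by rewrite -(h e3); vecring.
(* The determinant of the matrix of [tri u], which kills the nonzero vector [n]. *)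
have hess : co1 u * co2 u ^+ 2 - co1 u ^+ 3 - co2 u * co3 u ^+ 2 = 0.
  have H a : a != 0 -> (co1 u * co2 u ^+ 2 - co1 u ^+ 3 - co2 u * co3 u ^+ 2) * a = 0 ->
     co1 u * co2 u ^+ 2 - co1 u ^+ 3 - co2 u * co3 u ^+ 2 = 0.
    by move=> a0 /eqP; rewrite mulf_eq0 (negPf a0) orbF => /eqP.
  have [y1|] := eqVneq (co1 n) 0; last first.
    move=> y1; apply: (H _ y1).
    transitivity (co1 u * co2 u * 0 - co1 u ^+ 2 * 0 - co2 u * co3 u * 0 : F); last by ring.
    by rewrite -{1}q1 -{1}q2 -q3; ring.
  have y3 : co3 n = 0.
    by move/eqP: q3; rewrite y1 mulr0 add0r mulf_eq0 (negPf nz1) => /eqP.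
  have y2 : co2 n = 0.
    by move/eqP: q1; rewrite y1 y3 !mulr0 add0r addr0 mulf_eq0 (negPf nz1) => /eqP.
  by case/eqP: n0; apply: vecP; rewrite ?y1 ?y2 ?y3.
have c0' := etrans (esym cE) c0; apply/andP; split; apply/eqP.
  (* The combination of the cubic and its Hessian from which [co3 u] disappears. *)
  have q : (co1 u ^+ 4) * ((co2 u / co1 u) ^+ 4 + 6 * (co2 u / co1 u) ^+ 2 - 3) = 0.
    transitivity (co2 u * (co2 u ^+ 3 + 3 * co1 u ^+ 2 * co2 u + 3 * co1 u * co3 u ^+ 2)
      + 3 * co1 u * (co1 u * co2 u ^+ 2 - co1 u ^+ 3 - co2 u * co3 u ^+ 2)); first by field.
    by rewrite c0' hess !mulr0 addr0.
  by move/eqP: q; rewrite mulf_eq0 expf_eq0 (negPf nz1) andbF => /eqP.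
have q : (co1 u ^+ 3) * (3 * (co3 u / co1 u) ^+ 2 + (co2 u / co1 u) ^+ 3 + 3 * (co2 u / co1 u)) = 0.
  transitivity (co2 u ^+ 3 + 3 * co1 u ^+ 2 * co2 u + 3 * co1 u * co3 u ^+ 2); first by field.
  exact: c0'.
by move/eqP: q; rewrite mulf_eq0 expf_eq0 (negPf nz1) andbF => /eqP.
Qed.

Lemma flex_trans u : flex u -> exists2 s : {perm vec F}, s \in simil F & s e3 = u.
Proof.
case/flex_cases=> [[t t0 ->]|[t [x [y [t0 hxy ->]]]]].
  by have [s sG sE] := scl_simil t0; exists s.
have [x0 y0] := affine_flex_neq0 hxy.
have n2 := nz2F hp3 pF.
have n512 : (512 : F) != 0.
  by rewrite (_ : 512 = 2 ^+ 9) ?expf_neq0 //; ring.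
have trD : {morph transl x y : u v / u + v} by move=> a b; apply: vecP; rewrite /transl; vecring.
have [||s sG sE] := @simil_perm (transl x y) (512 * y ^+ 3) trD.
- by rewrite mulf_neq0 // expf_neq0.
- by apply: (polarize hp hp3 pF) => // v; apply: cub_transl.
have n4 : (4 : F) != 0 by rewrite (_ : 4 = 2 * 2) ?mulf_neq0 //; ring.
have [r rG rE] := scl_simil (mulf_neq0 t0 (invr_neq0 n4)).
exists (s * r)%g; first by rewrite (groupM (G := Group (simil_group_set hp hp3 pF))).
rewrite permM rE sE; apply: vecP; rewrite /transl /scl !coordE; field; exact: n4.
Qed.

Lemma flex_affine t x y : t != 0 -> affine_flex x y -> flex (scl t (mkv 1 x y)).
Proof.
move=> t0 hxy; have [x0 y0] := affine_flex_neq0 hxy; case/andP: hxy => /eqP h1 /eqP h2.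
apply/flexP; split.
- apply/eqP => /(congr1 (@co1 _)) /eqP; rewrite /scl !coordE mulr1; exact/negP.
- transitivity (t ^+ 3 * (3 * y ^+ 2 + x ^+ 3 + 3 * x)); last by rewrite h2 mulr0.
  by rewrite /cub; vecring.
(* This vector solves the last two equations of the kernel identically; the first one is the Hessian
   equation. *)
exists (mkv x (-1) (- x * y)).
  by apply/eqP => /(congr1 (@co1 _)) /eqP; rewrite !coordE; apply/negP.
move=> z; apply: (mulfI nz3F); rewrite mulr0.
transitivity (t * co1 z * ((x ^+ 4 + 6 * x ^+ 2 - 3) - x * (3 * y ^+ 2 + x ^+ 3 + 3 * x))); last first.
  by rewrite h1 h2; ring.
by vecring.
Qed.
End Flex.

(** * Eigenvectors of similitudes *)

Section Eigen.
Variables (p : nat) (F : finFieldType) (nv : F -> nat).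
Hypothesis hp : prime p.
Hypothesis hp3 : (3 < p)%N.
Hypothesis pF : p \in [pchar F].
Hypothesis cF : #|F| = p.
Hypothesis nvK : forall a, (nv a)%:R = a.
Implicit Types (u v w : vec F) (s : {perm vec F}).

Local Notation e1 := (@eb F I1).
Local Notation e2 := (@eb F I2).
Local Notation e3 := (@eb F I3).

(** A similitude that fixes the flex [e3] preserves its tangent [u1 = 0], read from [tri e3 e3], and
    its harmonic polar [u3 = 0], read from [tri e3]. So [e2], where these lines meet, is an
    eigenvector, and then [e1] too. Comparing multipliers leaves a fourth root of unity [c]. *)
Lemma simil_line_e3 s t : s \in simil F -> s e3 = scl t e3 ->
  t != 0 /\ exists2 c, c ^+ 4 = 1 & forall u, s u = scl t (mkv (c ^+ 3 * co1 u) (c * co2 u) (co3 u)).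
Proof.
move=> sG se3; have /(similP hp hp3 pF)[sD [m m0 h]] := sG.
have t0 : t != 0.
  apply/eqP => t0; have : s e3 = s 0.
    by rewrite se3 t0 (simil0 hp hp3 pF sG); apply: vecP; vecring.
  by move/perm_inj/(congr1 (@co3 _))/eqP; rewrite !coordE oner_eq0.
have n2 := nz2F hp3 pF.
have h33 x : t * t * co1 (s x) = m * co1 x.
  have := h e3 e3 x; rewrite se3 => e; transitivity (m * tri e3 e3 x); last by vecring.
  by rewrite -e; vecring.
have a1 x : co1 (s x) = m / t / t * co1 x.
  apply: (mulfI (mulf_neq0 t0 t0)); rewrite h33; field; exact: t0.
have h3 x y : t * (co1 (s x) * co3 (s y) + co3 (s x) * co1 (s y)) = m * (co1 x * co3 y + co3 x * co1 y).
  have := h e3 x y; rewrite se3 => e; transitivity (m * tri e3 x y); last by vecring.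
  by rewrite -e; vecring.
have a0 : m / t / t != 0 by rewrite !mulf_neq0 ?invr_eq0.
have b3 : co3 (s e2) = 0.
  have := h3 e1 e2; rewrite !a1 !coordE !mulr0 !addr0 => /eqP; rewrite mulr1.
  by rewrite mulr0 mulf_eq0 (negPf t0) mulf_eq0 (negPf a0) => /eqP.
have b1 : co1 (s e2) = 0 by rewrite a1 !coordE mulr0.
have d3 : co3 (s e1) = 0.
  have : t * (m / t / t * (2 * co3 (s e1))) = 0.
    transitivity (t * (co1 (s e1) * co3 (s e1) + co3 (s e1) * co1 (s e1))).
      by rewrite a1 !coordE; ring.
    by rewrite h3 !coordE; ring.
  move/eqP; rewrite mulf_eq0 (negPf t0) mulf_eq0 (negPf a0) mulf_eq0 (negPf n2).
  by move/eqP.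
set b := co2 (s e2).
have se2 : s e2 = scl b e2 by apply: vecP; rewrite ?b1 ?b3 -?/b; vecring.
have h22 x : b * b * co2 (s x) = m * co2 x.
  have := h e2 e2 x; rewrite se2 => e; transitivity (m * tri e2 e2 x); last by vecring.
  by rewrite -e; vecring.
have b0 : b != 0.
  apply/eqP => b0; have := h22 e2; rewrite b0 !mul0r !coordE mulr1 => /eqP.
  by rewrite eq_sym (negPf m0).
have d2 : co2 (s e1) = 0.
  have /eqP := h22 e1; rewrite !coordE mulr0 mulf_eq0 mulf_eq0 (negPf b0) => /eqP; exact.
set a := m / t / t in a1 a0.
have se1 : s e1 = scl a e1.
  by apply: vecP; rewrite ?d2 ?d3 ?a1; vecring.
have mt : m = t * t * a by rewrite /a; field.
have mb : m = b * b * b.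
  by have := h22 e2; rewrite -/b !coordE mulr1.
have ma : m = a * a * b.
  have := h e1 e1 e2; rewrite se1 se2 => e.
  transitivity (m * tri e1 e1 e2); first by vecring.
  by rewrite -e; vecring.
have bb : b * b = a * a by apply: (mulIf b0); rewrite -ma mb.
have tab : t * t = a * b.
  apply: (mulIf a0); rewrite -mt mb -mulrA bb; ring.
split=> //; exists (b / t).
  apply: (mulfI (expf_neq0 4 t0)); rewrite mulr1 expr_div_n mulrCA divff ?expf_neq0 // mulr1.
  transitivity ((b * b) * (b * b)); first by ring.
  transitivity ((t * t) * (t * t)); last by ring.
  by rewrite tab {1}bb; ring.
have c3 : (b / t) ^+ 3 = a / t.
  apply: (mulfI (expf_neq0 3 t0)); rewrite expr_div_n mulrCA divff ?expf_neq0 // mulr1.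
  transitivity m; first by rewrite mb; ring.
  by rewrite mt; field.
move=> u; rewrite c3 (add_decomp nvK u sD) se1 se2 se3.
by apply: vecP; rewrite /scl !coordE; field.
Qed.

Lemma diag_simil t c : t != 0 -> c ^+ 4 = 1 -> exists2 s, s \in simil F &
  forall u, s u = scl t (mkv (c ^+ 3 * co1 u) (c * co2 u) (co3 u)).
Proof.
move=> t0 c4.
have c0 : c != 0 by apply: contra_eq_neq c4 => ->; rewrite expr0n /= eq_sym oner_eq0.
apply: (@simil_perm _ _ hp hp3 pF _ (t ^+ 3 * c ^+ 3)).
- by move=> u v; apply: vecP; vecring.
- by rewrite mulf_neq0 ?expf_neq0.
move=> u v w; transitivity (t ^+ 3 * (
   tri u v w * c ^+ 3 + (c ^+ 4 - 1) * c ^+ 3 *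
    (co1 u * co1 v * co2 w + co1 u * co2 v * co1 w + co2 u * co1 v * co1 w))).
  by vecring.
by rewrite c4 subrr; ring.
Qed.

Definition crs u v : vec F := mkv (co2 u * co3 v - co3 u * co2 v)
  (co3 u * co1 v - co1 u * co3 v) (co1 u * co2 v - co2 u * co1 v).

Lemma det3_crs u v x : det3 u v x = dot (crs u v) x.
Proof. by rewrite /crs; vecring. Qed.

Lemma crs_eq0 u v : u != 0 -> crs u v = 0 -> exists t, v = scl t u.
Proof.
move=> u0 e; apply: det3_collinear => // y.
rewrite (_ : det3 v u y = - dot (crs u v) y); last by rewrite /crs; vecring.
by rewrite e; vecring.
Qed.

(** The cubic is smooth enough that the symmetric matrix of [tri n] has rank at least 2 for nonzero
    [n]. *)
Lemma tri_ker n u v : crs u v != 0 -> (forall z, tri n u z = 0) ->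
  (forall z, tri n v z = 0) -> n = 0.
Proof.
move=> k0 hu hv; set k := crs u v in k0 *.
(* rows of the matrix of tri n are orthogonal to u and v, hence parallel to k *)
have par a b c : a * co1 u + b * co2 u + c * co3 u = 0 ->
    a * co1 v + b * co2 v + c * co3 v = 0 ->
    [/\ b * co3 k = c * co2 k, c * co1 k = a * co3 k & a * co2 k = b * co1 k].
  move=> e e'; split; apply/eqP; rewrite -subr_eq0; apply/eqP.
  - transitivity (co1 u * (a * co1 v + b * co2 v + c * co3 v) -
       co1 v * (a * co1 u + b * co2 u + c * co3 u)); last by rewrite e e'; ring.
    by rewrite /k /crs !coordE; ring.
  - transitivity (co2 u * (a * co1 v + b * co2 v + c * co3 v) -
       co2 v * (a * co1 u + b * co2 u + c * co3 u)); last by rewrite e e'; ring.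
    by rewrite /k /crs !coordE; ring.
  - transitivity (co3 u * (a * co1 v + b * co2 v + c * co3 v) -
       co3 v * (a * co1 u + b * co2 u + c * co3 u)); last by rewrite e e'; ring.
    by rewrite /k /crs !coordE; ring.
have [||_ r11 r12] := par (co2 n) (co1 n) (co3 n).
- by rewrite -[RHS](hu e1); vecring.
- by rewrite -[RHS](hv e1); vecring.
have [||r21 r22 r23] := par (co1 n) (co2 n) 0.
- by rewrite -[RHS](hu e2); vecring.
- by rewrite -[RHS](hv e2); vecring.
have [||r31 r32 r33] := par (co3 n) 0 (co1 n).
- by rewrite -[RHS](hu e3); vecring.
- by rewrite -[RHS](hv e3); vecring.
rewrite !mul0r in r21 r22 r31 r33.
have z (a b : F) : b != 0 -> a * b = 0 -> a = 0.
  by move=> b0 /eqP; rewrite mulf_eq0 (negPf b0) orbF => /eqP.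
have [k1|k1] := eqVneq (co1 k) 0; last first.
  have n2 : co2 n = 0 by apply: (z _ _ k1); rewrite -r23 -r31.
  have n3 : co3 n = 0 by apply: (z _ _ k1); rewrite r11 r21.
  have n1 : co1 n = 0 by apply: (z _ _ k1); rewrite r32 n3 mul0r.
  by apply: vecP; rewrite ?n1 ?n2 ?n3.
have [k2|k2] := eqVneq (co2 k) 0; last first.
  have n1 : co1 n = 0 by apply: (z _ _ k2); rewrite -r31.
  have n3 : co3 n = 0 by apply: (z _ _ k2); rewrite r33.
  have n2 : co2 n = 0 by apply: (z _ _ k2); rewrite r12 n1 mul0r.
  by apply: vecP; rewrite ?n1 ?n2 ?n3.
have k3 : co3 k != 0.
  by apply: contra k0 => /eqP k3; apply/eqP/vecP; rewrite ?k1 ?k2 ?k3.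
have n1 : co1 n = 0 by apply: (z _ _ k3); rewrite -r22.
have n2 : co2 n = 0 by apply: (z _ _ k3); rewrite r21.
have n3 : co3 n = 0 by apply: (z _ _ k3); rewrite -r32 n1 mul0r.
by apply: vecP; rewrite ?n1 ?n2 ?n3.
Qed.

(** The cubic contains no line. A combination [w] of [u] and [v] with first coordinate 0 is a
    multiple of [e3], because the cubic is [u2^3] there; and [tri e3 e3] is the first coordinate, so
    it would have to vanish on both [u] and [v]. *)
Lemma no_line u v : crs u v != 0 -> cub u = 0 -> tri u u v = 0 ->
  tri u v v = 0 -> cub v = 0 -> False.
Proof.
move=> k0 h1 h2 h3 h4.
have cub1 w : co1 w = 0 -> cub w = 0 -> co2 w = 0.
  move=> w1 /eqP; rewrite (_ : cub w = co2 w ^+ 3) ?expf_eq0 => [/eqP //|].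
  by rewrite /cub /tri /dot /tau !coordE w1; ring.
have both : co1 u = 0 -> co1 v = 0 -> False.
  move=> u1 v1; have u2 := cub1 u u1 h1; have v2 := cub1 v v1 h4.
  by case/eqP: k0; apply: vecP; rewrite /crs !coordE ?u1 ?v1 ?u2 ?v2; ring.
have ww' w x : co1 w = 0 -> co2 w = 0 -> tri w w x = co3 w ^+ 2 * co1 x.
  by move=> w1 w2; rewrite /tri /dot /tau !coordE w1 w2; ring.
pose w := scl (co1 v) u - scl (co1 u) v.
have tw x y a b : tri (scl a u - scl b v) x y = a * tri u x y - b * tri v x y by vecring.
have w1 : co1 w = 0 by rewrite /w; vecring.
have twu x : (forall y, y = u \/ y = v -> tri u y x = 0 /\ tri v y x = 0) ->
   tri w w x = 0.
  move=> H; rewrite tw; have [a1 a2] := H u (or_introl erefl).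
  have [a3 a4] := H v (or_intror erefl).
  rewrite (_ : tri u w x = co1 v * tri u u x - co1 u * tri u v x); last by rewrite /w; vecring.
  rewrite (_ : tri v w x = co1 v * tri v u x - co1 u * tri v v x); last by rewrite /w; vecring.
  by rewrite a1 a2 a3 a4; ring.
have p1 : tri u u u = 0 by exact: h1.
have p4 : tri v v v = 0 by exact: h4.
have s1 : tri u v u = 0 by rewrite -h2; vecring.
have s2 : tri v u u = 0 by rewrite -h2; vecring.
have s3 : tri v u v = 0 by rewrite -h3; vecring.
have s4 : tri v v u = 0 by rewrite -h3; vecring.
have wwu : tri w w u = 0 by apply: twu => y [] ->.
have wwv : tri w w v = 0 by apply: twu => y [] ->.
have cw : cub w = 0.
  rewrite /cub (_ : tri w w w = co1 v * tri w w u - co1 u * tri w w v).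
    by rewrite wwu wwv; ring.
  by rewrite {3}/w; vecring.
have w2 := cub1 _ w1 cw.
have ww x : tri w w x = co3 w ^+ 2 * co1 x by apply: ww'.
have [w3|w3] := eqVneq (co3 w) 0; last first.
  have z a : co3 w ^+ 2 * a = 0 -> a = 0.
    by move/eqP; rewrite mulf_eq0 expf_eq0 (negPf w3) => /eqP.
  by apply: both; apply: z; rewrite -ww.
have wz : w = 0 by apply: vecP; rewrite ?w1 ?w2 ?w3.
have cz : scl (co1 v) (crs u v) = 0.
  by transitivity (crs w v); [rewrite /w /crs; apply: vecP; vecring |
     rewrite wz /crs; apply: vecP; vecring].
have cz' : scl (co1 u) (crs u v) = 0.
  by transitivity (crs w u); [rewrite /w /crs; apply: vecP; vecring |
     rewrite wz /crs; apply: vecP; vecring].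
have [v1|v1] := eqVneq (co1 v) 0; last by case/eqP: k0; apply: (scl_eq0 v1).
have [u1|u1] := eqVneq (co1 u) 0; last by case/eqP: k0; apply: (scl_eq0 u1).
exact: both.
Qed.
End Eigen.

(** * Similitudes that fix a plane pointwise *)

Section Count.
Variables (p : nat) (F : finFieldType) (nv : F -> nat).
Hypothesis hp : prime p.
Hypothesis hp3 : (3 < p)%N.
Hypothesis pF : p \in [pchar F].
Hypothesis cF : #|F| = p.
Hypothesis nvK : forall a, (nv a)%:R = a.
Implicit Types (u v w : vec F) (s : {perm vec F}).

Local Notation e1 := (@eb F I1).
Local Notation e2 := (@eb F I2).
Local Notation e3 := (@eb F I3).

Lemma cramer u v y x : scl (det3 u v y) x =
  scl (det3 x v y) u + scl (det3 u x y) v + scl (det3 u v x) y.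
Proof. by apply: vecP; vecring. Qed.

(** Such a map is the identity, a transvection or a homology. Transvections are excluded by
    [tri_ker], and invariance of [tri] forces a homology to be harmonic; its centre [n] is then a
    flex. In the contrapositive, a similitude without flex eigenvectors has eigenspaces of dimension
    at most 1. *)
Lemma fixed_plane_flex (r : vec F -> vec F) m u v :
  {morph r : x y / x + y} -> m != 0 ->
  (forall x y z, tri (r x) (r y) (r z) = m * tri x y z) ->
  crs u v != 0 -> r u = u -> r v = v ->
  exists2 P, flex P & exists k, r P = scl k P.
Proof.
move=> rD m0 h k0 ru rv; have rZ := add_scl nvK rD.
have n2 := nz2F hp3 pF.
(* Otherwise the cubic would vanish on the whole fixed plane. *)
have m1 : m = 1.
  apply/eqP; apply: contraT => m1.
  have z x : x = m * x -> x = 0.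
    move=> e; apply/eqP; have : (1 - m) * x = 0 by rewrite mulrBl mul1r -e subrr.
    by move/eqP; rewrite mulf_eq0 subr_eq0 eq_sym (negPf m1).
  case: (@no_line _ u v k0); apply: z; rewrite /cub -h ?ru ?rv //.
have [allfix|/existsP[y yP]] := boolP [forall y, r y == y].
  exists e3; first exact: flex_e3.
  by exists 1; rewrite scl1; apply/eqP; apply: (forallP allfix).
pose n := r y - y; have ry : r y = y + n by rewrite /n addrC subrK.
have n0 : n != 0 by rewrite /n subr_eq0.
clearbody n.
have d0 : det3 u v y != 0.
  apply/eqP => d0.
  have [x xP] : exists x, det3 u v x != 0.
    apply/existsP; apply: contraT; rewrite negb_exists => /forallP H.
    case/eqP: k0; have q x : dot (crs u v) x = 0.
      by rewrite -det3_crs; apply/eqP; rewrite -[_ == _]negbK; apply: H.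
    apply: vecP; [rewrite -[RHS](q e1)|rewrite -[RHS](q e2)|rewrite -[RHS](q e3)]; by vecring.
  have e := cramer u v y x; rewrite d0 in e.
  have e' := congr1 r e; rewrite !rD !rZ ru rv in e'.
  have sc0 w : scl 0 w = 0 by apply: vecP; vecring.
  rewrite !sc0 in e e'; rewrite e in e'; move/addrI: e'.
  move/(congr1 (scl (det3 u v x)^-1)); rewrite !sclA mulVf // !scl1 => e'.
  by rewrite -e' eqxx in yP.
have dec x : exists a b, x = scl a u + scl b v + scl (det3 u v x / det3 u v y) y.
  exists (det3 x v y / det3 u v y), (det3 u x y / det3 u v y).
  transitivity (scl (det3 u v y)^-1 (scl (det3 u v y) x)); first by rewrite sclA mulVf ?scl1.
  rewrite cramer; move: (det3 _ _ _) (det3 _ _ _) (det3 _ _ _) (det3 _ _ _) => q q1 q2 q3.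
  by move: (q^-1) => q'; apply: vecP; vecring.
have h' x z w : tri (r x) (r z) (r w) = tri x z w by rewrite h m1 mul1r.
have N x x' : r x = x -> r x' = x' -> tri n x x' = 0.
  move=> e e'; have := h' x x' y; rewrite e e' ry => q.
  apply: (addrI (tri x x' y)); rewrite addr0 -[RHS]q; by vecring.
have N2 x : r x = x -> 2 * tri n x y + tri n x n = 0.
  move=> e; have := h' x y y; rewrite e ry => q.
  apply: (addrI (tri x y y)); rewrite addr0 -[RHS]q; by vecring.
set c := det3 u v n / det3 u v y.
have [a [b nE]] := dec n; rewrite -/c in nE.
have rn : r n = scl (1 + c) n.
  transitivity (n + scl c n); last by apply: vecP; vecring.
  rewrite [in LHS]nE !rD !rZ ru rv ry sclDr addrA; congr (_ + _); exact: esym.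
have uz w q1 q2 q3 : tri n w (scl q1 u + scl q2 v + scl q3 y) =
   q1 * tri n w u + q2 * tri n w v + q3 * tri n w y by vecring.
have absurd : tri n u y = 0 -> tri n v y = 0 -> False.
  move=> hu hv; case/eqP: n0; apply: (@tri_ker _ n u v) => // z.
    by have [a' [b' ->]] := dec z; rewrite uz (N _ _ ru ru) (N _ _ ru rv) hu; ring.
  by have [a' [b' ->]] := dec z; rewrite uz (N _ _ rv ru) (N _ _ rv rv) hv; ring.
have trin x : r x = x -> tri n x n = c * tri n x y.
  by move=> e; rewrite {2}nE uz (N _ _ e ru) (N _ _ e rv); ring.
have z2 (x : F) : 2 * x = 0 -> x = 0 by move/eqP; rewrite mulf_eq0 (negPf n2) => /eqP.
(* The transvections: [tri n] would kill both [u] and [v]. *)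
have [c0|c0] := eqVneq c 0.
  have q x : r x = x -> tri n x y = 0.
    by move=> e; apply: z2; have := N2 x e; rewrite trin // c0 mul0r addr0.
  by case: absurd; apply: q.
have cn x : tri n x n = 0 -> r x = x -> tri n x y = 0.
  by move=> q e; have := trin x e; rewrite q => /esym/eqP; rewrite mulf_eq0 (negPf c0) => /eqP.
have kap x : r x = x -> (1 + c) ^+ 2 * tri n x n = tri n x n.
  move=> e; rewrite -[RHS]h' rn e; by vecring.
have [k2|k2] := eqVneq ((1 + c) ^+ 2) 1; last first.
  have q x : r x = x -> tri n x n = 0.
    move=> e; have /eqP := kap x e; rewrite -subr_eq0 -{2}(mul1r (tri n x n)) -mulrBl.
    by rewrite mulf_eq0 subr_eq0 (negPf k2) => /eqP.
  by case: absurd; apply: cn => //; apply: q.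
have cub0 : cub n = 0.
  have q : (1 + c) * cub n = cub n.
    rewrite /cub -[RHS]h' rn; transitivity ((1 + c) ^+ 2 * ((1 + c) * tri n n n)).
      by rewrite k2 mul1r.
    by vecring.
  apply/eqP; move/eqP: q; rewrite mulrDl mul1r -subr_eq0 addrAC subrr add0r.
  by rewrite mulf_eq0 (negPf c0).
(* [tri n] vanishes on the fixed plane. A nonzero vector of this plane on which [tri n _ n] also
   vanishes is therefore in the kernel of [tri n], as the definition of a flex demands. *)
have [al0|al0] := eqVneq (tri n u n) 0.
  have [be0|be0] := eqVneq (tri n v n) 0; first by case: absurd; apply: cn.
  exists n; last by exists (1 + c).
  apply/flexP; split=> //; exists u.
    by apply: contra k0 => /eqP ->; apply/eqP/vecP; rewrite /crs; vecring.
  by move=> z; have [a' [b' ->]] := dec z; rewrite uz (N _ _ ru ru) (N _ _ ru rv) (cn u) //; ring.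
exists n; last by exists (1 + c).
apply/flexP; split=> //; exists (scl (tri n v n) u - scl (tri n u n) v).
  apply: contra k0 => /eqP e; apply/eqP; apply: (scl_eq0 al0).
  transitivity (crs (scl (tri n v n) u - scl (tri n u n) v) u).
    by move: (tri n u n) (tri n v n) => q q'; apply: vecP; rewrite /crs; vecring.
  by rewrite e; apply: vecP; rewrite /crs; vecring.
move=> z; have [a' [b' ->]] := dec z.
have lin q q' w : tri n (scl q u - scl q' v) w = q * tri n u w - q' * tri n v w by vecring.
rewrite lin.
by rewrite !uz (N _ _ ru ru) (N _ _ ru rv) (N _ _ rv ru) (N _ _ rv rv) !trin //; ring.
Qed.
End Count.

(** * Counting orbits *)

Section Burnside.
Variables (p : nat) (F : finFieldType) (nv : F -> nat).
Hypothesis hp : prime p.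
Hypothesis hp3 : (3 < p)%N.
Hypothesis pF : p \in [pchar F].
Hypothesis cF : #|F| = p.
Hypothesis nvK : forall a, (nv a)%:R = a.
Implicit Types (u v w : vec F) (s : {perm vec F}).

Local Notation e1 := (@eb F I1).
Local Notation e2 := (@eb F I2).
Local Notation e3 := (@eb F I3).

Definition simil_grp : {group {perm vec F}} := Group (simil_group_set hp hp3 pF).

Definition esp s (t : F) : {set vec F} := [set u | (u != 0) && (s u == scl t u)].
Definition eigs s : {set vec F} := [set u | (u != 0) && [exists t, s u == scl t u]].
Definition vray v : {set vec F} := [set scl a v | a in [set a : F | a != 0]].

Lemma card_nzF : #|[set a : F | a != 0]| = p.-1.
Proof. by rewrite (_ : [set _ | _] = [set~ 0]) ?cardsC1 ?cF //; apply/setP => a; rewrite !inE. Qed.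

Lemma scl_inj v : v != 0 -> injective (fun a => scl a v).
Proof.
move=> v0 a b /= e; apply/eqP; rewrite -subr_eq0; apply: contraT => ab.
case/eqP: v0; apply: (scl_eq0 ab); apply: (addrI (scl b v)).
by rewrite addr0 -[RHS]e; apply: vecP; vecring.
Qed.

Lemma card_vray v : v != 0 -> #|vray v| = p.-1.
Proof. by move=> v0; rewrite card_imset ?card_nzF //; apply: scl_inj. Qed.

Lemma vrayP v u : reflect (exists2 a, a != 0 & u = scl a v) (u \in vray v).
Proof.
by apply: (iffP imsetP) => -[a a0 ->]; exists a => //; move: a0; rewrite inE.
Qed.

Lemma card_eigs s : #|eigs s| = (\sum_t #|esp s t|)%N.
Proof.
transitivity (\sum_t \sum_u (u \in esp s t : nat))%N; last first.
  by apply: eq_bigr => t _; rewrite -sum1_card [RHS]big_mkcond; apply: eq_bigr => u _; case: (u \in _).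
rewrite exchange_big -sum1_card big_mkcond; apply: eq_bigr => u _ /=.
have [|un] := boolP (u \in eigs s).
  rewrite inE => /andP[u0 /existsP[t tE]]; rewrite (bigD1 t) //= inE u0 tE big1 // => t' tt'.
  rewrite inE u0 (eqP tE) /=; case: eqP => // /(scl_inj u0) e.
  by rewrite e eqxx in tt'.
rewrite big1 // => t _; case: (boolP (u \in esp s t)) => //.
rewrite inE => /andP[u0 e]; case/negP: un; rewrite inE u0; apply/existsP; by exists t.
Qed.

(** If the eigenspace contained two independent vectors, [t^-1 s] would fix a plane, and [s] would
    have a flex eigenvector. *)
Lemma card_esp_le s t : s \in simil_grp -> (forall P, flex P -> P \notin eigs s) ->
  (#|esp s t| <= p.-1)%N.
Proof.
move=> sG nof; have [->|[u uE]] := set_0Vmem (esp s t); first by rewrite cards0.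
have := uE; rewrite inE => /andP[u0 /eqP su].
rewrite -(card_vray u0); apply: subset_leq_card; apply/subsetP => v.
rewrite inE => /andP[v0 /eqP sv].
have t0 : t != 0.
  apply/eqP => t0; have : s u == 0 by rewrite su t0; apply/eqP/vecP; vecring.
  by rewrite (simil_eq0 hp hp3 pF _ sG) (negPf u0).
have [k0|k0] := eqVneq (crs u v) 0.
  have [a aE] := crs_eq0 u0 k0; apply/vrayP; exists a => //.
  by apply: contra v0 => /eqP a0; rewrite aE a0; apply/eqP/vecP; vecring.
have /(similP hp hp3 pF)[sD [m m0 h]] := sG.
have [||||||P fP [k kE]] := @fixed_plane_flex p F nv hp3 pF nvK
   (fun x => scl t^-1 (s x)) (t^-1 * t^-1 * t^-1 * m) u v.
- by move=> x y; rewrite sD sclDr.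
- by rewrite !mulf_neq0 ?invr_eq0.
- move=> x y z; transitivity (t^-1 * t^-1 * t^-1 * tri (s x) (s y) (s z)).
    by vecring.
  by rewrite h mulrA.
- exact: k0.
- by rewrite su sclA mulVf // scl1.
- by rewrite sv sclA mulVf // scl1.
case/negP: (nof P fP); rewrite inE; case/flexP: (fP) => -> _ _; apply/existsP.
by exists (t * k); apply/eqP; rewrite -sclA -kE sclA mulfV // scl1.
Qed.

(** The eigenvalues are roots of the characteristic polynomial [q]. Expansion along cofactors shows
    that the determinant, multiplied by each coordinate of an eigenvector, is zero. *)
Lemma eigenvalues_le3 s : s \in simil_grp -> (#|[set t | esp s t != set0]| <= 3)%N.
Proof.
move=> sG; have sD := simil_add hp hp3 pF sG.
have [a1 a1E] : exists a, a = s e1 by exists (s e1).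
have [a2 a2E] : exists a, a = s e2 by exists (s e2).
have [a3 a3E] : exists a, a = s e3 by exists (s e3).
pose c2 := co1 a1 + co2 a2 + co3 a3.
pose c1 := - (co1 a1 * co2 a2 - co2 a1 * co1 a2 + co1 a1 * co3 a3 - co3 a1 * co1 a3
  + co2 a2 * co3 a3 - co3 a2 * co2 a3).
pose q := Poly [:: det3 a1 a2 a3; c1; c2; -1].
have q0 : q != 0.
  apply/eqP => /(congr1 (fun q : {poly F} => q`_3)); rewrite coef_Poly coef0 /=.
  by move/eqP; rewrite oppr_eq0 oner_eq0.
set R := [set t | _].
have rR : all (root q) (enum R).
  apply/allP => t; rewrite mem_enum inE => /set0Pn[u]; rewrite inE => /andP[u0 /eqP su].
  rewrite rootE horner_Poly /=; apply/eqP.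
  have e : scl (co1 u) a1 + scl (co2 u) a2 + scl (co3 u) a3 = scl t u.
    by rewrite -su (add_decomp nvK u sD) a1E a2E a3E.
  have [[e' e''] e'''] := (congr1 (@co1 _) e, congr1 (@co2 _) e, congr1 (@co3 _) e).
  rewrite /scl !coordE in e' e'' e'''.
  set Q := (X in X = 0).
  have QE : Q = det3 (a1 - scl t e1) (a2 - scl t e2) (a3 - scl t e3).
    by rewrite /Q /c1 /c2 /eb; vecring.
  have z x y (A : F) : x = y -> A * (x - y) = 0 by move=> ->; rewrite subrr mulr0.
  have w1 : co1 u * Q = 0.
    rewrite QE.
    transitivity (((co2 a2 - t) * (co3 a3 - t) - co3 a2 * co2 a3) * ((co1 u * co1 a1 + co2 u * co1 a2 + co3 u * co1 a3) - t * co1 u)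
     - (co1 a2 * (co3 a3 - t) - co3 a2 * co1 a3) * ((co1 u * co2 a1 + co2 u * co2 a2 + co3 u * co2 a3) - t * co2 u)
     + (co1 a2 * co2 a3 - (co2 a2 - t) * co1 a3) * ((co1 u * co3 a1 + co2 u * co3 a2 + co3 u * co3 a3) - t * co3 u)).
      by rewrite /eb; vecring.
    by rewrite e' e'' e''' !subrr; ring.
  have w2 : co2 u * Q = 0.
    rewrite QE.
    transitivity (- (co2 a1 * (co3 a3 - t) - co3 a1 * co2 a3) * ((co1 u * co1 a1 + co2 u * co1 a2 + co3 u * co1 a3) - t * co1 u)
     + ((co1 a1 - t) * (co3 a3 - t) - co3 a1 * co1 a3) * ((co1 u * co2 a1 + co2 u * co2 a2 + co3 u * co2 a3) - t * co2 u)
     - ((co1 a1 - t) * co2 a3 - co2 a1 * co1 a3) * ((co1 u * co3 a1 + co2 u * co3 a2 + co3 u * co3 a3) - t * co3 u)).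
      by rewrite /eb; vecring.
    by rewrite e' e'' e''' !subrr; ring.
  have w3 : co3 u * Q = 0.
    rewrite QE.
    transitivity ((co2 a1 * co3 a2 - co3 a1 * (co2 a2 - t)) * ((co1 u * co1 a1 + co2 u * co1 a2 + co3 u * co1 a3) - t * co1 u)
     - ((co1 a1 - t) * co3 a2 - co3 a1 * co1 a2) * ((co1 u * co2 a1 + co2 u * co2 a2 + co3 u * co2 a3) - t * co2 u)
     + ((co1 a1 - t) * (co2 a2 - t) - co2 a1 * co1 a2) * ((co1 u * co3 a1 + co2 u * co3 a2 + co3 u * co3 a3) - t * co3 u)).
      by rewrite /eb; vecring.
    by rewrite e' e'' e''' !subrr; ring.
  apply/eqP; apply: contraT => Q0; case/eqP: u0.
  have zz x : x * Q = 0 -> x = 0 by move/eqP; rewrite mulf_eq0 (negPf Q0) orbF => /eqP.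
  by apply: vecP; apply: zz.
have := max_poly_roots q0 rR (enum_uniq _); rewrite -cardE => lt.
by rewrite -ltnS (leq_trans lt) // size_Poly.
Qed.

Lemma card_eigs_le s : s \in simil_grp -> (forall P, flex P -> P \notin eigs s) ->
  (#|eigs s| <= 3 * p.-1)%N.
Proof.
move=> sG nof; rewrite card_eigs (bigID (mem [set t | esp s t != set0])) /=.
rewrite [X in (_ + X)%N]big1 ?addn0; last first.
  by move=> t; rewrite inE negbK => /eqP ->; rewrite cards0.
apply: (@leq_trans (\sum_(t in [set t | esp s t != set0]) p.-1)%N).
  by apply: leq_sum => t _; apply: card_esp_le.
by rewrite sum_nat_const leq_mul2r eigenvalues_le3 ?orbT.
Qed.

(** Translation by the scalar [t] in the group carries fixed vectors to eigenvectors of eigenvalue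
    [t], so each nonzero [t] contributes the same sum. Burnside's count of fixed vectors becomes a
    count of eigenvectors. *)
Lemma sum_eigs : (\sum_(s in simil_grp) #|eigs s| = p.-1 * \sum_(s in simil_grp) #|esp s 1%R|)%N.
Proof.
under eq_bigr => s _ do rewrite card_eigs.
rewrite exchange_big (bigID (fun t : F => t == 0)) /= big_pred1_eq.
rewrite [X in (X + _)%N]big1 ?add0n; last first.
  move=> s sG; apply/eqP; rewrite cards_eq0; apply/eqP/setP => u; rewrite !inE.
  apply/negP => /andP[u0 /eqP e]; have : s u == 0 by rewrite e; apply/eqP/vecP; vecring.
  by rewrite (simil_eq0 hp hp3 pF _ sG) (negPf u0).
transitivity (\sum_(t : F | t != 0%R) \sum_(s in simil_grp) #|esp s 1%R|)%N; last first.
  by rewrite sum_nat_const -card_nzF; congr (_ * _)%N; apply: eq_card => t; rewrite !inE.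
apply: eq_bigr => t t0; have [r rG rE] := scl_simil hp hp3 pF t0.
rewrite (reindex_inj (mulIg r)); apply: eq_big => s.
  by rewrite (groupMr _ (rG : r \in simil_grp)).
move=> sG; apply: eq_card => u; rewrite !inE permM rE; congr (_ && _).
by rewrite scl1; apply/eqP/eqP => [/(congr1 (scl t^-1))|->//]; rewrite !sclA mulVf // !scl1.
Qed.

Lemma card_orbits : (#|orbit 'P simil_grp @: [set: vec F]| * #|simil_grp| =
   #|simil_grp| + \sum_(s in simil_grp) #|esp s 1%R|)%N.
Proof.
rewrite -Frobenius_Cauchy; last by apply/actsP => s _ u; rewrite !inE.
rewrite -sum1_card -big_split /=; apply: eq_bigr => s sG.
transitivity #|0%R |: esp s 1%R|; last by rewrite cardsU1 inE eqxx.
apply: eq_card => u; rewrite in_setU1 in_setI in_setT [u \in esp _ _]inE scl1 /=; apply/idP/idP.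
  move=> /afix1P; rewrite /= apermE => e; rewrite e eqxx andbT.
  exact: orbN.
by case/orP=> [/eqP ->|/andP[_ /eqP e]]; apply/afix1P; rewrite /= apermE // (simil0 hp hp3 pF sG).
Qed.
End Burnside.

(** * Flexes among the eigenvectors *)

Section DoubleCount.
Variables (p : nat) (F : finFieldType) (nv : F -> nat).
Hypothesis hp : prime p.
Hypothesis hp3 : (3 < p)%N.
Hypothesis pF : p \in [pchar F].
Hypothesis cF : #|F| = p.
Hypothesis nvK : forall a, (nv a)%:R = a.
Implicit Types (u v w : vec F) (s : {perm vec F}).

Local Notation e1 := (@eb F I1).
Local Notation e2 := (@eb F I2).
Local Notation e3 := (@eb F I3).
Local Notation G := (simil_grp hp hp3 pF).

Definition FV : {set vec F} := [set u | flex u].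
Definition AF : {set F * F} := [set xy | affine_flex xy.1 xy.2].
Definition mu4 : {set F} := [set c | c ^+ 4 == 1].
Definition scalar_perm s := [exists t, forall u, s u == scl t u].

Lemma e3_neq0 : e3 != 0.
Proof. by apply/eqP => /(congr1 (@co3 _)) /eqP; rewrite !coordE oner_eq0. Qed.

Lemma card_FV : #|FV| = (p.-1 * #|AF|.+1)%N.
Proof.
pose h (q : F * (F * F)) := scl q.1 (mkv 1 q.2.1 q.2.2).
pose S := setX [set a : F | a != 0] AF.
have -> : FV = vray e3 :|: h @: S.
  apply/setP => u; rewrite !inE; apply/idP/orP.
    case/flex_cases=> // [[t t0 ->]|[t [x [y [t0 hxy ->]]]]].
      by left; apply/vrayP; exists t.
    by right; apply/imsetP; exists (t, (x, y)) => //; rewrite !inE /= t0.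
  case=> [/vrayP[a a0 ->]|/imsetP[[t [x y]]]].
    have [s sG sE] := scl_simil hp hp3 pF a0.
    by rewrite -sE (flex_simil hp hp3 pF) // flex_e3.
  by rewrite !inE /= => /andP[t0 hxy] ->; apply: (flex_affine hp hp3 pF).
rewrite cardsU (_ : _ :&: _ = set0) ?cards0 ?subn0; last first.
  apply/setP => u; rewrite !inE; apply/negP => /andP[/vrayP[a a0 ->] /imsetP[[t [x y]]]].
  rewrite !inE /= => /andP[t0 _] /(congr1 (@co1 _)); rewrite /h /scl !coordE mulr0 mulr1 /= => e.
  by rewrite -e eqxx in t0.
rewrite (card_vray cF e3_neq0) card_in_imset ?cardsX ?(card_nzF cF) ?mulnS //.
move=> [t [x y]] [t' [x' y']]; rewrite !inE /= => /andP[t0 _] /andP[t'0 _] e.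
have [[q1 q2] q3] := (congr1 (@co1 _) e, congr1 (@co2 _) e, congr1 (@co3 _) e).
move: q1 q2 q3; rewrite /h /scl !coordE !mulr1 /= => <- /(mulfI t0) -> /(mulfI t0) ->.
by [].
Qed.

Lemma flex_neq0 u : flex u -> u != 0. Proof. by case/flexP. Qed.

Lemma mem_eigs_conj s h u : s \in G -> h \in G -> (h u \in eigs (s ^ h)%g) = (u \in eigs s).
Proof.
move=> sG hG; rewrite !inE (simil_eq0 hp hp3 pF _ hG); congr (_ && _).
apply: eq_existsb => t; rewrite conjgE !permM permK.
have hZ := add_scl nvK (simil_add hp hp3 pF hG).
by rewrite -hZ (inj_eq (@perm_inj _ h)).
Qed.

Lemma card_eigs_conj s h : s \in G -> h \in G -> #|eigs (s ^ h)%g| = #|eigs s|.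
Proof.
move=> sG hG; rewrite -[RHS](card_imset _ (@perm_inj _ h)); apply: eq_card => u.
by rewrite -(permKV h u) (mem_imset _ _ (@perm_inj _ h)) mem_eigs_conj.
Qed.

(** Double counting of pairs of a similitude and a flex eigenvector. Transitivity on flexes and
    invariance of [w] under conjugation make every flex contribute as much as [e3]. *)
Lemma sum_flex (w : {perm vec F} -> nat) :
  (forall s h, s \in G -> h \in G -> w (s ^ h)%g = w s) ->
  (\sum_(s in G) w s * #|FV :&: eigs s| =
   #|FV| * \sum_(s in G | e3 \in eigs s) w s)%N.
Proof.
move=> wJ.
transitivity (\sum_(u in FV) \sum_(s in G | u \in eigs s) w s)%N; last first.
  rewrite -sum_nat_const; apply: eq_bigr => u; rewrite inE => fu.
  have [h hG hE] := flex_trans hp hp3 pF fu.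
  rewrite (reindex_inj (conjg_inj h)); apply: eq_big => s.
    have [sG|nsG] := boolP (s \in G); last first.
      by rewrite (memJ_norm _ (subsetP (normG G) h hG)) (negPf nsG).
    by rewrite (groupJ sG hG) /= -hE mem_eigs_conj.
  by move=> /andP[+ _]; rewrite (memJ_norm _ (subsetP (normG G) h hG)) => sG; apply: wJ.
rewrite (exchange_big_dep (fun s => s \in G)) /=; last by move=> u s _ /andP[].
apply: eq_bigr => s sG; rewrite mulnC -sum_nat_const; apply: eq_bigl => u.
by rewrite in_setI (sG : s \in G).
Qed.

Lemma scalar_eigs s u : scalar_perm s -> u != 0 -> u \in eigs s.
Proof.
case/existsP=> t /forallP h u0; rewrite inE u0; apply/existsP; exists t; exact: h.
Qed.

(** On an affine flex [(1, x, y)] both [x] and [y] are nonzero. If it were an eigenvector of the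
    diagonal map, its last two coordinates would force [c = 1], a scalar map. *)
Lemma line_e3_eigs s : s \in G -> e3 \in eigs s -> ~~ scalar_perm s ->
  FV :&: eigs s = vray e3.
Proof.
move=> sG; rewrite inE => /andP[_ /existsP[t /eqP se3]] nsc.
have [t0 [c c4 sE]] := simil_line_e3 hp hp3 pF nvK sG se3.
have c1 : c != 1.
  apply: contra nsc => /eqP c1; apply/existsP; exists t; apply/forallP => u.
  by rewrite sE c1 expr1n !mul1r; apply/eqP/vecP; vecring.
apply/setP => u; rewrite in_setI inE; apply/andP/vrayP.
  case=> fu; rewrite inE => /andP[u0 /existsP[k /eqP su]].
  case: (flex_cases fu) => // -[a [x [y [a0 hxy uE]]]].
  have [x0 y0] := affine_flex_neq0 hp hp3 pF hxy.
  have [q2 q3] := (congr1 (@co2 _) su, congr1 (@co3 _) su).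
  move: q2 q3; rewrite sE uE /scl !coordE => q2 q3.
  have kt : t = k by apply: (mulIf (mulf_neq0 a0 y0)).
  case/eqP: c1; apply: (mulIf (mulf_neq0 a0 x0)); apply: (mulfI t0).
  by rewrite q2 kt mul1r.
case=> a a0 ->; have [r rG rE] := scl_simil hp hp3 pF a0; split.
  by rewrite -rE (flex_simil hp hp3 pF) // flex_e3.
rewrite inE -{1}rE (simil_eq0 hp hp3 pF _ rG) e3_neq0; apply/existsP; exists t.
rewrite (add_scl nvK (simil_add hp hp3 pF sG)) se3 !sclA mulrC //.
Qed.

Lemma card_flex_eigs s : s \in G -> ~~ scalar_perm s ->
  (exists2 u, flex u & u \in eigs s) -> #|FV :&: eigs s| = p.-1.
Proof.
move=> sG nsc [u fu us]; have [h hG hE] := flex_trans hp hp3 pF fu.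
have hiG : (h^-1)%g \in G by rewrite groupV.
have e3s : e3 \in eigs (s ^ h^-1)%g.
  by rewrite -(permK h e3) hE mem_eigs_conj.
have nsc' : ~~ scalar_perm (s ^ h^-1)%g.
  apply: contra nsc => /existsP[t /forallP q]; apply/existsP; exists t; apply/forallP => x.
  have hZ := add_scl nvK (simil_add hp hp3 pF hG).
  have /eqP := q ((h^-1)%g x); rewrite conjgE invgK !permM permKV => e.
  by rewrite -(permKV h (s x)) e hZ permKV.
have E := line_e3_eigs (groupJ sG hiG) e3s nsc'.
rewrite -(card_vray cF e3_neq0) -E -[RHS](card_imset _ (@perm_inj _ h)); apply: eq_card => x.
rewrite -(permKV h x) (mem_imset _ _ (@perm_inj _ h)) permKV !in_setI.
rewrite -[in RHS](mem_eigs_conj _ (groupJ sG hiG) hG) conjgKV permKV; congr (_ && _).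
rewrite !inE; apply/idP/idP => q; last by rewrite -(permKV h x) (flex_simil hp hp3 pF).
exact: (flex_simil hp hp3 pF).
Qed.
End DoubleCount.

(** * The equation for the number of orbits *)

Section OrbitEquation.
Variables (p : nat) (F : finFieldType) (nv : F -> nat).
Hypothesis hp : prime p.
Hypothesis hp3 : (3 < p)%N.
Hypothesis pF : p \in [pchar F].
Hypothesis cF : #|F| = p.
Hypothesis nvK : forall a, (nv a)%:R = a.
Implicit Types (u v w : vec F) (s : {perm vec F}).

Local Notation e1 := (@eb F I1).
Local Notation e2 := (@eb F I2).
Local Notation e3 := (@eb F I3).
Local Notation G := (simil_grp hp hp3 pF).

(** The number of eigenvectors of [diag (c^3, c, 1)] for a fourth root of unity [c]: all nonzero
    vectors, a plane and a line, or three lines. *)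
Definition eigs_diag (c : F) : nat :=
  if c == 1 then (p ^ 3).-1 else if c == -1 then ((p ^ 2).-1 + p.-1)%N else (3 * p.-1)%N.

Lemma card_nzv : #|[set u : vec F | u != 0]| = (p ^ 3).-1.
Proof.
rewrite (_ : [set _ | _] = [set~ 0]); last by apply/setP => u; rewrite !inE.
by rewrite cardsC1 !card_prod cF !expnS muln1 mulnA.
Qed.

Lemma eb_neq0 i : @eb F i != 0.
Proof.
by case: i; apply/eqP => e;
  [move/(congr1 (@co1 _)): e|move/(congr1 (@co2 _)): e|move/(congr1 (@co3 _)): e];
  rewrite !coordE => /eqP; rewrite oner_eq0.
Qed.

Lemma card_eigs_diag s t c : t != 0 -> c ^+ 4 = 1 ->
  (forall u, s u = scl t (mkv (c ^+ 3 * co1 u) (c * co2 u) (co3 u))) ->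
  #|eigs s| = eigs_diag c.
Proof.
move=> t0 c4 sE; rewrite /eigs_diag.
have memE u : (u \in eigs s) = (u != 0) &&
    [exists k, [&& c ^+ 3 * co1 u == k * co1 u, c * co2 u == k * co2 u & co3 u == k * co3 u]].
  rewrite inE; congr (_ && _); apply/existsP/existsP => -[k].
    move=> /eqP e; exists (k / t).
    have [[q1 q2] q3] := (congr1 (@co1 _) e, congr1 (@co2 _) e, congr1 (@co3 _) e).
    move: q1 q2 q3; rewrite sE /scl !coordE => q1 q2 q3.
    have z x y : t * x = k * y -> x == k / t * y.
      by move=> q; apply/eqP; apply: (mulfI t0); rewrite q; field.
    by rewrite !z.
  case/and3P=> /eqP q1 /eqP q2 /eqP q3; exists (t * k); rewrite sE.
  by apply/eqP/vecP; rewrite /scl !coordE -mulrA ?q1 ?q2 -?q3.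
have n2 := nz2F hp3 pF.
have m1' : (1 : F) != -1 by rewrite -subr_eq0 opprK.
have m3 : (-1 : F) ^+ 3 = -1 by ring.
have [c1|c1] := eqVneq c 1.
  rewrite -card_nzv; apply: eq_card => u; rewrite memE inE; case: eqP => //= _.
  by apply/existsP; exists 1; rewrite c1 expr1n !mul1r !eqxx.
have cancel1 (k x : F) a : k * x == a * x -> a != k -> x = 0.
  by rewrite -subr_eq0 -mulrBl mulf_eq0 subr_eq0 eq_sym => /orP[/eqP->|/eqP//]; rewrite eqxx.
have [cm|cm] := eqVneq c (-1).
  pose h (ab : F * F) := mkv ab.1 ab.2 0.
  have hi : injective h by move=> [a b] [a' b'] [-> ->].
  have cX : #|[set ab : F * F | ab != (0, 0)]| = (p ^ 2).-1.
    rewrite (_ : [set ab : F * F | ab != (0, 0)] = [set~ (0, 0)]); last by apply/setP => ab; rewrite !inE.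
    by rewrite cardsC1 card_prod cF !expnS muln1.
  rewrite -cX -(card_vray cF (eb_neq0 I3)) -(card_imset _ hi).
  rewrite -cardsUI (_ : _ :&: _ = set0) ?cards0 ?addn0; last first.
    apply/setP => u; rewrite !inE; apply/negP => /andP[/imsetP[ab _ ->] /vrayP[a a0]].
    by move/(congr1 (@co3 _)); rewrite /h /scl !coordE mulr1 => /eqP; rewrite eq_sym (negPf a0).
  apply: eq_card => u; rewrite memE in_setU; apply/idP/orP.
    case/andP=> u0 /existsP[k /and3P[q1 q2 q3]].
    have [z3|z3] := eqVneq (co3 u) 0.
      left; apply/imsetP; exists (co1 u, co2 u); last by apply: vecP; rewrite /h ?coordE.
      rewrite inE; apply: contra u0 => /eqP[z1 z2]; apply/eqP/vecP; by rewrite ?z1 ?z2 ?z3.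
    have k1 : k = 1 by apply: (mulIf z3); rewrite mul1r -(eqP q3).
    right; apply/vrayP; exists (co3 u) => //.
    rewrite k1 cm m3 in q1; rewrite k1 cm in q2.
    have z1 := cancel1 _ _ _ q1 m1'; have z2 := cancel1 _ _ _ q2 m1'.
    by apply: vecP; rewrite ?z1 ?z2 /eb; vecring.
  case=> [/imsetP[[a b]]|/vrayP[a a0 ->]].
    rewrite inE => ab0 ->; apply/andP; split.
      apply: contra ab0 => /eqP e.
      have [q1 q2] := (congr1 (@co1 _) e, congr1 (@co2 _) e).
      by move: q1 q2; rewrite /h !coordE /= => -> ->.
    apply/existsP; exists (-1); rewrite /h !coordE /= cm m3 mulr0 !eqxx.
    by [].
  apply/andP; split; first by apply: contra a0 => /eqP /(congr1 (@co3 _)); rewrite /scl !coordE mulr1 => ->.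
  by apply/existsP; exists 1; rewrite /scl !coordE !mulr0 mul1r !eqxx.
have c2 : c ^+ 2 = -1.
  have : (c ^+ 2 - 1) * (c ^+ 2 + 1) = 0.
    by transitivity (c ^+ 4 - 1); [ring | rewrite c4 subrr].
  move/eqP; rewrite mulf_eq0 subr_eq0 sqrf_eq1 (negPf c1) (negPf cm) /= addr_eq0.
  by move/eqP.
have c0 : c != 0 by apply: contra_eq_neq c4 => ->; rewrite expr0n /= eq_sym oner_eq0.
have c3 : c ^+ 3 = - c by rewrite exprS c2 mulrN1.
have mc1 : - c != 1 by rewrite eqr_oppLR.
have cmc : c != - c.
  by rewrite -subr_eq0 opprK -mulr2n -mulr_natl mulf_neq0.
rewrite (_ : eigs s = vray e1 :|: vray e2 :|: vray e3); last first.
  apply/setP => u; rewrite memE !in_setU; apply/idP/idP.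
    case/andP=> u0 /existsP[k /and3P[q1 q2 q3]]; rewrite c3 in q1.
    have uE : u = mkv (co1 u) (co2 u) (co3 u) by apply: vecP.
    have [z1|z1] := eqVneq (co1 u) 0; last first.
      have k1 : k = - c by apply: (mulIf z1); rewrite -(eqP q1).
      rewrite k1 in q2 q3; rewrite -[X in X == _]mul1r in q3.
      suff -> : u \in vray e1 by [].
      have z2 : co2 u = 0 by apply: (cancel1 _ _ _ q2); rewrite eq_sym.
      have z3 := cancel1 _ _ _ q3 mc1.
      by apply/vrayP; exists (co1 u) => //; apply: vecP; rewrite ?z2 ?z3 /eb; vecring.
    have [z2|z2] := eqVneq (co2 u) 0; last first.
      have k1 : k = c by apply: (mulIf z2); rewrite -(eqP q2).
      rewrite k1 in q3; rewrite -[X in X == _]mul1r in q3.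
      suff -> : u \in vray e2 by rewrite orbT.
      have z3 := cancel1 _ _ _ q3 c1.
      by apply/vrayP; exists (co2 u) => //; apply: vecP; rewrite ?z1 ?z3 /eb; vecring.
    suff -> : u \in vray e3 by rewrite orbT.
    apply/vrayP; exists (co3 u); last by apply: vecP; rewrite ?z1 ?z2 /eb; vecring.
    by apply: contra u0 => /eqP z3; apply/eqP/vecP; rewrite ?z1 ?z2 ?z3.
  have nz (a : F) i : a != 0 -> scl a (eb i) != 0.
    by move=> a0; apply: contra (eb_neq0 i) => /eqP /(scl_eq0 a0) ->.
  case/orP=> [/orP[]|] /vrayP[a a0 ->]; rewrite nz //=; apply/existsP.
  - by exists (- c); rewrite c3 /scl !coordE !mulr0 !eqxx.
  - by exists c; rewrite c3 /scl !coordE !mulr0 !eqxx.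
  - by exists 1; rewrite c3 /scl !coordE !mulr0 !mul1r !eqxx.
have d1 : (vray e1 :|: vray e2) :&: vray e3 = set0.
  apply/setP => u; rewrite !inE; apply/negP => /andP[H /vrayP[a a0 uE]].
  case/orP: H => /vrayP[b b0]; rewrite uE => /(congr1 (@co3 _)) /eqP;
    by rewrite /scl !coordE mulr1 mulr0 (negPf a0).
have d2 : vray e1 :&: vray e2 = set0.
  apply/setP => u; rewrite !inE; apply/negP => /andP[/vrayP[b b0 ->] /vrayP[a a0]].
  by move=> /(congr1 (@co1 _)) /eqP; rewrite /scl !coordE mulr1 mulr0 (negPf b0).
by rewrite !cardsU d1 d2 !cards0 !subn0 !(card_vray cF (eb_neq0 _)); lia.
Qed.

Lemma co_e3 (a : F) : co3 (scl a e3) = a.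
Proof. by rewrite /scl !coordE mulr1. Qed.

Lemma sum_line_e3 (w : F -> nat) (W : {perm vec F} -> nat) :
  (forall s t c, t != 0 -> c ^+ 4 = 1 ->
    (forall u, s u = scl t (mkv (c ^+ 3 * co1 u) (c * co2 u) (co3 u))) -> W s = w c) ->
  (\sum_(s in G | e3 \in eigs s) W s = p.-1 * \sum_(c in mu4 F) w c)%N.
Proof.
move=> WE; pose D := [set s in G | e3 \in eigs s].
pose d s := (co3 (s e3), co2 (s e2) / co3 (s e3)).
have DP s : s \in D -> exists t c, [/\ t != 0, c ^+ 4 = 1, d s = (t, c) &
    forall u, s u = scl t (mkv (c ^+ 3 * co1 u) (c * co2 u) (co3 u))].
  rewrite inE => /andP[sG]; rewrite inE => /andP[_ /existsP[t /eqP se3]].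
  have [t0 [c c4 sE]] := simil_line_e3 hp hp3 pF nvK sG se3.
  exists t, c; split=> //; rewrite /d !sE /scl !coordE !mulr1; congr (_, _).
  by field.
have di : {in D &, injective d}.
  move=> s s' /DP[t [c [t0 c4 dE sE]]] /DP[t' [c' [t'0 c'4 dE' sE']]].
  rewrite dE dE' => -[tt cc]; apply/permP => u; by rewrite sE sE' tt cc.
have dD : d @: D = setX [set a : F | a != 0] (mu4 F).
  apply/setP => -[t c]; rewrite !inE /=; apply/imsetP/andP.
    case=> s /DP[t' [c' [t0 c4 dE _]]]; rewrite dE => -[-> ->]; by rewrite c4.
  case=> t0 /eqP c4; have [s sG sE] := diag_simil hp hp3 pF t0 c4.
  exists s; last by rewrite /d !sE /scl !coordE !mulr1; congr (_, _); field.
  rewrite inE (sG : s \in G) inE (e3_neq0 F) /=; apply/existsP; exists t.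
  by rewrite sE; apply/eqP/vecP; rewrite /eb; vecring.
transitivity (\sum_(s in D) w (d s).2)%N.
  apply: eq_big => s; first by rewrite [RHS]in_set.
  move=> sD; have /DP[t [c [t0 c4 dE sE]]] : s \in D by rewrite in_set.
  by rewrite dE; apply: (WE s t c).
rewrite -(big_imset (fun tc => w tc.2) di) dD -(card_nzF cF) -sum_nat_const pair_big /=.
by apply: eq_bigl => -[t c]; rewrite in_setX.
Qed.

(** Orbit and stabiliser of the vector [e3]: the orbit is the set of flexes, and a stabilising map
    is diagonal, given by [c]. *)
Lemma card_simil : #|G| = (#|FV F| * #|mu4 F|)%N.
Proof.
rewrite -(card_orbit_stab 'P G e3).
have -> : orbit 'P G e3 = FV F.
  apply/setP => u; rewrite inE; apply/orbitP/idP => [[s sG <-]|fu].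
    by rewrite /= apermE (flex_simil hp hp3 pF) // flex_e3.
  by have [s sG sE] := flex_trans hp hp3 pF fu; exists s.
congr (_ * _)%N; pose d s := co2 (s e2).
have DP s : s \in 'C_G[e3 | 'P]%g -> exists c, [/\ c ^+ 4 = 1, d s = c &
    forall u, s u = mkv (c ^+ 3 * co1 u) (c * co2 u) (co3 u)].
  rewrite in_setI => /andP[sG /astab1P]; rewrite /= apermE => se3.
  have [|_ [c c4 sE]] := @simil_line_e3 _ _ _ hp hp3 pF nvK s 1 sG; first by rewrite scl1.
  by exists c; split=> // [|u]; rewrite /d !sE ?scl1 ?coordE ?mulr1.
rewrite -(card_in_imset (f := d)); last first.
  move=> s s' /DP[c [c4 dE sE]] /DP[c' [c'4 dE' sE']].
  by rewrite dE dE' => cc; apply/permP => u; rewrite sE sE' cc.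
apply: eq_card => c; apply/imsetP/idP.
  by case=> s /DP[c' [c4 dE _]] ->; rewrite dE inE c4.
rewrite inE => /eqP c4; have [s sG sE] := diag_simil hp hp3 pF (oner_neq0 F) c4.
exists s; last by rewrite /d sE scl1 !coordE mulr1.
rewrite in_setI (sG : s \in G); apply/astab1P; rewrite /= apermE sE scl1.
by apply: vecP; rewrite /eb; vecring.
Qed.

Lemma sum_ew : (2 <= #|mu4 F|)%N /\
  (\sum_(c in mu4 F) eigs_diag c = (p ^ 3).-1 + ((p ^ 2).-1 + p.-1) + (#|mu4 F| - 2) * (3 * p.-1))%N.
Proof.
have m1 : (-1 : F) != 1 by rewrite eq_sym -subr_eq0 opprK; apply: (nz2F hp3 pF).
have i1 : (1 : F) \in mu4 F by rewrite inE expr1n.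
have i2 : (-1 : F) \in mu4 F by rewrite inE; apply/eqP; ring.
have c2 : #|mu4 F| = (#|mu4 F :\ 1 :\ (-1)|).+2.
  by rewrite (cardsD1 1) i1 (cardsD1 (-1)) in_setD1 m1 i2.
split; first by rewrite c2.
rewrite (bigD1 1) // (bigD1 (-1)) /=; last by rewrite i2.
rewrite /eigs_diag eqxx (negPf m1) eqxx addnA; congr (_ + _)%N.
rewrite (eq_bigr (fun=> (3 * p.-1)%N)); last first.
  by move=> c /andP[/andP[_ n1] n2]; rewrite (negPf n1) (negPf n2).
rewrite c2 !subSS subn0 -sum_nat_const; apply: eq_bigl => c.
by rewrite !in_setD1; case: (c == 1); case: (c == -1); case: (c \in mu4 F).
Qed.

Lemma card_scalars : #|[set s in G | scalar_perm s]| = p.-1.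
Proof.
pose d s := co3 (s e3).
rewrite -(card_nzF cF) -(card_in_imset (f := d)); last first.
  move=> s s'; rewrite !in_set => /andP[_ /existsP[t /forallP h]] /andP[_ /existsP[t' /forallP h']].
  rewrite /d (eqP (h _)) (eqP (h' _)) !co_e3 => tt.
  by apply/permP => u; rewrite (eqP (h _)) (eqP (h' _)) tt.
apply: eq_card => t; rewrite inE; apply/imsetP/idP.
  case=> s; rewrite in_set => /andP[sG /existsP[t' /forallP h]] ->.
  rewrite /d (eqP (h _)) co_e3; apply/eqP => t0.
  have := simil_eq0 hp hp3 pF e3 sG; rewrite (eqP (h _)) t0 (negPf (e3_neq0 F)) => /negP[].
  by apply/eqP/vecP; vecring.
move=> t0; have [s sG sE] := scl_simil hp hp3 pF t0.
exists s; last by rewrite /d sE co_e3.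
rewrite in_set (sG : s \in G); apply/existsP; exists t; apply/forallP => u; by rewrite sE.
Qed.

(** Burnside's lemma multiplied by [p - 1], with the group split into scalars, other maps with a
    flex eigenvector, and maps without one. Eigenvectors of the first two kinds are counted exactly.
    The third kind has [(p - 1) #|AF F|] members with at most [3 (p - 1)] eigenvectors each; [e] is
    their total divided by [(p - 1)^2]. *)
Lemma orbit_equation : exists e, (e <= 3 * #|AF F|)%N /\
  ((#|orbit 'P G @: [set: vec F]|.-1) * (#|AF F|.+1 * #|mu4 F|) =
   p ^ 2 + p + 1 + #|AF F|.+1 * (p + 2 + 3 * (#|mu4 F| - 2)) + e)%N
  /\ (0 < #|orbit 'P G @: [set: vec F]|)%N.
Proof.
set n := #|orbit _ _ @: _|; set A := #|AF F|; set k := #|mu4 F|.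
pose sc := [pred s : {perm vec F} | scalar_perm s].
pose hf := [pred s : {perm vec F} | [exists u, flex u && (u \in eigs s)]].
have e3F : e3 \in FV F by rewrite inE flex_e3.
have split (f : {perm vec F} -> nat) : (\sum_(s in G) f s =
   \sum_(s in G | sc s) f s + (\sum_(s in G | ~~ sc s && hf s) f s +
    \sum_(s in G | ~~ sc s && ~~ hf s) f s))%N.
  rewrite (bigID sc) /=; congr (_ + _)%N; rewrite (bigID hf) /=.
  by congr (_ + _)%N; apply: eq_bigl => s; rewrite andbA.
have phi_sc s : sc s -> #|FV F :&: eigs s| = #|FV F|.
  move=> scs; apply: eq_card => u; rewrite in_setI; case: (boolP (u \in FV F)) => //.
  by rewrite inE => /flex_neq0 u0; apply: scalar_eigs.
have phi_hf s : s \in G -> ~~ sc s && hf s -> #|FV F :&: eigs s| = p.-1.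
  move=> sG /andP[nsc /existsP[u /andP[fu us]]].
  by apply: (card_flex_eigs cF nvK sG) => //; exists u.
have phi_n s : s \in G -> ~~ hf s -> #|FV F :&: eigs s| = 0%N.
  move=> sG nh; apply/eqP; rewrite cards_eq0; apply/eqP/setP => u; rewrite in_setI in_set in_set0.
  apply/negP => /andP[fu us]; case/existsP: nh; by exists u; rewrite fu.
have nsum (f : {perm vec F} -> nat) : (\sum_(s in G) f s * #|FV F :&: eigs s| =
   (\sum_(s in G | sc s) f s) * #|FV F| + (\sum_(s in G | ~~ sc s && hf s) f s) * p.-1)%N.
  rewrite (split (fun s => f s * #|FV F :&: eigs s|)%N) !big_distrl /=; congr (_ + _)%N.
    by apply: eq_bigr => s /andP[sG scs]; rewrite phi_sc.
  rewrite [X in (_ + X)%N]big1 ?addn0; last first.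
    by move=> s /and3P[sG _ nh]; rewrite phi_n ?muln0.
  by apply: eq_bigr => s /andP[sG scs]; rewrite phi_hf.
have csc : (\sum_(s in G | sc s) 1 = p.-1)%N.
  rewrite -card_scalars -sum1_card; apply: eq_bigl => s; by rewrite in_set.
have esc : (\sum_(s in G | sc s) #|eigs s| = p.-1 * (p ^ 3).-1)%N.
  rewrite -csc big_distrl /=; apply: eq_bigr => s /andP[sG scs].
  rewrite mul1n -card_nzv; apply: eq_card => u; rewrite !in_set; case: (boolP (u != 0)) => //= u0.
  by have := scalar_eigs scs u0; rewrite in_set u0.
(* The double count is used twice: weight 1 counts the maps of the second kind, weight [#|eigs s|]
   counts their eigenvectors. *)
have : (\sum_(s in G) 1 * #|FV F :&: eigs s| =
   #|FV F| * \sum_(s in G | e3 \in eigs s) 1)%N by apply: (sum_flex nvK).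
rewrite nsum csc (sum_line_e3 (w := fun _ => 1%N)) // sum_nat_const muln1 -/k => q1.
have : (\sum_(s in G) #|eigs s| * #|FV F :&: eigs s| =
   #|FV F| * \sum_(s in G | e3 \in eigs s) #|eigs s|)%N.
  apply: (@sum_flex p F nv hp hp3 pF nvK (fun s => #|eigs s|)) => s h sG hG.
  exact: (card_eigs_conj nvK sG hG).
rewrite nsum esc (sum_line_e3 (w := eigs_diag)); last exact: card_eigs_diag.
have [k2 ->] := sum_ew => q2; rewrite -/k in k2 q2.
have cG := card_simil; rewrite -/k in cG.
have gs : (#|G| = p.-1 + (\sum_(s in G | ~~ sc s && hf s) 1 +
    \sum_(s in G | ~~ sc s && ~~ hf s) 1))%N.
  by rewrite -sum1_card (split (fun _ => 1%N)) csc.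
have es := split (fun s => #|eigs s|); rewrite esc (sum_eigs hp hp3 pF cF) in es.
have ob := card_orbits hp hp3 pF; rewrite -/n in ob.
have le : (\sum_(s in G | ~~ sc s && ~~ hf s) #|eigs s| <=
   3 * p.-1 * \sum_(s in G | ~~ sc s && ~~ hf s) 1)%N.
  rewrite big_distrr /=; apply: leq_sum => s /and3P[sG _ nh]; rewrite muln1.
  apply: (@card_eigs_le _ _ _ hp hp3 pF cF nvK s sG) => P fP; apply: contra nh => PE.
  by apply/existsP; exists P; rewrite fP.
rewrite (card_FV hp hp3 pF cF) -/A in q1 q2 cG.
have n0 : (0 < n)%N.
  by apply/card_gt0P; exists (orbit 'P G 0); apply: imset_f; rewrite inE.
move: q1 q2 cG gs es ob le.
move: (\sum_(s in G | ~~ sc s && hf s) 1)%N (\sum_(s in G | ~~ sc s && ~~ hf s) 1)%N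
  (\sum_(s in G | ~~ sc s && hf s) #|eigs s|)%N
  (\sum_(s in G | ~~ sc s && ~~ hf s) #|eigs s|)%N
  (\sum_(s in G) #|esp s 1%R|)%N #|G| => a b ea eb' fx g.
move: (hp3) n0 k2; move: (n) (k) (A) => {}n {}k {}A.
case: (p) => // q; rewrite [q.+1.-1]/= => q3 n0 k2 q1 q2 cG gs es ob le.
have [n' nE] : exists n', n = n'.+1 by exists n.-1; rewrite prednK.
have [k' kE] : exists k', k = k'.+2 by exists k.-2; lia.
subst n k; rewrite [n'.+1.-1]/=.
have qp : (0 < q)%N by lia.
have P3 : (q.+1 ^ 3).-1 = (q * (q.+1 ^ 2 + q.+1 + 1))%N.
  by rewrite (_ : q.+1 ^ 3 = (q * (q.+1 ^ 2 + q.+1 + 1)).+1)%N // !expnS expn0; lia.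
have P2 : (q.+1 ^ 2).-1 = (q * (q.+1 + 1))%N.
  by rewrite (_ : q.+1 ^ 2 = (q * (q.+1 + 1)).+1)%N // !expnS expn0; lia.
rewrite P3 P2 in q2 es; rewrite subn2 [k'.+2.-2]/= in q2 *.
set Y := (q.+1 ^ 2 + q.+1 + 1)%N in q2 es *.
have aE : a = (q * (A.+1 * k'.+1))%N.
  by apply/eqP; rewrite -(eqn_pmul2r qp) -(eqn_add2l (q * (q * A.+1))) q1; apply/eqP; ring.
(* The maps without flex eigenvectors are what remains of the group: the nonzero translations times
   the scalars. *)
have bE : b = (q * A)%N.
  apply/eqP; rewrite -(eqn_add2l (q + a)) -addnA -gs cG aE; apply/eqP; ring.
have eaE : ea = (q * q * (A.+1 * (q.+1 + 2 + 3 * k')))%N.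
  apply/eqP; rewrite -(eqn_pmul2r qp) -(eqn_add2l (q * (q * Y) * (q * A.+1))) q2.
  by apply/eqP; ring.
have fxE : fx = (n' * g)%N by apply/eqP; rewrite -(eqn_add2l g) -ob mulSn.
have main : (q * q * (n' * (A.+1 * k'.+2)) =
    q * q * (Y + A.+1 * (q.+1 + 2 + 3 * k')) + eb')%N.
  transitivity (q * fx)%N; first by rewrite fxE cG; ring.
  by rewrite es eaE; ring.
have qq : (0 < q * q)%N by rewrite muln_gt0 qp.
have leY : (Y + A.+1 * (q.+1 + 2 + 3 * k') <= n' * (A.+1 * k'.+2))%N.
  by rewrite -(leq_pmul2l qq) main leq_addr.
exists (n' * (A.+1 * k'.+2) - (Y + A.+1 * (q.+1 + 2 + 3 * k')))%N.
split; last by rewrite subnKC.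
rewrite -(leq_pmul2l qq) mulnBr main addKn (leq_trans le) // bE.
by apply/eq_leq; ring.
Qed.
End OrbitEquation.

(** * Arithmetic in the prime field *)

Section Arithmetic.
Variables (p : nat) (F : finFieldType).
Hypothesis hp : prime p.
Hypothesis hp3 : (3 < p)%N.
Hypothesis pF : p \in [pchar F].
Hypothesis cF : #|F| = p.

Let n2 : (2 : F) != 0 := nz2F hp3 pF.
Let n3 : (3 : F) != 0 := nz3F hp3 pF.

Lemma expf_pred (x : F) : x != 0 -> x ^+ p.-1 = 1.
Proof.
move=> x0; apply: (mulfI x0); rewrite mulr1 -exprS prednK ?prime_gt0 //.
by rewrite -cF expf_card.
Qed.

Lemma prim_root_ex : exists z : F, (p.-1).-primitive_root z.
Proof.
pose rs := enum [set a : F | a != 0].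
have p1 : (0 < p.-1)%N by rewrite -ltnS prednK ?prime_gt1 ?prime_gt0.
have /hasP[z _ zP] : has (p.-1).-primitive_root rs.
  apply: (has_prim_root p1); last 2 first.
  - exact: enum_uniq.
  - by rewrite -cardE (card_nzF cF).
  by apply/allP => x; rewrite mem_enum inE => x0; rewrite unity_rootE expf_pred.
by exists z.
Qed.

Definition issq (x : F) := exists y, y ^+ 2 = x.

(** Both are odd powers of a generator of the multiplicative group. *)
Lemma issq_prod (x y : F) : x != 0 -> y != 0 -> ~ issq x -> ~ issq y -> issq (x * y).
Proof.
move=> x0 y0 nx ny; have [z zP] := prim_root_ex.
have [i xE] := prim_rootP zP (expf_pred x0); have [j yE] := prim_rootP zP (expf_pred y0).
have ev (k : nat) : ~~ odd k -> issq (z ^+ k).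
  by move=> ok; exists (z ^+ k./2); rewrite -exprM muln2 even_halfK.
have oi : odd i by apply: contraT => /ev; rewrite -xE.
have oj : odd j by apply: contraT => /ev; rewrite -yE.
by rewrite xE yE -exprD; apply: ev; rewrite oddD oi oj.
Qed.

Lemma prim_pow (d m : nat) : p.-1 = (d * m)%N -> (1 < d)%N -> exists2 w : F, w ^+ d = 1 & w != 1.
Proof.
move=> e d1; have [z zP] := prim_root_ex; exists (z ^+ m); first by rewrite -exprM mulnC -e (prim_expr_order zP).
have m0 : (0 < m)%N.
  by case: m e => // e; have := prime_gt1 hp; rewrite -(prednK (prime_gt0 hp)) e muln0.
rewrite -(prim_order_dvd zP) e; apply/negP => /(dvdn_leq m0).
by rewrite leqNgt -{1}(mul1n m) ltn_pmul2r // d1.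
Qed.

Lemma sqrt_m1 : (p %% 4 = 1)%N -> exists i : F, i ^+ 2 = -1.
Proof.
move=> e; have [m mE] : exists m, p.-1 = (2 * (2 * m))%N.
  by exists (p %/ 4)%N; have := divn_eq p 4; rewrite e; lia.
have [z zP] := prim_root_ex.
exists (z ^+ m); rewrite -exprM.
have w2 : (z ^+ (m * 2)) ^+ 2 = 1 by rewrite -exprM (_ : m * 2 * 2 = p.-1)%N ?(prim_expr_order zP) // mE; lia.
have w1 : z ^+ (m * 2) != 1.
  rewrite -(prim_order_dvd zP) mE gtnNdvd //.
    by have := hp3; have := mE; lia.
  by have := hp3; have := mE; lia.
by move/eqP: w2; rewrite sqrf_eq1 (negPf w1) => /eqP.
Qed.

Lemma nsqrt_m1 (i : F) : (p %% 4 = 3)%N -> i ^+ 2 <> -1.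
Proof.
move=> e iE; have [m mE] : exists m, p.-1 = (2 * (2 * m).+1)%N.
  by exists (p %/ 4)%N; have := divn_eq p 4; rewrite e; lia.
have i0 : i != 0.
  by apply/eqP => i0; move/eqP: iE; rewrite i0 expr0n /= eq_sym oppr_eq0 oner_eq0.
have := expf_pred i0; rewrite mE exprM iE exprS exprM sqrrN !expr1n mulr1 => /eqP.
by rewrite eq_sym -subr_eq0 opprK; apply/negP.
Qed.

Lemma omega_ex : (p %% 3 = 1)%N -> exists w : F, w ^+ 2 + w + 1 = 0.
Proof.
move=> e; have [m mE] : exists m, p.-1 = (3 * m)%N.
  by exists (p %/ 3)%N; have := divn_eq p 3; rewrite e; lia.
have [//|w w3 w1] := prim_pow mE; exists w.
have : (w - 1) * (w ^+ 2 + w + 1) = 0.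
  by transitivity (w ^+ 3 - 1); [ring | rewrite w3 subrr].
by move/eqP; rewrite mulf_eq0 subr_eq0 (negPf w1) => /eqP.
Qed.

Lemma nomega (w : F) : (p %% 3 = 2)%N -> w ^+ 2 + w + 1 <> 0.
Proof.
move=> e wE; have [m mE] : exists m, p.-1 = (3 * m).+1.
  by exists (p %/ 3)%N; have := divn_eq p 3; rewrite e; lia.
have w3 : w ^+ 3 = 1.
  apply/eqP; rewrite -subr_eq0; apply/eqP.
  by transitivity ((w - 1) * (w ^+ 2 + w + 1)); [ring | rewrite wE mulr0].
have w0 : w != 0 by apply/eqP => w0; move/eqP: wE; rewrite w0 expr0n /= !add0r oner_eq0.
have := expf_pred w0; rewrite mE exprS exprM w3 expr1n mulr1 => w1.
by move/eqP: wE; rewrite w1 expr1n; apply/negP; rewrite (_ : 1 + 1 + 1 = 3) //; ring.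
Qed.

(** From a square root [y] of -3, [(-1 + y) / 2] would be a primitive cube root of unity. *)
Lemma nsq_m3 : (p %% 3 = 2)%N -> ~ issq (-3).
Proof.
move=> e [y yE]; apply: (@nomega ((-1 + y) / 2) e).
apply: (mulfI n2); apply: (mulfI n2); rewrite !mulr0.
transitivity (y ^+ 2 + 3); first by field.
by rewrite yE addNr.
Qed.

Lemma card_mu4_4 : (p %% 4 = 1)%N -> #|mu4 F| = 4%N.
Proof.
move=> /sqrt_m1[i iE].
have i0 : i != 0.
  by apply/eqP => i0; move/eqP: iE; rewrite i0 expr0n /= eq_sym oppr_eq0 oner_eq0.
have -> : mu4 F = [set 1; -1; i; -i].
  apply/setP => c; rewrite !inE -subr_eq0.
  have -> : c ^+ 4 - 1 = (c - 1) * (c + 1) * (c - i) * (c + i).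
    transitivity ((c ^+ 2 - 1) * (c ^+ 2 - i ^+ 2)); last by ring.
    by rewrite iE; ring.
  by rewrite !mulf_eq0 !subr_eq0 !addr_eq0.
have sq1 (x : F) : x ^+ 2 = 1 -> x != i.
  move=> x1; apply/eqP => xi; move: x1; rewrite xi iE => /eqP.
  by rewrite eq_sym -subr_eq0 opprK; apply/negP.
have i1 : 1 != i by apply: sq1; rewrite expr1n.
have i2 : -1 != i by apply: sq1; rewrite sqrrN expr1n.
have e1 : (1 : F) != -1 by rewrite -subr_eq0 opprK.
have e2 : i != - i by rewrite -subr_eq0 opprK -mulr2n -mulr_natl mulf_neq0.
have i3 : 1 != - i by rewrite -(inj_eq oppr_inj) opprK.
have i4 : -1 != - i by rewrite (inj_eq oppr_inj).
rewrite -!setUA !cardsU1 cards1 !inE.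
by rewrite (negPf e1) (negPf i1) (negPf i2) (negPf e2) (negPf i3) (negPf i4).
Qed.

Lemma card_mu4_2 : (p %% 4 = 3)%N -> #|mu4 F| = 2%N.
Proof.
move=> e; have -> : mu4 F = [set 1; -1].
  apply/setP => c; rewrite !inE -subr_eq0.
  have -> : c ^+ 4 - 1 = (c - 1) * (c + 1) * (c ^+ 2 + 1) by ring.
  rewrite !mulf_eq0 subr_eq0 !addr_eq0 [c ^+ 2 == _](_ : _ = false) ?orbF //.
  by apply/eqP; apply: nsqrt_m1.
by rewrite cards2 -subr_eq0 opprK n2.
Qed.

Lemma card_AF : #|AF F| = (2 * #|[set x : F | [exists y, affine_flex x y]]|)%N.
Proof.
transitivity (\sum_x #|[set y : F | affine_flex x y]|)%N.
  rewrite -sum1_card (eq_bigr (fun x => \sum_(y | affine_flex x y) 1)%N); last first.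
    by move=> x _; rewrite -sum1_card; apply: eq_bigl => y; rewrite inE.
  by rewrite pair_big_dep; apply: eq_bigl => -[x y]; rewrite inE.
rewrite mulnC -sum_nat_const [RHS]big_mkcond /=; apply: eq_bigr => x _; rewrite inE.
case: existsP => [[y hxy]|none]; last first.
  apply/eqP; rewrite cards_eq0; apply/eqP/setP => y; rewrite !inE; apply/negP => h.
  by apply: none; exists y.
have [x0 y0] := affine_flex_neq0 hp hp3 pF hxy.
have -> : [set y | affine_flex x y] = [set y; -y].
  apply/setP => z; rewrite !inE; move: hxy; rewrite /affine_flex => /andP[-> /eqP h2] /=.
  rewrite -h2 -subr_eq0 (_ : _ - _ = 3 * ((z - y) * (z + y))); last by ring.
  by rewrite !mulf_eq0 (negPf n3) subr_eq0 addr_eq0.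
by rewrite cards2 -addr_eq0 -mulr2n -mulr_natl mulf_neq0.
Qed.

(** The quartic says [(x^2 + 3)^2 = 12], so an affine flex needs a square root of 3. *)
Lemma affine_flex_sqrt3 x y : affine_flex x y -> ((x ^+ 2 + 3) / 2) ^+ 2 = 3 :> F.
Proof.
case/andP=> /eqP h1 _; apply: (mulfI n2); apply: (mulfI n2).
transitivity ((x ^+ 4 + 6 * x ^+ 2 - 3) + 12); first by field.
by rewrite h1; ring.
Qed.

Lemma card_AF0 : (forall x y : F, ~~ affine_flex x y) -> #|AF F| = 0%N.
Proof.
by move=> h; apply/eqP; rewrite cards_eq0; apply/eqP/setP => -[x y]; rewrite !inE (negPf (h x y)).
Qed.

(** Here -1 is a square and -3 is not, so 3 has no square root. *)
Lemma card_AF_5 : (p %% 12 = 5)%N -> #|AF F| = 0%N.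
Proof.
move=> e; have [|i iE] := sqrt_m1; first by lia.
apply: card_AF0 => x y; apply/negP => /affine_flex_sqrt3 rE.
case: nsq_m3; first by lia.
by exists (i * ((x ^+ 2 + 3) / 2)); rewrite exprMn iE rE mulN1r.
Qed.

(** Here -3 is a square and -1 is not, so again 3 has no square root. *)
Lemma card_AF_7 : (p %% 12 = 7)%N -> #|AF F| = 0%N.
Proof.
move=> e; have [|w wE] := omega_ex; first by lia.
apply: card_AF0 => x y; apply/negP => /affine_flex_sqrt3 rE.
apply: (@nsqrt_m1 ((2 * w + 1) / ((x ^+ 2 + 3) / 2))); first by lia.
rewrite expr_div_n rE; apply: (mulIf n3); rewrite divfK //.
by transitivity (4 * (w ^+ 2 + w + 1) - 3); [ring | rewrite wE; ring].
Qed.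

(** Neither -1 nor -3 is a square, so 3 is one, and of any two opposite nonzero elements at least
    one is a square. This fixes the signs of [r] and [x], leaving a single [x] with two values of
    [y]. *)
Lemma card_AF_11 : (p %% 12 = 11)%N -> #|AF F| = 2%N.
Proof.
move=> e; have p4 : (p %% 4 = 3)%N by lia.
have p3 : (p %% 3 = 2)%N by lia.
have nm1 : ~ issq (-1) by case=> i; apply: nsqrt_m1.
have nm3 := nsq_m3 p3.
have sqor (x : F) : x != 0 -> issq x \/ issq (- x).
  move=> x0; have [/existsP[y /eqP yE]|/existsPn nx] := boolP [exists y, y ^+ 2 == x].
    by left; exists y.
  right; rewrite -mulN1r; apply: issq_prod => //; first by rewrite oppr_eq0 oner_eq0.
  by case=> y yE; case/negP: (nx y); rewrite yE.
have [r rE] : issq 3.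
  rewrite (_ : 3 = -1 * -3); last by ring.
  by apply: issq_prod => //; rewrite oppr_eq0 ?oner_eq0.
have r0 : r != 0 by apply: contra_eq_neq rE => ->; rewrite expr0n eq_sym.
have {r rE r0} [r [k [rE kE]]] : exists r k : F, r ^+ 2 = 3 /\ k ^+ 2 = 2 * r.
  have [[k kE]|[k kE]] := sqor (2 * r) (mulf_neq0 n2 r0); first by exists r, k.
  by exists (- r), k; rewrite sqrrN kE mulrN.
have r0 : r != 0 by apply: contra_eq_neq rE => ->; rewrite expr0n eq_sym.
have k0 : k != 0.
  by apply: contra_eq_neq kE => ->; rewrite expr0n eq_sym mulf_neq0.
have r1 : r - 1 != 0.
  apply: contra_eq_neq rE => /eqP; rewrite subr_eq0 => /eqP ->; rewrite expr1n.
  by rewrite eq_sym -subr_eq0 (_ : 3 - 1 = 2) //; ring.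
have [x [m [xE mE]]] : exists x m : F, x ^+ 2 = 2 * r - 3 /\ m ^+ 2 = - x.
  (* Since [k^2 = 2 r] and [(r - 1)^2 = 4 - 2 r], this is a square root of [2 r - 3]. *)
  pose x := k * (r - 1) / 2.
  have xE : x ^+ 2 = 2 * r - 3.
    rewrite /x expr_div_n exprMn kE; apply: (mulIf (expf_neq0 2 n2)); rewrite divfK ?expf_neq0 //.
    transitivity (2 * r * (r ^+ 2 - 2 * r + 1)); first by ring.
    rewrite rE; transitivity (8 * r - 4 * r ^+ 2); first by ring.
    by rewrite rE; ring.
  have x0 : x != 0 by rewrite !mulf_neq0 ?invr_eq0.
  have [[m mE]|[m mE]] := sqor x x0; last by exists x, m.
  by exists (- x), m; rewrite sqrrN opprK.
have hx : x ^+ 4 + 6 * x ^+ 2 - 3 = 0.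
  transitivity ((x ^+ 2) ^+ 2 + 6 * x ^+ 2 - 3); first by ring.
  rewrite xE; transitivity (4 * r ^+ 2 - 12); first by ring.
  by rewrite rE; ring.
(* As [x^2 + 3 = 2 r], the cubic asks for [3 y^2 = - 2 r x], which is [k^2 m^2], and [3 = r^2]. *)
have hxy : affine_flex x (k * m / r).
  apply/andP; split; first by rewrite hx.
  rewrite expr_div_n exprMn kE mE rE mulrC divfK //; apply/eqP.
  transitivity (x * (x ^+ 2 - (2 * r - 3))); first by ring.
  by rewrite xE subrr mulr0.
have [x0 y0] := affine_flex_neq0 hp hp3 pF hxy.
rewrite card_AF (_ : [set _ | _] = [set x]) ?cards1 //.
apply/setP => x'; rewrite !inE; apply/existsP/eqP => [[y' hxy']|->]; last by exists (k * m / r).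
case/andP: (hxy') => /eqP hx' /eqP hy'; case/andP: hxy => _ /eqP hy.
have : (x' - x) * ((x' + x) * (x' ^+ 2 + x ^+ 2 + 6)) = 0.
  transitivity ((x' ^+ 4 + 6 * x' ^+ 2 - 3) - (x ^+ 4 + 6 * x ^+ 2 - 3)); first by ring.
  by rewrite hx hx' subrr.
(* The root [- x] would make -1 a square, as the quotient of two values of [y^2]; a root of the
   other factor would make -3 the square of [x' x]. *)
move/eqP; rewrite !mulf_eq0 subr_eq0 addr_eq0 => /or3P[/eqP //|/eqP xx|/eqP xx].
  case: nm1; exists (y' / (k * m / r)); rewrite expr_div_n.
  apply: (mulIf (expf_neq0 2 y0)); rewrite divfK ?expf_neq0 //; apply: (mulfI n3).
  apply/eqP; rewrite -subr_eq0; apply/eqP.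
  transitivity ((3 * y' ^+ 2 + x' ^+ 3 + 3 * x') + (3 * (k * m / r) ^+ 2 + x ^+ 3 + 3 * x)).
    by rewrite xx; ring.
  by rewrite hy hy' addr0.
case: nm3; exists (x' * x).
have -> : (x' * x) ^+ 2 = x ^+ 2 * (x' ^+ 2 + x ^+ 2 + 6) - (x ^+ 4 + 6 * x ^+ 2 - 3) - 3 by ring.
by rewrite xx hx; ring.
Qed.

(** The quartic gives [(x^2 + 3) (1 - x^2) = 4 x^2], so the squared element is just [x y]; and the
    Hessian equation [x y^2 = x^2 - 1] gives [(x y)^2 = x^3 - x]. *)
Lemma affine_flex_Vp x y : affine_flex x y ->
  (y * (x ^+ 2 + 3) * (1 - x ^+ 2) / (4 * x)) ^+ 2 = x ^+ 3 - x :> F.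
Proof.
move=> hxy; have [x0 y0] := affine_flex_neq0 hp hp3 pF hxy; case/andP: hxy => /eqP h1 /eqP h2.
have n4 : (4 : F) != 0 by rewrite (_ : 4 = 2 * 2) ?mulf_neq0 //; ring.
rewrite expr_div_n; apply: (mulIf (expf_neq0 2 (mulf_neq0 n4 x0))); rewrite divfK ?expf_neq0 ?mulf_neq0 //.
apply: (mulfI n3); apply/eqP; rewrite -subr_eq0; apply/eqP.
transitivity ((x ^+ 2 + 3) ^+ 2 * (1 - x ^+ 2) ^+ 2 * (3 * y ^+ 2 + x ^+ 3 + 3 * x)
  - x * (x ^+ 2 - 1) * (x ^+ 4 + 6 * x ^+ 2 - 3) * (x ^+ 4 + 2 * x ^+ 2 + 9 - 12)
  - x * (x ^+ 2 - 1) * 12 * (x ^+ 4 + 6 * x ^+ 2 - 3)).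
  by ring.
by rewrite h1 h2; ring.
Qed.

(** The inverse of the previous map: modulo the quartic the second coordinate is [y / x]. *)
Lemma Vp_affine_flex x y : x ^+ 4 + 6 * x ^+ 2 - 3 = 0 -> y ^+ 2 = x ^+ 3 - x :> F ->
  affine_flex x (4 * x * y / ((x ^+ 2 + 3) * (1 - x ^+ 2))).
Proof.
move=> h1 h2; rewrite /affine_flex h1 eqxx /=.
have d1 : x ^+ 2 + 3 != 0.
  apply/eqP => e; have : (12 : F) == 0.
    apply/eqP; transitivity ((x ^+ 2 + 3) * (x ^+ 2 + 3) - (x ^+ 4 + 6 * x ^+ 2 - 3)); first by ring.
    by rewrite h1 e; ring.
  by rewrite (_ : 12 = 2 * (2 * 3)) ?mulf_eq0 ?(negPf n2) ?(negPf n3) //; ring.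
have d2 : 1 - x ^+ 2 != 0.
  apply/eqP => e; have : (4 : F) == 0.
    apply/eqP; transitivity ((x ^+ 4 + 6 * x ^+ 2 - 3) + (1 - x ^+ 2) * (x ^+ 2 + 7)); first by ring.
    by rewrite h1 e; ring.
  by rewrite (_ : 4 = 2 * 2) ?mulf_eq0 ?(negPf n2) //; ring.
have d0 := mulf_neq0 d1 d2; apply/eqP; apply: (mulIf (expf_neq0 2 d0)); rewrite mul0r.
transitivity (48 * x ^+ 2 * y ^+ 2 + (x ^+ 3 + 3 * x) * ((x ^+ 2 + 3) * (1 - x ^+ 2)) ^+ 2).
  by field; rewrite d1 d2.
rewrite h2; transitivity (x * (x ^+ 2 - 1) * (x ^+ 4 + 6 * x ^+ 2 - 3) * (x ^+ 4 + 2 * x ^+ 2 + 9)).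
  by ring.
by rewrite h1; ring.
Qed.

(** One affine flex yields all: multiplication by [i] on the curve sends [(x, y)] to [(- x, i y)],
    and the roots [x1] and [- x1] of the quartic come from [(x x1)^2 = -3 = (i r)^2]. Four roots
    with two values of [y] each make 8. *)
Lemma card_AF_1 : (p %% 12 = 1)%N -> (exists x y : F, affine_flex x y) -> #|AF F| = 8%N.
Proof.
move=> e [x [y hxy]]; have [|i iE] := sqrt_m1; first by lia.
have [x0 y0] := affine_flex_neq0 hp hp3 pF hxy.
have rE := affine_flex_sqrt3 hxy; set r := (x ^+ 2 + 3) / 2 in rE.
have xr : x ^+ 2 = 2 * r - 3 by rewrite /r; field.
case/andP: hxy => /eqP h1 /eqP h2.
have i0 : i != 0.
  by apply/eqP => i0; move/eqP: iE; rewrite i0 expr0n /= eq_sym oppr_eq0 oner_eq0.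
have r0 : r != 0 by apply: contra_eq_neq rE => ->; rewrite expr0n eq_sym.
have r1 : r - 1 != 0.
  apply: contra_eq_neq rE => /eqP; rewrite subr_eq0 => /eqP ->; rewrite expr1n.
  by rewrite eq_sym -subr_eq0 (_ : 3 - 1 = 2) //; ring.
(* The cubic requires [y1^2 / y^2 = - x1 / x = i r / x^2]. As [x^2 = r (r - 1)^2 / 2] and
   [2 i = (1 + i)^2], this is the square of [(1 + i) / (r - 1)]. *)
pose x1 := - (i * r) / x; pose y1 := y * (1 + i) / (r - 1).
have x10 : x1 != 0 by rewrite mulf_neq0 ?invr_eq0 // oppr_eq0 mulf_neq0.
have x1E : x1 ^+ 2 = - x ^+ 2 - 6.
  rewrite /x1 expr_div_n sqrrN exprMn iE rE; apply: (mulIf (expf_neq0 2 x0)); rewrite divfK ?expf_neq0 //.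
  apply/eqP; rewrite -subr_eq0; apply/eqP; transitivity (x ^+ 4 + 6 * x ^+ 2 - 3); [ring | exact: h1].
have x1x : x1 * x = - (i * r) by rewrite /x1 divfK.
have hx1 : x1 ^+ 4 + 6 * x1 ^+ 2 - 3 = 0.
  transitivity ((x1 ^+ 2) ^+ 2 + 6 * x1 ^+ 2 - 3); first by ring.
  by rewrite x1E -h1; ring.
have hy1 : 3 * y1 ^+ 2 + x1 ^+ 3 + 3 * x1 = 0.
  have rr : (r - 1) ^+ 2 = 4 - 2 * r by transitivity (r ^+ 2 - 2 * r + 1); [ring | rewrite rE; ring].
  have q1 : y1 ^+ 2 * (4 - 2 * r) = y ^+ 2 * (2 * i).
    rewrite -rr /y1 expr_div_n divfK ?expf_neq0 // exprMn; congr (_ * _).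
    by transitivity (1 + 2 * i + i ^+ 2); [ring | rewrite iE; ring].
  have q2 : 3 * y ^+ 2 = - (2 * r) * x.
    apply/eqP; rewrite -subr_eq0; apply/eqP.
    transitivity (3 * y ^+ 2 + x ^+ 3 + 3 * x - x * (x ^+ 2 - (2 * r - 3))); first by ring.
    by rewrite h2 xr; ring.
  have q3 : 4 - 2 * r != 0 by rewrite -rr expf_neq0.
  apply: (mulIf q3); apply: (mulIf x0); rewrite !mul0r.
  transitivity (3 * (y1 ^+ 2 * (4 - 2 * r)) * x + (x1 * x) * (x1 ^+ 2 + 3) * (4 - 2 * r)); first by ring.
  rewrite q1 x1x x1E.
  transitivity (2 * i * x * (3 * y ^+ 2) + i * r * (x ^+ 2 + 3) * (4 - 2 * r)); first by ring.
  rewrite q2; transitivity (i * r * ((x ^+ 2 + 3) * (4 - 2 * r) - 4 * x ^+ 2)); first by ring.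
  rewrite xr; transitivity (i * r * (12 - 4 * r ^+ 2)); first by ring.
  by rewrite rE; ring.
have neg x' y' : 3 * y' ^+ 2 + x' ^+ 3 + 3 * x' = 0 -> 3 * (i * y') ^+ 2 + (- x') ^+ 3 + 3 * (- x') = 0 :> F.
  move=> h; transitivity (- (3 * y' ^+ 2 + x' ^+ 3 + 3 * x') + (i ^+ 2 + 1) * 3 * y' ^+ 2); first by ring.
  by rewrite h iE; ring.
rewrite card_AF (_ : [set _ | _] = [set x; -x; x1; -x1]); last first.
  apply/setP => z; rewrite !inE; apply/existsP/idP.
    case=> y' /andP[/eqP hz _].
    have : (z - x) * (z + x) * (z - x1) * (z + x1) = 0.
      transitivity ((z ^+ 2 - x ^+ 2) * (z ^+ 2 - x1 ^+ 2)); first by ring.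
      rewrite x1E; transitivity ((z ^+ 4 + 6 * z ^+ 2 - 3) - (x ^+ 4 + 6 * x ^+ 2 - 3)); first by ring.
      by rewrite hz h1 subrr.
    by move/eqP; rewrite !mulf_eq0 !subr_eq0 !addr_eq0.
  rewrite /affine_flex; case/orP=> [/orP[/orP[]|]|] /eqP ->.
  - by exists y; rewrite h1 h2 !eqxx.
  - by exists (i * y); rewrite neg // eqxx andbT -h1; apply/eqP; ring.
  - by exists y1; rewrite hx1 hy1 !eqxx.
  - by exists (i * y1); rewrite neg // eqxx andbT -hx1; apply/eqP; ring.
have dbl0 (z : F) : z != 0 -> z != - z.
  by move=> z0; rewrite -subr_eq0 opprK -mulr2n -mulr_natl mulf_neq0.
have nx (z : F) : z ^+ 2 = x ^+ 2 -> z != x1.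
  move=> zE; apply/eqP => zx; move: zE; rewrite zx x1E => /eqP.
  rewrite eq_sym -subr_eq0 (_ : _ - _ = 2 * (x ^+ 2 + 3)); last by ring.
  by rewrite mulf_eq0 (negPf n2) xr subrK mulf_eq0 (negPf n2) (negPf r0).
have a1 : x != x1 by apply: nx.
have a2 : - x != x1 by apply: nx; rewrite sqrrN.
have a3 : x != - x1 by rewrite -(inj_eq oppr_inj) opprK.
have a4 : - x != - x1 by rewrite (inj_eq oppr_inj).
rewrite -!setUA !cardsU1 cards1 !inE (negPf (dbl0 x x0)) (negPf (dbl0 x1 x10)).
by rewrite (negPf a1) (negPf a2) (negPf a3) (negPf a4).
Qed.

Lemma card_mu4_cases : (p %% 4 = 1 -> #|mu4 F| = 4)%N /\ (p %% 4 = 3 -> #|mu4 F| = 2)%N.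
Proof. by split; [apply: card_mu4_4 | apply: card_mu4_2]. Qed.
End Arithmetic.

(** * Isomorphism classes of descendants as orbits *)

Section Classes.
Variables (p : nat) (F : finFieldType) (nv : F -> nat).
Hypothesis hp : prime p.
Hypothesis hp3 : (3 < p)%N.
Hypothesis pF : p \in [pchar F].
Hypothesis cF : #|F| = p.
Hypothesis nvK : forall a, (nv a)%:R = a.
Local Notation G := (simil_grp hp hp3 pF).

Lemma num_iso_classes_orbits :
  num_iso_classes (desc10 p) #|orbit 'P G @: [set: vec F]|.
Proof.
set O := orbit _ _ @: _.
have repP (i : 'I_#|O|) : exists al : vec F, enum_val i == orbit 'P G al.
  by have /imsetP[al _ ->] := enum_valP i; exists al.
pose r i := xchoose (repP i).
have rP i : enum_val i = orbit 'P G (r i) by apply/eqP/(xchooseP (repP i)).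
exists (fun i => mgrp (r i)), (fun i => [set: mgrp (r i)]%G); split.
- by move=> i; apply: (model_desc10 hp hp3 pF cF nvK).
- move=> i j /(simil_of_isog hp hp3 pF nvK)[s sG sE].
  apply: enum_val_inj; rewrite !rP; apply/esym/orbit_eqP; rewrite -sE.
  by apply/orbitP; exists s.
move=> gT H /(classify hp hp3 pF cF nvK)[al alH].
have alO : orbit 'P G al \in O by apply: imset_f; rewrite inE.
have [k kE] : exists k : 'I_#|O|, enum_val k = orbit 'P G al.
  by exists (enum_rank_in alO (orbit 'P G al)); apply: (enum_rankK_in alO alO).
exists k; have : r k \in orbit 'P G al by rewrite -kE rP orbit_refl.
case/orbitP=> s sG <-; apply: (isog_trans alH).
exact: (isog_of_simil hp hp3 pF cF nvK).
Qed.

End Classes.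

(* Solving the orbit equation for each residue of [p] modulo 12 *)
Local Close Scope ring_scope.

(** Without affine flexes every similitude has a flex eigenvector, so [e = 0] and the equation gives
    [n] directly. *)
Lemma orbit_number_4 m r n e : (r = 5) \/ (r = 1) -> e <= 3 * 0 -> 0 < n ->
  let p := m * 12 + r in
  n.-1 * (1 * 4) = p ^ 2 + p + 1 + 1 * (p + 2 + 3 * (4 - 2)) + e ->
  (p + 1) ^ 2 %/ 4 + 3 = n.
Proof.
move=> hr le n0 p eq.
(* Exhibiting the factor 4 makes the division exact; the parameter [r] covers the residues 5 and 1,
   since [r./2.+1] is 3 or 1. *)
have -> : (p + 1) ^ 2 = ((6 * m + r./2.+1) * (6 * m + r./2.+1)) * 4.
  by rewrite /p; case: hr => ->; rewrite !expnS expn0 /=; ring.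
rewrite mulnK //; move: eq; rewrite /p !expnS expn0.
by case: hr => ->; rewrite /=; lia.
Qed.

Lemma orbit_number_2 m n e : e <= 3 * 0 -> 0 < n ->
  let p := m * 12 + 7 in
  n.-1 * (1 * 2) = p ^ 2 + p + 1 + 1 * (p + 2 + 3 * (2 - 2)) + e ->
  (p + 1) ^ 2 %/ 2 + 2 = n.
Proof.
move=> le n0 p eq.
have -> : (p + 1) ^ 2 = (8 * ((3 * m + 2) * (3 * m + 2))) * 2 by rewrite /p !expnS expn0; ring.
by rewrite mulnK //; move: eq; rewrite /p !expnS expn0; lia.
Qed.

(* Divisibility by 6 and the bound on [e] leave only [e = 2]. *)
Lemma orbit_number_6 m n e : e <= 3 * 2 -> 0 < n ->
  let p := m * 12 + 11 in
  n.-1 * (3 * 2) = p ^ 2 + p + 1 + 3 * (p + 2 + 3 * (2 - 2)) + e ->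
  (p + 1) ^ 2 %/ 6 + (p + 1) %/ 3 + 2 = n.
Proof.
move=> le n0 p eq.
have -> : (p + 1) ^ 2 = (24 * (m.+1 * m.+1)) * 6 by rewrite /p !expnS expn0; ring.
have -> : p + 1 = (4 * m.+1) * 3 by rewrite /p; ring.
by rewrite !mulnK //; move: eq; rewrite /p !expnS expn0; lia.
Qed.

(* Here the same argument leaves only [e = 24]. *)
Lemma orbit_number_36 m n e : e <= 3 * 8 -> 0 < n ->
  let p := m * 12 + 1 in
  n.-1 * (9 * 4) = p ^ 2 + p + 1 + 9 * (p + 2 + 3 * (4 - 2)) + e ->
  (p - 1) ^ 2 %/ 36 + (p - 1) %/ 3 + 4 = n.
Proof.
move=> le n0 p eq; have -> : p - 1 = (4 * m) * 3 by rewrite /p addnK; ring.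
have -> : (4 * m * 3) ^ 2 = (4 * (m * m)) * 36 by rewrite !expnS expn0; ring.
by rewrite !mulnK //; move: eq; rewrite /p !expnS expn0; lia.
Qed.

Theorem theorem1 (p : nat) (hp : prime p) (hp3 : 3 < p) :
  [/\ p %% 12 = 5 -> num_iso_classes (desc10 p) ((p + 1) ^ 2 %/ 4 + 3),
      p %% 12 = 7 -> num_iso_classes (desc10 p) ((p + 1) ^ 2 %/ 2 + 2),
      p %% 12 = 11 ->
        num_iso_classes (desc10 p) ((p + 1) ^ 2 %/ 6 + (p + 1) %/ 3 + 2),
      p %% 12 = 1 -> Vp p = 0 ->
        num_iso_classes (desc10 p) ((p + 1) ^ 2 %/ 4 + 3) &
      p %% 12 = 1 -> Vp p <> 0 ->
        num_iso_classes (desc10 p) ((p - 1) ^ 2 %/ 36 + (p - 1) %/ 3 + 4)]%N.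
Proof.
have pF := pchar_Fp hp; have cF := card_Fp hp.
have nvK (a : 'F_p) : (a : nat)%:R%R = a := natr_Zp a.
have [e [le [eq n0]]] := orbit_equation hp hp3 (pchar_Fp hp) cF nvK.
have main := num_iso_classes_orbits hp hp3 (pchar_Fp hp) cF nvK.
have A5 := card_AF_5 hp hp3 pF cF; have A7 := card_AF_7 hp hp3 pF cF.
have A11 := card_AF_11 hp hp3 pF cF; have A1 := card_AF_1 hp hp3 pF cF.
have [M1 M3] := card_mu4_cases hp hp3 pF cF.
(* Points counted by [Vp] and affine flexes have the same first coordinates, so one set is empty
   exactly when the other is. *)
have V0 : Vp p = 0 -> #|AF 'F_p| = 0.
  move=> v0; apply: card_AF0 => x y; apply/negP => hxy.
  move/eqP: v0; rewrite cards_eq0 => /eqP/setP.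
  move/(_ (x, y * (x ^+ 2 + 3) * (1 - x ^+ 2) / (4 * x))%R); rewrite !inE /=.
  by rewrite (affine_flex_Vp hp hp3 pF hxy) eqxx andbT; case/andP: hxy => ->.
have V1 : Vp p <> 0 -> exists x y : 'F_p, affine_flex x y.
  move/eqP; rewrite cards_eq0 => /set0Pn[[x y]]; rewrite inE /= => /andP[/eqP h1 /eqP h2].
  exists x, (4 * x * y / ((x ^+ 2 + 3) * (1 - x ^+ 2)))%R.
  exact: (Vp_affine_flex hp3 pF h1 h2).
move: eq le n0 main A5 A7 A11 A1 M1 M3 V0 V1.
move: #|_ @: _| #|AF _| #|mu4 _| => n A k eq le n0 main A5 A7 A11 A1 M1 M3 V0 V1.
have p12 := divn_eq p 12.
set m := p %/ 12 in p12.
split=> pm; rewrite pm in p12.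
- rewrite A5 // M1 in eq le; last by lia.
  suff -> : (p + 1) ^ 2 %/ 4 + 3 = n by [].
  by move: eq; rewrite p12; apply: orbit_number_4 => //; left.
- rewrite A7 // M3 in eq le; last by lia.
  suff -> : (p + 1) ^ 2 %/ 2 + 2 = n by [].
  by move: eq; rewrite p12; apply: orbit_number_2.
- rewrite A11 // M3 in eq le; last by lia.
  suff -> : (p + 1) ^ 2 %/ 6 + (p + 1) %/ 3 + 2 = n by [].
  by move: eq; rewrite p12; apply: orbit_number_6.
- move=> /V0 v0; rewrite v0 M1 in eq le; last by lia.
  suff -> : (p + 1) ^ 2 %/ 4 + 3 = n by [].
  by move: eq; rewrite p12; apply: orbit_number_4 => //; right.
move=> /V1 v1; rewrite A1 // M1 in eq le; last by lia.
suff -> : (p - 1) ^ 2 %/ 36 + (p - 1) %/ 3 + 4 = n by [].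
by move: eq; rewrite p12; apply: orbit_number_36.
Qed.
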